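(* Let $(M,g)$ have dimension $2n$ and let $\hat{\varphi}$ denote a nowhere vanishing pure spinor field on it. The following hold depending on the dimension: (1) $2n=4$: If $\hat{\varphi}$ is a twistor with respect to some spinorial connection, then the maximally isotropic distribution generated by $\hat{\varphi}$ is integrable. Conversely, if $\hat{\varphi}$ generates an integrable distribution, then one can always choose the $1$-form $A$ (i.e. the spinorial connection) so that $\hat{\varphi}$ obeys the twistor equation. (2) $2n=6$: The fact that $\hat{\varphi}$ obeys the twistor equation does not imply that the distribution generated by $\hat{\varphi}$ is integrable; that is, there exist a six-dimensional $(M,g)$, a spinorial connection and a pure spinor field $\hat\varphi$ that is a twistor, whose generated distribution is not integrable. Conversely, the integrability of the distribution generated by $\hat{\varphi}$ does not guarantee that one can choose $A$ so that $\hat{\varphi}$ obeys the twistor equation; that is, there exist a six-dimensional $(M,g)$ and a pure spinor field $\hat\varphi$ generating an integrable distribution such that $\hat\varphi$ is not a twistor for any choice of $A$. (3) $2n\geq8$: If $\hat{\varphi}$ is a twistor with respect to some spinorial connection, then the maximally isotropic distribution generated by $\hat{\varphi}$ is integrable. On the other hand, the integrability of the distribution generated by $\hat{\varphi}$ does not imply that one can find $A$ such that $\hat{\varphi}$ obeys the twistor equation; that is, in each such dimension there exist $(M,g)$ and a pure spinor field $\hat\varphi$ generating an integrable distribution such that $\hat\varphi$ is not a twistor for any choice of $A$.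
   Context: $(M,g)$ is a smooth $2n$-dimensional manifold with a non-degenerate metric $g$ of arbitrary signature; $\nabla$ is its Levi-Civita connection. Vector fields are sections of the complexified tangent bundle, and $g$, $\nabla$ and the Lie bracket are extended complex-linearly. All results are local: $M$ is replaced by a small open set on which there is a frame $\{e_i,\theta^j\}_{i,j=1}^n$ of the complexified tangent bundle with $g(e_i,e_j)=0$, $g(\theta^i,\theta^j)=0$, $g(e_i,\theta^j)=\frac12\delta_i^j$. Let $V=\mathrm{Span}\{e_i\}$, and identify $\mathrm{Span}\{\theta^j\}$ with the dual bundle $V^*$ via $\theta^j(e_i)=\delta^j_i$. The spinor bundle is $S=\wedge V^*$ with Clifford action $(e+\theta)\cdot\hat\varphi=e\lrcorner\hat\varphi+\theta\wedge\hat\varphi$ for $e\in V,\theta\in V^*$; thus $(vu+uv)\cdot\hat\varphi=2g(v,u)\hat\varphi$. A spinorial connection is a connection $\hat\nabla$ on $S$ satisfying the Leibniz rule $\hat\nabla_X(v\cdot\hat\varphi)=(\nabla_Xv)\cdot\hat\varphi+v\cdot\hat\nabla_X\hat\varphi$ for all vector fields $X,v$ and spinor fields $\hat\varphi$. Write $e_{i+n}=\theta^i$, so $\{e_a\}_{a=1}^{2n}$ is the frame; $g_{ab}=g(e_a,e_b)$ with inverse $g^{ab}$; $\nabla_{e_a}e_b=\omega_{ab}{}^{c}e_c$ and $\omega_a{}^{dc}=g^{bd}\omega_{ab}{}^{c}$. In the spinor frame $\{\hat\psi_\alpha\}$ given by wedge products of the $\theta^i$, the spinorial connections are exactly those given by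 $\hat\nabla_{e_a}\hat\psi_\alpha=-\frac14\omega_a{}^{bc}\,e_b\cdot(e_c\cdot\hat\psi_\alpha)+A_a\hat\psi_\alpha$ with $A$ an arbitrary (complex-valued) $1$-form; choosing $A$ means choosing $\hat\nabla$. The Dirac operator is $\hat{\boldsymbol D}=g^{ab}e_a\cdot\hat\nabla_{e_b}$ and the twistor operator is $\hat{\boldsymbol T}_X\hat\psi=\hat\nabla_X\hat\psi-\frac1{2n}X\cdot\hat{\boldsymbol D}\hat\psi$. A spinor field $\hat\psi$ is a twistor (obeys the twistor equation), with respect to $\hat\nabla$, if $\hat{\boldsymbol T}_X\hat\psi=0$ for all vector fields $X$. A nowhere vanishing spinor field $\hat\varphi$ is pure if at each point the (necessarily isotropic) space $N_{\hat\varphi}=\{v: v\cdot\hat\varphi=0\}$ of complexified tangent vectors has the maximal possible dimension $n$; $N_{\hat\varphi}$ is then the maximally isotropic distribution generated by $\hat\varphi$. A distribution is integrable if it is closed under Lie brackets. *)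

(* Defs.v *)
From HB Require Import structures.
From mathcomp Require Import all_boot all_order all_algebra.
From mathcomp Require Import complex.
From mathcomp Require Import boolp classical_sets functions reals topology.
From mathcomp Require Import normedtype derive.

Set Implicit Arguments.
Unset Strict Implicit.
Unset Printing Implicit Defensive.

Import Order.TTheory GRing.Theory Num.Theory.
Import numFieldNormedType.Exports.
Local Open Scope classical_set_scope.
Local Open Scope ring_scope.

Section Calculus.
Context {R : realType} {m : nat}.
Implicit Types (U : set 'rV[R]_m) (x : 'rV[R]_m).

Definition partial (i : 'I_m) (f : 'rV[R]_m -> R) : 'rV[R]_m -> R :=
  fun x => 'D_(delta_mx 0 i) f x.

(* Functions and fields "on U" are total functions whose values outside U are
   irrelevant; U is always open, so derivatives at points of U only see U. *)
Definition smooth U (f : 'rV[R]_m -> R) : Prop :=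
  forall (s : seq 'I_m) x, U x -> differentiable (foldr partial f s) x.

Definition csmooth U (f : 'rV[R]_m -> R[i]) : Prop :=
  smooth U (fun x => complex.Re (f x)) /\ smooth U (fun x => complex.Im (f x)).

Definition cpartial (i : 'I_m) (f : 'rV[R]_m -> R[i]) : 'rV[R]_m -> R[i] :=
  fun x => (partial i (fun y => complex.Re (f y)) x +i*
            partial i (fun y => complex.Im (f y)) x)%C.

(* Complexified vector fields, by their components in the coordinate basis. *)
Definition vfield := 'rV[R]_m -> 'rV[R[i]]_m.

Definition smooth_vfield U (X : vfield) : Prop :=
  forall k, csmooth U (fun x => X x 0 k).

Definition vderiv (v : 'rV[R[i]]_m) (f : 'rV[R]_m -> R[i]) x : R[i] :=
  \sum_i v 0 i * cpartial i f x.

Definition lie_bracket (X Y : vfield) : vfield := fun x =>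
  \row_k (vderiv (X x) (fun y => Y y 0 k) x - vderiv (Y x) (fun y => X y 0 k) x).

End Calculus.
Arguments vfield : clear implicits.

Section ExteriorAlgebra.
Context {R : realType} {n : nat}.

(* The exterior algebra of V^*: the coefficient of s at I = {i1 < ... < ik} is
   that of theta^i1 /\ ... /\ theta^ik. *)
Definition spinor := {ffun {set 'I_n} -> R[i]^o}.

Definition koszul_sign (j : 'I_n) (I : {set 'I_n}) : R[i] :=
  (-1) ^+ #|[set i in I | (i < j)%N]|.

Definition wedge (j : 'I_n) (s : spinor) : spinor :=
  [ffun I : {set 'I_n} =>
    if j \in I then koszul_sign j (I :\ j) * s (I :\ j) else 0].

Definition contract (j : 'I_n) (s : spinor) : spinor :=
  [ffun I : {set 'I_n} =>
    if j \in I then 0 else koszul_sign j I * s (j |: I)].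

End ExteriorAlgebra.
Arguments spinor : clear implicits.

(* A coordinate domain of a 2n-dimensional pseudo-Riemannian manifold carrying
   a null frame of its complexified tangent bundle: e_i is frame (lshift n i),
   and theta^i = e_(i+n) is frame (rshift n i). *)
Record framed_domain (R : realType) (n : nat) := FramedDomain {
  domain : set 'rV[R]_(n + n);
  metric : 'rV[R]_(n + n) -> 'M[R]_(n + n);
  frame : 'I_(n + n) -> vfield R (n + n);
  cmetric := fun x (u v : 'rV[R[i]]_(n + n)) =>
    (u *m map_mx (real_complex R) (metric x) *m v^T) 0 0 : R[i];
  domain_open : open domain;
  metric_smooth : forall i j, smooth domain (fun x => metric x i j);
  metric_sym : forall x, domain x -> (metric x)^T = metric x;
  metric_nondegenerate : forall x, domain x -> metric x \in unitmx;
  frame_smooth : forall a, smooth_vfield domain (frame a);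
  frame_ee : forall x (i j : 'I_n), domain x ->
    cmetric x (frame (lshift n i) x) (frame (lshift n j) x) = 0;
  frame_tt : forall x (i j : 'I_n), domain x ->
    cmetric x (frame (rshift n i) x) (frame (rshift n j) x) = 0;
  frame_et : forall x (i j : 'I_n), domain x ->
    cmetric x (frame (lshift n i) x) (frame (rshift n j) x)
      = 2%:R^-1 * (i == j)%:R
}.

Section Geometry.
Context {R : realType} {n : nat}.
Variable M : framed_domain R n.
Notation C := R[i].
Notation point := 'rV[R]_(n + n).
Notation field := (vfield R (n + n)).
Notation spinor_field := (point -> spinor R n).
Implicit Types (x : point) (X Y : field) (phi : spinor_field).

Definition christoffel x (k i j : 'I_(n + n)) : R :=
  2%:R^-1 * \sum_l invmx (metric M x) k l *
    (partial i (fun y => metric M y j l) x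
     + partial j (fun y => metric M y i l) x
     - partial l (fun y => metric M y i j) x).

Definition levi_civita X Y : field := fun x =>
  \row_k (vderiv (X x) (fun y => Y y 0 k) x
          + \sum_i \sum_j (christoffel x k i j)%:C%C * X x 0 i * Y x 0 j).

(* The entry (frame_coord x v) 0 a is v^a, where v = v^a e_a at x. *)
Definition frame_coord x (v : 'rV[C]_(n + n)) : 'rV[C]_(n + n) :=
  v *m invmx (\matrix_a frame M a x).

Definition frame_metric x : 'M[C]_(n + n) :=
  \matrix_(a, b) cmetric M x (frame M a x) (frame M b x).

Definition frame_metric_inv x : 'M[C]_(n + n) := invmx (frame_metric x).

(* omega x a b c is omega_{ab}^c, and omega_up x a d c is omega_a^{dc}. *)
Definition omega x (a b c : 'I_(n + n)) : C :=
  frame_coord x (levi_civita (frame M a) (frame M b) x) 0 c.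

Definition omega_up x (a d c : 'I_(n + n)) : C :=
  \sum_b frame_metric_inv x b d * omega x a b c.

Definition clifford x (v : 'rV[C]_(n + n)) (s : spinor R n) : spinor R n :=
  \sum_(i < n) frame_coord x v 0 (lshift n i) *: contract i s
  + \sum_(i < n) frame_coord x v 0 (rshift n i) *: wedge i s.

Definition smooth_spinor_field phi : Prop :=
  forall I, csmooth (domain M) (fun x => phi x I).

Definition spinor_vderiv (v : 'rV[C]_(n + n)) phi x : spinor R n :=
  [ffun I : {set 'I_n} => vderiv v (fun y => phi y I) x].

Definition spinor_operator := field -> spinor_field -> spinor_field.
Implicit Types nabla : spinor_operator.

(* Linearity over functions smooth on the domain makes nabla X phi on the
   domain depend only on the values of X and phi there: multiply a field
   vanishing on the domain by the indicator function of the complement. *)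
Record spinorial_connection nabla : Prop := SpinorialConnection {
  spinorial_smooth : forall X phi,
    smooth_vfield (domain M) X -> smooth_spinor_field phi ->
    smooth_spinor_field (nabla X phi);
  spinorial_linear_vfield : forall (f : point -> C) X Y phi x,
    csmooth (domain M) f -> smooth_vfield (domain M) X ->
    smooth_vfield (domain M) Y -> smooth_spinor_field phi -> domain M x ->
    nabla (fun y => f y *: X y + Y y) phi x
      = f x *: nabla X phi x + nabla Y phi x;
  spinorial_additive : forall X phi chi x,
    smooth_vfield (domain M) X -> smooth_spinor_field phi ->
    smooth_spinor_field chi -> domain M x ->
    nabla X (fun y => phi y + chi y) x = nabla X phi x + nabla X chi x;
  spinorial_leibniz : forall (f : point -> C) X phi x,
    csmooth (domain M) f -> smooth_vfield (domain M) X ->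
    smooth_spinor_field phi -> domain M x ->
    nabla X (fun y => f y *: phi y) x
      = vderiv (X x) f x *: phi x + f x *: nabla X phi x;
  spinorial_clifford : forall X (v : field) phi x,
    smooth_vfield (domain M) X -> smooth_vfield (domain M) v ->
    smooth_spinor_field phi -> domain M x ->
    nabla X (fun y => clifford y (v y) (phi y)) x
      = clifford x (levi_civita X v x) (phi x)
        + clifford x (v x) (nabla X phi x)
}.

(* A complex 1-form, given by its frame components A_a = A(e_a). *)
Definition smooth_one_form (A : point -> 'rV[C]_(n + n)) : Prop :=
  forall a, csmooth (domain M) (fun x => A x 0 a).

(* The extension, by the Leibniz rule and linearity in X, of
   nabla_{e_a} psi = - 1/4 omega_a^{bc} e_b . (e_c . psi) + A_a psi,
   prescribed on the constant-coefficient spinors psi. *)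
Definition spin_conn (A : point -> 'rV[C]_(n + n)) : spinor_operator :=
  fun X phi x => \sum_a frame_coord x (X x) 0 a *:
    (spinor_vderiv (frame M a x) phi x
     - 4%:R^-1 *: (\sum_b \sum_c omega_up x a b c *:
         clifford x (frame M b x) (clifford x (frame M c x) (phi x)))
     + A x 0 a *: phi x).

Definition dirac nabla phi : spinor_field := fun x =>
  \sum_a \sum_b frame_metric_inv x a b *:
    clifford x (frame M a x) (nabla (frame M b) phi x).

Definition twistor_operator nabla X phi : spinor_field := fun x =>
  nabla X phi x - (2 * n)%:R^-1 *: clifford x (X x) (dirac nabla phi x).

Definition is_twistor nabla phi : Prop :=
  forall X x, smooth_vfield (domain M) X -> domain M x ->
    twistor_operator nabla X phi x = 0.

Definition annihilator phi x : {vspace 'rV[C]_(n + n)} :=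
  lker (linfun (fun v => clifford x v (phi x))).

Definition pure_spinor_field phi : Prop :=
  smooth_spinor_field phi /\
  forall x, domain M x -> phi x != 0 /\ \dim (annihilator phi x) = n.

Definition generates_integrable phi : Prop :=
  forall X Y, smooth_vfield (domain M) X -> smooth_vfield (domain M) Y ->
    (forall x, domain M x -> X x \in annihilator phi x) ->
    (forall x, domain M x -> Y x \in annihilator phi x) ->
    forall x, domain M x -> lie_bracket X Y x \in annihilator phi x.

End Geometry.

(* Main.v *)
(* If phi is a twistor, nabla_X phi = (1/2n) X.chi with chi = D phi. For Y in
   N = N_phi the Leibniz rule gives Y.X.chi = -2n (nabla_X Y).phi, and for X, Y in N
   the absence of torsion gives [X, Y].phi = (1/n) X.Y.chi. Since
   Z.Y.X.chi = c(Z, Y, X) phi for a 3-form c on N, and N is its own orthogonal,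
   integrability amounts to c = 0. This is automatic for n = 2, and for n >= 4 it
   follows by testing against vectors v orthogonal to X, Y, Z but not in N. For n = 3
   the flat twistor 1 + x _| theta^123 has c <> 0.

   Conversely, for n = 2 put lam(s) = <phi, s> / |phi|^2, let B_X = nabla_X phi for
   the connection with A = 0 and D' = g^ab e_a.(B_b - lam(B_b) phi). Integrability
   kills the obstruction in the chirality space of phi and
   A(X) = - lam(B_X) + lam(X.D') / 2 solves the twistor equation.

   For n >= 3 and the metric sum_i dx_i dy_i + x_p dx_q dy_r, the spinor 1 generates
   the integrable distribution spanned by the d/dx_i but is not a twistor. *)

Require Import Defs.
From HB Require Import structures.
From mathcomp Require Import all_boot all_order all_algebra.
From mathcomp Require Import perm complex.
From mathcomp Require Import boolp classical_sets functions reals topology.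
From mathcomp Require Import normedtype landau derive.
From mathcomp Require Import ring.

Set Implicit Arguments.
Unset Strict Implicit.
Unset Printing Implicit Defensive.

Import Order.TTheory GRing.Theory Num.Theory.
Import numFieldNormedType.Exports.

(** In frame components the Clifford action no longer depends on the point: frame vectors act by
    fixed operators [gamma a], and the metric becomes the constant form [pairing]. Geometry enters
    only through derivatives and the coefficients [omega]. The passage from twistor to integrable
    uses only the axioms of a spinorial connection, so it covers every [nabla]. For n = 2 the
    chirality space of phi is a plane, so B_X modulo phi is one number for each X. Modulo phi the
    twistor equation is four linear equations for the two components of the Dirac spinor, and
    integrability supplies their two compatibility conditions; the part along phi is absorbed by A.
    The domain need not be connected, so the chirality of phi may differ from point to point. Hence
    A is given by one smooth formula, built from the Hermitian product, and chirality is
    distinguished only pointwise. The deformed metric keeps the fields d/dx_i null and commuting,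
    but the x_p-dependence of its dx_q dy_r coefficient makes nabla_{d/dy_r} d/dx_p leave their span
    at the origin. Three distinct indices p, q, r are what requires n >= 3. *)

(** * Calculus of smooth real functions on an open set *)

Section SmoothFunctions.
Local Open Scope classical_set_scope.
Local Open Scope ring_scope.

(** The difference f - g vanishes near x, so it has the zero map as differential there, and f is g
    plus this difference. *)
Lemma near_eq_differentiable (K : numFieldType) (V W : normedModType K)
    (f g : V -> W) x :
  (\near x, f x = g x) -> differentiable g x -> differentiable f x.
Proof.
move=> fg dg; have fgx : f x = g x := nbhs_singleton fg.
have e : (f - g) \o shift x = cst ((f - g) x) + (\0 : {linear V -> W}) +o_ 0 id.
  apply/eqaddoP => e e0; near=> y.
  have fgy : f (y + x) = g (y + x).
    near: y; have := fg; rewrite (near_shift 0 x).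
    by apply: filterS => y /=; rewrite subr0.
  have -> : ((f - g) \o shift x - (cst ((f - g) x) + (\0 : {linear V -> W}))) y = 0.
    change (f (y + x) - g (y + x) - (f x - g x + 0) = 0).
    by rewrite fgx fgy !subrr addr0 subr0.
  by rewrite normr0 mulr_ge0// ltW.
have c0 : continuous (\0 : {linear V -> W}) by exact: cst_continuous.
have dfg : differentiable (f - g) x.
  by apply/diff_locallyP; rewrite (diff_unique c0 e).
rewrite (_ : f = g + (f - g)); first exact: differentiableD.
by rewrite addrC subrK.
Unshelve. all: by end_near. Qed.

Context {R : realType} {m : nat}.
Implicit Types (U : set 'rV[R]_m) (f g : 'rV[R]_m -> R) (x : 'rV[R]_m).

Lemma open_near_eq U f g x : open U -> (forall y, U y -> f y = g y) -> U x ->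
  \near x, f x = g x.
Proof.
move=> oU fg Ux; near=> y; apply: fg; near: y; exact: open_nbhs_nbhs.
Unshelve. all: by end_near. Qed.

Lemma partial_ext U f g (i : 'I_m) x : open U -> (forall y, U y -> f y = g y) ->
  U x -> partial i f x = partial i g x.
Proof. by move=> oU fg Ux; apply: near_eq_derive; apply: open_near_eq Ux. Qed.

Lemma partialD f g (i : 'I_m) x : differentiable f x -> differentiable g x ->
  partial i (fun y => f y + g y) x = partial i f x + partial i g x.
Proof. by move=> df dg; apply: deriveD; exact: diff_derivable. Qed.

Lemma partialM f g (i : 'I_m) x : differentiable f x -> differentiable g x ->
  partial i (fun y => f y * g y) x = f x * partial i g x + g x * partial i f x.
Proof. by move=> df dg; apply: deriveM; exact: diff_derivable. Qed.

Lemma partialV f (i : 'I_m) x : f x != 0 -> differentiable f x ->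
  partial i (fun y => (f y)^-1) x = - 1 * ((f x)^-1 * ((f x)^-1 * partial i f x)).
Proof.
move=> fx df; rewrite /partial deriveV//; last exact: diff_derivable.
by rewrite /GRing.scale/= -exprVn expr2; ring.
Qed.

Lemma partial_cst (c : R) (i : 'I_m) x : partial i (fun=> c) x = 0.
Proof. exact: derive_cst. Qed.

(* A class of differentiable functions stable under partial derivatives consists of
   smooth functions. *)
Inductive smooth_closure U : ('rV[R]_m -> R) -> Prop :=
| SCbase f : smooth U f -> smooth_closure U f
| SCadd f g : smooth_closure U f -> smooth_closure U g ->
    smooth_closure U (fun x => f x + g x)
| SCmul f g : smooth_closure U f -> smooth_closure U g ->
    smooth_closure U (fun x => f x * g x)
| SCinv f : smooth_closure U f -> (forall x, U x -> f x != 0) ->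
    smooth_closure U (fun x => (f x)^-1)
| SCext f g : smooth_closure U f -> (forall x, U x -> g x = f x) ->
    smooth_closure U g.

Lemma smooth_differentiable U f x : smooth U f -> U x -> differentiable f x.
Proof. by move=> sf Ux; exact: (sf [::] x Ux). Qed.

Lemma smooth_partial U f i : smooth U f -> smooth U (partial i f).
Proof. by move=> sf s x Ux; have := sf (rcons s i) x Ux; rewrite foldr_rcons. Qed.

Lemma smooth_cst U (c : R) : smooth U (fun=> c).
Proof.
move=> s x _; suff [d ->] : exists d, foldr partial (fun=> c) s = (fun=> d).
  exact: differentiable_cst.
elim: s => [|i s [d e]]; first by exists c.
exists 0; rewrite /= e; apply/funext => y; exact: partial_cst.
Qed.

Lemma smooth_closure_differentiable U f : open U -> smooth_closure U f ->
  forall x, U x -> differentiable f x.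
Proof.
move=> oU; elim=> {f}.
- by move=> f sf x Ux; exact: smooth_differentiable sf Ux.
- by move=> f g _ df _ dg x Ux; apply: differentiableD; [exact: df|exact: dg].
- by move=> f g _ df _ dg x Ux; apply: differentiableM; [exact: df|exact: dg].
- by move=> f _ df f0 x Ux; apply: differentiableV; [exact: df|exact: f0].
- move=> f g _ df gf x Ux.
  by apply: (@near_eq_differentiable _ _ _ g f); [apply: open_near_eq Ux|exact: df].
Qed.

(** The sum, product and quotient rules write the derivative through members of the class. They hold
    only at points of U, which is why [SCext] closes the class under equality on U. *)
Lemma smooth_closure_partial U f i : open U -> smooth_closure U f ->
  smooth_closure U (partial i f).
Proof.
move=> oU; elim=> {f}.
- by move=> f sf; apply: SCbase; exact: smooth_partial.
- move=> f g cf pf cg pg; apply: (SCext (SCadd pf pg)) => x Ux.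
  by apply: partialD; exact: (smooth_closure_differentiable oU).
- move=> f g cf pf cg pg.
  apply: (SCext (SCadd (SCmul cf pg) (SCmul cg pf))) => x Ux.
  by apply: partialM; exact: (smooth_closure_differentiable oU).
- move=> f cf pf f0; have iv := SCinv cf f0.
  apply: (SCext (SCmul (SCbase (@smooth_cst U (-1))) (SCmul iv (SCmul iv pf)))).
  move=> x Ux; apply: partialV; first exact: f0.
  exact: (smooth_closure_differentiable oU).
- move=> f g cf pf gf; apply: (SCext pf) => x Ux.
  exact: partial_ext gf Ux.
Qed.

Lemma smooth_closureE U f : open U -> smooth_closure U f -> smooth U f.
Proof.
move=> oU cf s; suff : smooth_closure U (foldr partial f s).
  by move=> cs x Ux; exact: (smooth_closure_differentiable oU cs).
by elim: s => //= i s; exact: smooth_closure_partial.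
Qed.

Lemma smoothD U f g : open U -> smooth U f -> smooth U g ->
  smooth U (fun x => f x + g x).
Proof.
by move=> oU sf sg; apply: (smooth_closureE oU); apply: SCadd; apply: SCbase.
Qed.

Lemma smoothM U f g : open U -> smooth U f -> smooth U g ->
  smooth U (fun x => f x * g x).
Proof.
by move=> oU sf sg; apply: (smooth_closureE oU); apply: SCmul; apply: SCbase.
Qed.

Lemma smoothV U f : open U -> smooth U f -> (forall x, U x -> f x != 0) ->
  smooth U (fun x => (f x)^-1).
Proof.
by move=> oU sf f0; apply: (smooth_closureE oU); apply: SCinv => //; apply: SCbase.
Qed.

Lemma smooth_ext U f g : open U -> (forall x, U x -> g x = f x) ->
  smooth U f -> smooth U g.
Proof.
by move=> oU gf sf; apply: (smooth_closureE oU); apply: (SCext (SCbase sf)).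
Qed.

Lemma smoothN U f : open U -> smooth U f -> smooth U (fun x => - f x).
Proof.
move=> oU sf; rewrite (_ : (fun x => _) = (fun x => -1 * f x)).
  by apply: smoothM => //; exact: smooth_cst.
by apply/funext => x; rewrite mulN1r.
Qed.

Lemma partial_coord (i j : 'I_m) x :
  partial i (fun y : 'rV[R]_m => y 0 j) x = (i == j)%:R.
Proof.
rewrite /partial deriveE; last exact: differentiable_coord.
(* Evaluation at j packaged as a linear map, which is its own differential. *)
have @f : {linear 'rV[R]_m -> R}.
  by exists (fun N : 'rV[R]_m => N 0 j); do 2![eexists]; do ?[constructor];
     rewrite ?mxE// => ? *; rewrite ?mxE//; move=> ?; rewrite !mxE.
rewrite (_ : (fun _ => _) = f) // diff_lin; last exact: coord_continuous.
by rewrite /= mxE eqxx eq_sym.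
Qed.

Lemma smooth_coord U (j : 'I_m) : smooth U (fun x => x 0 j).
Proof.
move=> s x Ux; case: s x Ux => [|i s] x _; first exact: differentiable_coord.
(* One derivative already gives a constant, and constants are preserved by further derivatives. *)
suff [d] : exists d, foldr partial (fun x => x 0 j) (i :: s) = (fun=> d).
  by move=> ->; exact: differentiable_cst.
elim: s i => [|k s IH] i /=.
  by exists (i == j)%:R; apply/funext => y; rewrite partial_coord.
have [d /= ->] := IH k; exists 0; apply/funext => y; exact: partial_cst.
Qed.

End SmoothFunctions.

(** * Smooth complex-valued functions and their derivatives along complex vectors *)

Section ComplexSmoothFunctions.
Local Open Scope classical_set_scope.
Local Open Scope ring_scope.
Context {R : realType} {m : nat}.
Variables (U : set 'rV[R]_m) (oU : open U).
Implicit Types (f g : 'rV[R]_m -> R[i]) (x : 'rV[R]_m) (v : 'rV[R[i]]_m).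

Lemma ReM (z w : R[i]) : complex.Re (z * w) =
  complex.Re z * complex.Re w - complex.Im z * complex.Im w.
Proof. by case: z w => a b []. Qed.

Lemma ImM (z w : R[i]) : complex.Im (z * w) =
  complex.Re z * complex.Im w + complex.Im z * complex.Re w.
Proof. by case: z w => a b []. Qed.

Lemma ReD (z w : R[i]) : complex.Re (z + w) = complex.Re z + complex.Re w.
Proof. by case: z w => a b []. Qed.

Lemma ImD (z w : R[i]) : complex.Im (z + w) = complex.Im z + complex.Im w.
Proof. by case: z w => a b []. Qed.

Lemma complex_eq (z w : R[i]) : complex.Re z = complex.Re w ->
  complex.Im z = complex.Im w -> z = w.
Proof. by case: z w => a b [c d] /= -> ->. Qed.

Lemma csmooth_ext f g : (forall x, U x -> g x = f x) -> csmooth U f -> csmooth U g.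
Proof.
by move=> gf [sR sI]; split; [apply: smooth_ext sR|apply: smooth_ext sI] => // x Ux;
  rewrite gf.
Qed.

Lemma csmooth_cst c : csmooth U (fun=> c).
Proof. by split; exact: smooth_cst. Qed.

Lemma csmooth_real (f : 'rV[R]_m -> R) : smooth U f -> csmooth U (fun x => (f x)%:C%C).
Proof. by move=> sf; split => //; exact: smooth_cst. Qed.

Lemma csmoothD f g : csmooth U f -> csmooth U g -> csmooth U (fun x => f x + g x).
Proof.
move=> [fR fI] [gR gI]; split.
  by apply: (smooth_ext oU _ (smoothD oU fR gR)) => x _; rewrite ReD.
by apply: (smooth_ext oU _ (smoothD oU fI gI)) => x _; rewrite ImD.
Qed.

Lemma csmoothM f g : csmooth U f -> csmooth U g -> csmooth U (fun x => f x * g x).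
Proof.
move=> [fR fI] [gR gI]; split.
  apply: (smooth_ext oU _ (smoothD oU (smoothM oU fR gR)
    (smoothN oU (smoothM oU fI gI)))) => x _; exact: ReM.
apply: (smooth_ext oU _ (smoothD oU (smoothM oU fR gI) (smoothM oU fI gR))) => x _.
exact: ImM.
Qed.

Lemma csmoothN f : csmooth U f -> csmooth U (fun x => - f x).
Proof.
by move=> sf; apply: csmooth_ext (csmoothM (csmooth_cst (-1)) sf) => x _; rewrite mulN1r.
Qed.

Lemma csmoothB f g : csmooth U f -> csmooth U g -> csmooth U (fun x => f x - g x).
Proof. by move=> sf sg; apply: csmoothD => //; exact: csmoothN. Qed.

Lemma csmooth_conj f : csmooth U f -> csmooth U (fun x => conjc (f x)).
Proof.
move=> [fR fI]; split.
  by apply: (smooth_ext oU _ fR) => x _; case: (f x).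
by apply: (smooth_ext oU _ (smoothN oU fI)) => x _; case: (f x).
Qed.

(** Real and imaginary part of 1/f are Re f and - Im f over |f|^2, a sum of two squares that is
    nonzero where f is. *)
Lemma csmoothV f : csmooth U f -> (forall x, U x -> f x != 0) ->
  csmooth U (fun x => (f x)^-1).
Proof.
move=> [fR fI] f0.
have sN : smooth U (fun x => (complex.Re (f x) * complex.Re (f x)
                              + complex.Im (f x) * complex.Im (f x))^-1).
  apply: smoothV => //; first by apply: smoothD => //; apply: smoothM.
  move=> x /f0; case: (f x) => a b; rewrite eq_complex/= => ab.
  by rewrite -!expr2 paddr_eq0 ?sqr_ge0// !sqrf_eq0.
split.
  by apply: (smooth_ext oU _ (smoothM oU fR sN)) => x _; case: (f x).
apply: (smooth_ext oU _ (smoothN oU (smoothM oU fI sN))) => x _.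
by case: (f x).
Qed.

Lemma csmooth_sum (I : Type) (r : seq I) (P : pred I) (F : I -> 'rV[R]_m -> R[i]) :
  (forall i, P i -> csmooth U (F i)) -> csmooth U (fun x => \sum_(i <- r | P i) F i x).
Proof.
move=> sF; elim: r => [|i r IH].
  by apply: csmooth_ext (csmooth_cst 0) => x _; rewrite big_nil.
case: (boolP (P i)) => Pi.
  by apply: csmooth_ext (csmoothD (sF _ Pi) IH) => x _; rewrite big_cons Pi.
by apply: csmooth_ext IH => x _; rewrite big_cons (negPf Pi).
Qed.

Lemma csmooth_prod (I : Type) (r : seq I) (P : pred I) (F : I -> 'rV[R]_m -> R[i]) :
  (forall i, P i -> csmooth U (F i)) -> csmooth U (fun x => \prod_(i <- r | P i) F i x).
Proof.
move=> sF; elim: r => [|i r IH].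
  by apply: csmooth_ext (csmooth_cst 1) => x _; rewrite big_nil.
case: (boolP (P i)) => Pi.
  by apply: csmooth_ext (csmoothM (sF _ Pi) IH) => x _; rewrite big_cons Pi.
by apply: csmooth_ext IH => x _; rewrite big_cons (negPf Pi).
Qed.

Lemma csmooth_cpartial f i : csmooth U f -> csmooth U (cpartial i f).
Proof. by move=> [fR fI]; split; exact: smooth_partial. Qed.

Lemma csmooth_vderiv (X : 'rV[R]_m -> 'rV[R[i]]_m) f :
  smooth_vfield U X -> csmooth U f -> csmooth U (fun x => vderiv (X x) f x).
Proof.
move=> sX sf; apply: csmooth_sum => i _.
by apply: csmoothM; [exact: sX|exact: csmooth_cpartial].
Qed.

Lemma cpartial_ext f g i x : (forall y, U y -> f y = g y) -> U x ->
  cpartial i f x = cpartial i g x.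
Proof.
by move=> fg Ux; congr (_ +i* _)%C; apply: (partial_ext _ oU) => // y Uy; rewrite fg.
Qed.

Lemma cpartialD f g i x : csmooth U f -> csmooth U g -> U x ->
  cpartial i (fun y => f y + g y) x = cpartial i f x + cpartial i g x.
Proof.
move=> [fR fI] [gR gI] Ux; apply: complex_eq; rewrite /= -partialD;
  try exact: (smooth_differentiable _ Ux);
  by apply: (partial_ext _ oU _ Ux) => y _; rewrite ?ReD ?ImD.
Qed.

Lemma cpartialM f g i x : csmooth U f -> csmooth U g -> U x ->
  cpartial i (fun y => f y * g y) x = cpartial i f x * g x + f x * cpartial i g x.
Proof.
move=> [fR fI] [gR gI] Ux.
have d := @smooth_differentiable R m U _ x _ Ux.
apply: complex_eq; rewrite /=.
  rewrite (partial_ext i oU (g := fun y => complex.Re (f y) * complex.Re (g y)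
    + -1 * (complex.Im (f y) * complex.Im (g y))) _ Ux); last first.
    by move=> y _; rewrite ReM mulN1r.
  rewrite partialD; [|apply: d..]; first last.
  - by apply: smoothM => //; [exact: smooth_cst|exact: smoothM].
  - exact: smoothM.
  rewrite !partialM; try by apply: d => //; (exact: smooth_cst||exact: smoothM).
  rewrite partial_cst ReD !ReM /=; ring.
rewrite (partial_ext i oU (g := fun y => complex.Re (f y) * complex.Im (g y)
  + complex.Im (f y) * complex.Re (g y)) _ Ux); last first.
  by move=> y _; rewrite ImM.
rewrite partialD; [|apply: d..]; try exact: smoothM.
rewrite !partialM; try exact: d.
rewrite ImD !ImM /=; ring.
Qed.

Lemma cpartial_cst (c : R[i]) i x : cpartial i (fun=> c) x = 0.
Proof. by rewrite /cpartial !partial_cst. Qed.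

Lemma vderiv_ext v f g x : (forall y, U y -> f y = g y) -> U x ->
  vderiv v f x = vderiv v g x.
Proof. by move=> fg Ux; apply: eq_bigr => i _; rewrite (cpartial_ext i fg Ux). Qed.

Lemma vderivD v f g x : csmooth U f -> csmooth U g -> U x ->
  vderiv v (fun y => f y + g y) x = vderiv v f x + vderiv v g x.
Proof.
move=> sf sg Ux; rewrite /vderiv -big_split; apply: eq_bigr => i _ /=.
by rewrite cpartialD// mulrDr.
Qed.

Lemma vderivM v f g x : csmooth U f -> csmooth U g -> U x ->
  vderiv v (fun y => f y * g y) x = vderiv v f x * g x + f x * vderiv v g x.
Proof.
move=> sf sg Ux; rewrite /vderiv mulr_suml mulr_sumr -big_split.
by apply: eq_bigr => i _ /=; rewrite cpartialM//; ring.
Qed.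

Lemma vderiv_cst v (c : R[i]) x : vderiv v (fun=> c) x = 0.
Proof. by rewrite /vderiv big1// => i _; rewrite cpartial_cst mulr0. Qed.

Lemma vderiv_sum v (I : Type) (r : seq I) (F : I -> 'rV[R]_m -> R[i]) x :
  (forall i, csmooth U (F i)) -> U x ->
  vderiv v (fun y => \sum_(i <- r) F i y) x = \sum_(i <- r) vderiv v (F i) x.
Proof.
move=> sF Ux; elim: r => [|i r IH].
  rewrite big_nil (vderiv_ext v (g := fun=> 0) _ Ux) ?vderiv_cst//.
  by move=> y _; rewrite big_nil.
rewrite big_cons -IH -vderivD//; last exact: csmooth_sum.
by apply: vderiv_ext Ux => y _; rewrite big_cons.
Qed.

Lemma vderivDl v w f x : vderiv (v + w) f x = vderiv v f x + vderiv w f x.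
Proof.
by rewrite /vderiv -big_split; apply: eq_bigr => i _; rewrite mxE mulrDl.
Qed.

Lemma vderivZl (c : R[i]) v f x : vderiv (c *: v) f x = c * vderiv v f x.
Proof. by rewrite /vderiv mulr_sumr; apply: eq_bigr => i _; rewrite mxE mulrA. Qed.

Lemma vderiv_suml (I : Type) (r : seq I) (F : I -> 'rV[R[i]]_m) f x :
  vderiv (\sum_(i <- r) F i) f x = \sum_(i <- r) vderiv (F i) f x.
Proof.
elim: r => [|i r IH]; last by rewrite !big_cons vderivDl IH.
by rewrite !big_nil /vderiv big1// => i _; rewrite mxE mul0r.
Qed.

Lemma csmooth_det k (A : 'rV[R]_m -> 'M[R[i]]_k) :
  (forall i j, csmooth U (fun x => A x i j)) -> csmooth U (fun x => \det (A x)).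
Proof.
move=> sA; apply: csmooth_sum => s _; apply: csmoothM; first exact: csmooth_cst.
by apply: csmooth_prod => i _.
Qed.

(** Cramer's rule: each entry is a cofactor divided by the determinant. *)
Lemma csmooth_invmx k (A : 'rV[R]_m -> 'M[R[i]]_k) i j :
  (forall i j, csmooth U (fun x => A x i j)) -> (forall x, U x -> A x \in unitmx) ->
  csmooth U (fun x => invmx (A x) i j).
Proof.
move=> sA uA; apply: (csmooth_ext
  (f := fun x => (\det (A x))^-1 * ((-1) ^+ (j + i) * \det (row' j (col' i (A x)))))).
  by move=> x Ux; rewrite /invmx uA// !mxE.
apply: csmoothM.
  apply: csmoothV; first exact: csmooth_det.
  by move=> x /uA; rewrite unitmxE unitfE.
apply: csmoothM; first exact: csmooth_cst.
by apply: csmooth_det => k1 k2; apply: csmooth_ext (sA _ _) => x _; rewrite !mxE.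
Qed.

End ComplexSmoothFunctions.

(** * The Clifford algebra acting on the exterior algebra *)

Section CliffordGenerators.
Local Open Scope ring_scope.
Context {R : realType} {n : nat}.
Implicit Types (i j : 'I_n) (I : {set 'I_n}) (a b : 'I_(n + n)) (s : spinor R n).

(** Symmetric difference with {j}. Contraction and wedge both read the coefficient at the toggled
    set, so phrasing them with this involution avoids treating removal and insertion separately. *)
Definition toggle j I := if j \in I then I :\ j else j |: I.

Lemma in_toggle i j I : (i \in toggle j I) = (i == j) (+) (i \in I).
Proof. by rewrite /toggle; case: ifP => jI; rewrite !inE; case: eqVneq => [->|]//=; rewrite jI. Qed.

Lemma toggleK j : involutive (toggle j).
Proof. by move=> I; apply/setP => i; rewrite !in_toggle addbA addbb. Qed.

Lemma toggleC i j I : toggle i (toggle j I) = toggle j (toggle i I).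
Proof. by apply/setP => k; rewrite !in_toggle addbCA. Qed.

(** Toggling j changes the number of elements below i by one precisely when j < i. As signs square
    to 1 and toggling is an involution, only the insertion of a new j has to be checked. *)
Lemma koszul_sign_toggle i j I :
  koszul_sign i (toggle j I) = (-1) ^+ (j < i)%N * koszul_sign i I :> R[i].
Proof.
wlog jI : I / j \notin I.
  move=> H; case: (boolP (j \in I)) => jI; last exact: H.
  have := H (toggle j I); rewrite in_toggle eqxx jI toggleK => ->//.
  by rewrite mulrA -expr2 sqrr_sign mul1r.
rewrite /koszul_sign -exprD (_ : #|[set k in toggle j I | (k < i)%N]| = (j < i) + #|[set k in I | (k < i)%N]|)%N//.
rewrite /toggle (negPf jI); case: (boolP (j < i)%N) => ji.
  rewrite (_ : [set k in j |: I | (k < i)%N] = j |: [set k in I | (k < i)%N]).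
    by rewrite cardsU1 inE (negPf jI).
  by apply/setP => k; rewrite !inE; case: eqVneq => // ->; rewrite ji.
congr #|pred_of_set _|; apply/setP => k; rewrite !inE.
by case: eqVneq => // ->; rewrite (negPf ji) (negPf jI).
Qed.

Lemma koszul_sign_sqr i I : koszul_sign i I * koszul_sign i I = 1 :> R[i].
Proof. by rewrite -expr2 sqrr_sign. Qed.

(** Creation (b = true) and annihilation (b = false) operators in one formula, so that the canonical
    anticommutation relations need a single proof. *)
Definition ladder (b : bool) j s : spinor R n :=
  [ffun I : {set 'I_n} => if (j \in I) == b then koszul_sign j I * s (toggle j I) else 0].

Lemma contractE j s : contract j s = ladder false j s.
Proof.
by apply/ffunP => I; rewrite !ffunE /toggle; case: ifP => //.
Qed.

Lemma wedgeE j s : wedge j s = ladder true j s.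
Proof.
apply/ffunP => I; rewrite !ffunE; case: ifP => //= jI.
by have := koszul_sign_toggle j j I; rewrite ltnn mul1r /toggle jI => ->.
Qed.

Lemma ladder_anticomm (b c : bool) i j s :
  ladder b i (ladder c j s) + ladder c j (ladder b i s)
    = ((i == j) && (b != c))%:R *: s.
Proof.
apply/ffunP => I; rewrite !ffunE !in_toggle [j == i]eq_sym.
case: (eqVneq i j) => [<-|ij] /=.
  rewrite !toggleK !koszul_sign_toggle ltnn mul1r /GRing.scale/=.
  have := koszul_sign_sqr i I; move: (koszul_sign _ _) => k kk.
  by case: b; case: c; case: (i \in I) => /=;
    rewrite ?mulrA ?mulr0 ?addr0 ?add0r ?mul0r ?kk.
rewrite !koszul_sign_toggle toggleC /GRing.scale/= mul0r.
(* For i <> j exactly one of the two orders of application picks up an extra sign, so the two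
   products cancel. *)
have : (i < j)%N != (j < i)%N.
  by case: ltngtP ij => // /val_inj ->; rewrite eqxx.
case: ifP => _; case: ifP => _; rewrite ?(mulr0, addr0)//.
move: (toggle _ _) (koszul_sign i I) (koszul_sign j I) => J k l.
by case: (i < j)%N; case: (j < i)%N => //= _; rewrite expr0 expr1; ring.
Qed.

Lemma ladder_is_linear (b : bool) j : linear (ladder b j).
Proof.
move=> k s t; apply/ffunP => I; rewrite !ffunE; case: ifP => _; last by rewrite scaler0 addr0.
by rewrite /GRing.scale/=; ring.
Qed.

Definition gamma a s : spinor R n :=
  match fintype.split a with inl i => contract i s | inr i => wedge i s end.

(** Exchanges e_i and theta^i: [dual a] is the only index whose frame vector is not orthogonal to
    that of a. *)
Definition dual a : 'I_(n + n) :=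
  match fintype.split a with inl i => rshift n i | inr i => lshift n i end.

Lemma split_lshift i : fintype.split (lshift n i) = inl i.
Proof. exact: (unsplitK (inl i)). Qed.

Lemma split_rshift i : fintype.split (rshift n i) = inr i.
Proof. exact: (unsplitK (inr i)). Qed.

Lemma dual_lshift i : dual (lshift n i) = rshift n i.
Proof. by rewrite /dual split_lshift. Qed.

Lemma dual_rshift i : dual (rshift n i) = lshift n i.
Proof. by rewrite /dual split_rshift. Qed.

Lemma gamma_lshift i s : gamma (lshift n i) s = contract i s.
Proof. by rewrite /gamma split_lshift. Qed.

Lemma gamma_rshift i s : gamma (rshift n i) s = wedge i s.
Proof. by rewrite /gamma split_rshift. Qed.

Lemma dualK : involutive dual.
Proof.
by move=> a; case: (split_ordP a) => i ->; rewrite ?(dual_lshift, dual_rshift).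
Qed.

Lemma gamma_is_linear a : linear (gamma a).
Proof.
by move=> k s t; case: (split_ordP a) => i ->; rewrite ?(gamma_lshift, gamma_rshift)
  ?(contractE, wedgeE) ladder_is_linear.
Qed.

HB.instance Definition _ a :=
  GRing.isLinear.Build R[i] (spinor R n) (spinor R n) *:%R (gamma a) (gamma_is_linear a).

Lemma gamma_anticomm a b s :
  gamma a (gamma b s) + gamma b (gamma a s) = (b == dual a)%:R *: s.
Proof.
by case: (split_ordP a) => i ->; case: (split_ordP b) => j ->;
  rewrite ?(gamma_lshift, gamma_rshift) ?(dual_lshift, dual_rshift)
    ?(contractE, wedgeE) ladder_anticomm ?andbF ?andbT ?eq_lrshift ?eq_rlshift
    ?eq_lshift ?eq_rshift // [i == j]eq_sym.
Qed.

Definition cliff (v : 'rV[R[i]]_(n + n)) s : spinor R n := \sum_a v 0 a *: gamma a s.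

Lemma cliff_is_linear v : linear (cliff v).
Proof.
move=> k s t; rewrite /cliff scaler_sumr -big_split; apply: eq_bigr => a _ /=.
by rewrite linearP scalerDr !scalerA mulrC.
Qed.

HB.instance Definition _ v :=
  GRing.isLinear.Build R[i] (spinor R n) (spinor R n) *:%R (cliff v) (cliff_is_linear v).

Lemma cliffZr v (k : R[i]) s : cliff v (k *: s) = k *: cliff v s.
Proof. by rewrite linearZ. Qed.

Lemma cliffDl u v s : cliff (u + v) s = cliff u s + cliff v s.
Proof. by rewrite /cliff -big_split; apply: eq_bigr => a _ /=; rewrite mxE scalerDl. Qed.

Lemma cliffZl (k : R[i]) v s : cliff (k *: v) s = k *: cliff v s.
Proof. by rewrite /cliff scaler_sumr; apply: eq_bigr => a _ /=; rewrite mxE scalerA. Qed.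

Lemma cliff_delta a s : cliff (delta_mx 0 a) s = gamma a s.
Proof.
rewrite /cliff (bigD1 a)//= mxE !eqxx scale1r big1 ?addr0// => b ba.
by rewrite mxE (negPf ba) scale0r.
Qed.

(** This is 2 g(u, v) in frame components; the 2 cancels the 1/2 in g(e_i, theta^i). *)
Definition pairing (u v : 'rV[R[i]]_(n + n)) : R[i] := \sum_a u 0 a * v 0 (dual a).

Lemma pairingC u v : pairing u v = pairing v u.
Proof.
rewrite /pairing (reindex_inj (inv_inj dualK)); apply: eq_bigr => a _.
by rewrite dualK mulrC.
Qed.

Lemma cliff_anticomm u v s :
  cliff u (cliff v s) + cliff v (cliff u s) = pairing u v *: s.
Proof.
rewrite /cliff; under eq_bigr do rewrite linear_sum /= scaler_sumr.
rewrite [X in _ + X](_ : _ = \sum_a \sum_b u 0 a * v 0 b *: gamma b (gamma a s)).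
  rewrite -big_split /= /pairing scaler_suml; apply: eq_bigr => a _.
  rewrite -big_split /= (bigD1 (dual a))//= big1 => [|b ba].
    by rewrite addr0 linearZ /= scalerA -scalerDr gamma_anticomm eqxx scale1r.
  by rewrite linearZ /= scalerA -scalerDr gamma_anticomm (negPf ba) scale0r scaler0.
rewrite exchange_big /=; apply: eq_bigr => b _.
rewrite linear_sum /= scaler_sumr.
by apply: eq_bigr => a _; rewrite linearZ /= scalerA mulrC.
Qed.

Lemma cliff_sqr v s : pairing v v = 0 -> cliff v (cliff v s) = 0.
Proof.
move=> v0; have := cliff_anticomm v v s; rewrite v0 scale0r -mulr2n => /eqP.
by rewrite -scaler_nat scaler_eq0 pnatr_eq0 /= => /eqP.
Qed.

End CliffordGenerators.

(** * The Levi-Civita connection and the null frame *)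

Section LeviCivita.
Local Open Scope classical_set_scope.
Local Open Scope ring_scope.
Context {R : realType} {n : nat}.
Variable M : framed_domain R n.
Notation C := R[i].
Notation U := (domain M).
Notation oU := (@domain_open R n M).
Notation field := (vfield R (n + n)).
Implicit Types (X Y Z : field) (x : 'rV[R]_(n + n)) (u v w : 'rV[C]_(n + n)).

Lemma cmetricE x u v :
  cmetric M x u v = \sum_i \sum_j u 0 i * v 0 j * (metric M x i j)%:C%C.
Proof.
rewrite /cmetric mxE exchange_big /=; apply: eq_bigr => j _.
rewrite mxE mulr_suml; apply: eq_bigr => i _; rewrite !mxE; ring.
Qed.

Lemma metricC x i j : U x -> metric M x i j = metric M x j i.
Proof. by move=> Ux; rewrite -[in LHS](Defs.metric_sym Ux) mxE. Qed.

Lemma cmetricC x u v : U x -> cmetric M x u v = cmetric M x v u.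
Proof.
move=> Ux; rewrite !cmetricE exchange_big /=.
by apply: eq_bigr => i _; apply: eq_bigr => j _; rewrite metricC//; ring.
Qed.

Lemma frame_metric_dual x a b : U x ->
  cmetric M x (frame M a x) (frame M b x) = 2%:R^-1 * (b == dual a)%:R.
Proof.
move=> Ux; case: (split_ordP a) => i ->; case: (split_ordP b) => j ->;
  rewrite ?(dual_lshift, dual_rshift) ?eq_lrshift ?eq_rlshift ?eq_lshift ?eq_rshift.
- by rewrite frame_ee// mulr0.
- by rewrite frame_et// eq_sym.
- by rewrite cmetricC// frame_et.
- by rewrite frame_tt// mulr0.
Qed.

Definition frame_mx x : 'M[C]_(n + n) := \matrix_a frame M a x.

Lemma frame_metricE x : U x ->
  frame_metric M x = \matrix_(a, b) (2%:R^-1 * (b == dual a)%:R).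
Proof. by move=> Ux; apply/matrixP => a b; rewrite !mxE frame_metric_dual. Qed.

Lemma sum_dual_l (a : 'I_(n + n)) (F : 'I_(n + n) -> C) :
  \sum_b (b == dual a)%:R * F b = F (dual a).
Proof.
rewrite (bigD1 (dual a))//= eqxx mul1r big1 ?addr0// => b /negPf ->.
by rewrite mul0r.
Qed.

Lemma frame_metricK x : U x ->
  frame_metric M x *m \matrix_(a, b) (2%:R * (b == dual a)%:R) = 1%:M.
Proof.
move=> Ux; rewrite frame_metricE//; apply/matrixP => a c; rewrite !mxE.
rewrite (eq_bigr (fun b => (b == dual a)%:R * (c == dual b)%:R)) => [|b _].
  by rewrite sum_dual_l dualK eq_sym.
by rewrite !mxE; field.
Qed.

Lemma frame_metric_invE x a b : U x ->
  frame_metric_inv M x a b = 2%:R * (b == dual a)%:R.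
Proof.
move=> Ux; have K := frame_metricK Ux; have [uM _] := mulmx1_unit K.
rewrite /frame_metric_inv -[invmx _]mulmx1 -K mulmxA mulVmx// mul1mx mxE //.
Qed.

(** Linear independence of the frame is not a field of [framed_domain]; it follows because the Gram
    matrix F G F^T is invertible. *)
Lemma frame_mx_unit x : U x -> frame_mx x \in unitmx.
Proof.
move=> Ux; have K := frame_metricK Ux.
have e : frame_metric M x = frame_mx x *m (map_mx (real_complex R) (metric M x) *m (frame_mx x)^T).
  apply/matrixP => a b; rewrite [LHS]mxE /cmetric -mulmxA [LHS]mxE [RHS]mxE.
  apply: eq_bigr => i _; rewrite [frame_mx x a i]mxE; congr (_ * _).
  by rewrite [LHS]mxE [RHS]mxE; apply: eq_bigr => j _; rewrite !mxE.
by move: K; rewrite e -mulmxA => /mulmx1_unit [].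
Qed.

Lemma frame_coord_is_linear x : linear (frame_coord M x).
Proof. by move=> k u v; rewrite /frame_coord mulmxDl scalemxAl. Qed.

HB.instance Definition _ x := GRing.isLinear.Build C 'rV[C]_(n + n) 'rV[C]_(n + n) *:%R
  (frame_coord M x) (frame_coord_is_linear x).

Lemma frame_coordK x v : U x -> v = \sum_a frame_coord M x v 0 a *: frame M a x.
Proof.
move=> Ux; rewrite -[LHS](mulmxKV (frame_mx_unit Ux)) mulmx_sum_row.
by apply: eq_bigr => a _; rewrite rowK.
Qed.

Lemma frame_coord_frame x a : U x -> frame_coord M x (frame M a x) = delta_mx 0 a.
Proof.
move=> Ux; rewrite /frame_coord -(rowK (frame M ^~ x)) rowE -mulmxA mulmxV ?mulmx1//.
exact: frame_mx_unit.
Qed.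

Lemma frame_coord_sum x (c : 'rV[C]_(n + n)) : U x ->
  frame_coord M x (\sum_a c 0 a *: frame M a x) = c.
Proof.
move=> Ux; rewrite linear_sum /= [RHS]row_sum_delta; apply: eq_bigr => a _.
by rewrite linearZ /= frame_coord_frame.
Qed.

Lemma cliffordE x v s : clifford M x v s = cliff (frame_coord M x v) s.
Proof.
rewrite /cliff big_split_ord /=; congr (_ + _); apply: eq_bigr => i _.
  by rewrite gamma_lshift.
by rewrite gamma_rshift.
Qed.

Lemma cmetricZl x (k : C) u w : cmetric M x (k *: u) w = k * cmetric M x u w.
Proof. by rewrite /cmetric -!scalemxAl mxE. Qed.

Lemma cmetric_suml x (I : Type) (r : seq I) (F : I -> 'rV[C]_(n + n)) w :
  cmetric M x (\sum_(i <- r) F i) w = \sum_(i <- r) cmetric M x (F i) w.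
Proof. by rewrite /cmetric !mulmx_suml summxE. Qed.

Lemma frame_coordE x v a : U x ->
  frame_coord M x v 0 a = 2%:R * cmetric M x v (frame M (dual a) x).
Proof.
move=> Ux; rewrite {2}(frame_coordK v Ux) cmetric_suml.
rewrite (eq_bigr (fun b => (b == dual (dual a))%:R * (frame_coord M x v 0 b * 2%:R^-1))).
  by rewrite sum_dual_l dualK mulrCA mulfV ?pnatr_eq0 ?mulr1.
move=> b _; rewrite cmetricZl frame_metric_dual// dualK eq_sym.
rewrite (inj_eq (inv_inj dualK)); ring.
Qed.

Lemma csmooth_metric i j : csmooth U (fun x => (metric M x i j)%:C%C).
Proof. by apply: csmooth_real; exact: metric_smooth. Qed.

Lemma csmooth_frame_coord X a : smooth_vfield U X ->
  csmooth U (fun x => frame_coord M x (X x) 0 a).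
Proof.
move=> sX; rewrite /frame_coord.
apply: (csmooth_ext oU (f := fun x => \sum_i X x 0 i * invmx (frame_mx x) i a)).
  by move=> x _; rewrite mxE.
apply: (csmooth_sum oU) => i _; apply: (csmoothM oU); first exact: sX.
apply: (csmooth_invmx oU); last exact: frame_mx_unit.
move=> b c; apply: (csmooth_ext oU _ (frame_smooth M b c)) => x _.
by rewrite mxE.
Qed.

Lemma map_metric_unit x : U x -> map_mx (real_complex R) (metric M x) \in unitmx.
Proof. by move=> Ux; rewrite map_unitmx metric_nondegenerate. Qed.

Lemma christoffelE x k i j : U x -> (christoffel M x k i j)%:C%C =
  2%:R^-1 * \sum_l invmx (map_mx (real_complex R) (metric M x)) k l *
    (cpartial i (fun y => (metric M y j l)%:C%C) x
     + cpartial j (fun y => (metric M y i l)%:C%C) x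
     - cpartial l (fun y => (metric M y i j)%:C%C) x) :> C.
Proof.
move=> Ux; rewrite /christoffel rmorphM rmorph_sum fmorphV rmorph_nat.
congr (_ * _); apply: eq_bigr => l _.
rewrite /cpartial /= !partial_cst -map_invmx mxE rmorphM rmorphB rmorphD.
by [].
Qed.

Lemma csmooth_christoffel k i j : csmooth U (fun x => (christoffel M x k i j)%:C%C).
Proof.
apply: (csmooth_ext oU (fun x Ux => christoffelE k i j Ux)).
apply: (csmoothM oU); first exact: csmooth_cst.
apply: (csmooth_sum oU) => l _; apply: (csmoothM oU).
  apply: (csmooth_invmx oU); last exact: map_metric_unit.
  move=> a b; apply: (csmooth_ext oU _ (csmooth_metric a b)) => x _.
  by rewrite mxE.
by apply: (csmoothB oU); [apply: (csmoothD oU)|];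
  apply: csmooth_cpartial; exact: csmooth_metric.
Qed.

Lemma smooth_levi_civita X Y : smooth_vfield U X -> smooth_vfield U Y ->
  smooth_vfield U (levi_civita M X Y).
Proof.
move=> sX sY k; rewrite /levi_civita.
apply: (csmooth_ext oU (f := fun x => vderiv (X x) (fun y => Y y 0 k) x
   + \sum_i \sum_j (christoffel M x k i j)%:C%C * X x 0 i * Y x 0 j)).
  by move=> x _; rewrite mxE.
apply: (csmoothD oU); first by apply: (csmooth_vderiv oU).
apply: (csmooth_sum oU) => i _; apply: (csmooth_sum oU) => j _.
by apply: (csmoothM oU) => //; apply: (csmoothM oU) => //; exact: csmooth_christoffel.
Qed.

Lemma christoffelC x k i j : U x -> christoffel M x k i j = christoffel M x k j i.
Proof.
move=> Ux; congr (_ * _); apply: eq_bigr => l _; congr (_ * _); congr (_ - _).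
  exact: addrC.
by apply: (partial_ext _ oU _ Ux) => y; exact: metricC.
Qed.

Lemma levi_civita_torsion_free X Y x : U x ->
  lie_bracket X Y x = levi_civita M X Y x - levi_civita M Y X x.
Proof.
move=> Ux; apply/rowP => k; rewrite !mxE.
set S := \sum_i _; rewrite (_ : \sum_i \sum_j _ = S); first by ring.
rewrite /S exchange_big /=; apply: eq_bigr => i _; apply: eq_bigr => j _.
by rewrite christoffelC//; ring.
Qed.

(** Lowering the upper index cancels the inverse metric and leaves the Christoffel symbols of the
    first kind. *)
Lemma christoffel_lower x i j l : U x ->
  \sum_k (christoffel M x k i j)%:C%C * (metric M x k l)%:C%C =
  2%:R^-1 * (cpartial i (fun y => (metric M y j l)%:C%C) x
     + cpartial j (fun y => (metric M y i l)%:C%C) x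
     - cpartial l (fun y => (metric M y i j)%:C%C) x) :> C.
Proof.
move=> Ux; set F := (fun l => cpartial i (fun y => (metric M y j l)%:C%C) x
     + cpartial j (fun y => (metric M y i l)%:C%C) x
     - cpartial l (fun y => (metric M y i j)%:C%C) x : C).
rewrite -/(F l); set G := map_mx (real_complex R) (metric M x).
transitivity (2%:R^-1 * \sum_l' F l' * (invmx G *m G) l' l).
  under eq_bigr => k _ do rewrite christoffelE// -mulrA mulr_suml.
  rewrite -mulr_sumr; congr (_ * _); rewrite exchange_big /=; apply: eq_bigr => l' _.
  rewrite mxE mulr_sumr; apply: eq_bigr => k _.
  have -> : invmx G l' k = invmx G k l'.
    transitivity ((invmx G)^T k l'); first by rewrite mxE.
    by rewrite trmx_inv /G matrix.map_trmx Defs.metric_sym.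
  by rewrite /F /G [in RHS]mxE; ring.
congr (_ * _); rewrite mulVmx ?map_metric_unit//.
rewrite (bigD1 l)//= mxE eqxx mulr1 big1 ?addr0// => k /negPf kl.
by rewrite mxE kl mulr0.
Qed.

(** A form of g(nabla_X Y, v) without the inverse metric. It serves both the proof that nabla is
    metric and the explicit computations for the sheared metric. *)
Lemma levi_civita_lower X Y x v : U x -> cmetric M x (levi_civita M X Y x) v =
  \sum_i \sum_j vderiv (X x) (fun y => Y y 0 i) x * v 0 j * (metric M x i j)%:C%C +
  \sum_i \sum_j \sum_l X x 0 i * Y x 0 j * v 0 l *
    (2%:R^-1 * (cpartial i (fun y => (metric M y j l)%:C%C) x
     + cpartial j (fun y => (metric M y i l)%:C%C) x
     - cpartial l (fun y => (metric M y i j)%:C%C) x)).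
Proof.
move=> Ux; rewrite cmetricE.
under eq_bigr => k _ do under eq_bigr => l _ do rewrite mxE !mulrDl.
under eq_bigr => k _ do rewrite big_split /=.
rewrite big_split /=; congr (_ + _).
under [RHS]eq_bigr => i _ do under eq_bigr => j _ do under eq_bigr => l _ do
  rewrite -christoffel_lower// mulr_sumr.
under [LHS]eq_bigr => k _ do under eq_bigr => l _ do rewrite -mulrA mulr_suml.
under [LHS]eq_bigr => k _ do under eq_bigr => l _ do under eq_bigr => i _ do rewrite mulr_suml.
under [LHS]eq_bigr => k _ do rewrite exchange_big /=.
rewrite exchange_big /=; apply: eq_bigr => i _.
under [LHS]eq_bigr => k _ do rewrite exchange_big /=.
rewrite exchange_big /=; apply: eq_bigr => j _.
rewrite exchange_big /=; apply: eq_bigr => l _.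
apply: eq_bigr => k _; ring.
Qed.

Lemma levi_civita_metric X Y Z x : smooth_vfield U Y -> smooth_vfield U Z -> U x ->
  vderiv (X x) (fun y => cmetric M y (Y y) (Z y)) x =
    cmetric M x (levi_civita M X Y x) (Z x) + cmetric M x (Y x) (levi_civita M X Z x).
Proof.
move=> sY sZ Ux; rewrite [X in _ + X]cmetricC// !levi_civita_lower//.
have sg := csmooth_metric; have sYZ i j := csmoothM oU (sY i) (sZ j).
transitivity (\sum_i \sum_j ((vderiv (X x) (fun y => Y y 0 i) x * Z x 0 j
     + Y x 0 i * vderiv (X x) (fun y => Z y 0 j) x) * (metric M x i j)%:C%C
     + Y x 0 i * Z x 0 j * vderiv (X x) (fun y => (metric M y i j)%:C%C) x)).
  rewrite (vderiv_ext oU _ (fun y _ => cmetricE y (Y y) (Z y)))//.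
  rewrite (vderiv_sum oU)// => [|i]; last first.
    by apply: (csmooth_sum oU) => j _; apply: (csmoothM oU).
  apply: eq_bigr => i _; rewrite (vderiv_sum oU)// => [|j]; last exact: (csmoothM oU).
  apply: eq_bigr => j _; rewrite (vderivM oU)//; congr (_ * _ + _).
  by rewrite (vderivM oU).
under eq_bigr => i _ do under eq_bigr => j _ do rewrite mulrDl -!addrA.
under eq_bigr => i _ do rewrite !big_split /=.
rewrite !big_split /= -!addrA; congr (_ + _).
rewrite [RHS]addrCA; congr (_ + _).
  rewrite exchange_big /=; apply: eq_bigr => j _; apply: eq_bigr => i _.
  by rewrite [metric M x i j]metricC//; ring.
transitivity (\sum_m \sum_i \sum_j X x 0 m * Y x 0 i * Z x 0 j *
    cpartial m (fun y => (metric M y i j)%:C%C) x).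
  rewrite exchange_big /=; under [LHS]eq_bigr => i _ do under eq_bigr => j _ do
    rewrite mulr_sumr.
  under [LHS]eq_bigr => i _ do rewrite exchange_big /=.
  rewrite exchange_big /=; apply: eq_bigr => m _; rewrite exchange_big /=.
  by apply: eq_bigr => i _; apply: eq_bigr => j _; ring.
(* Term by term, d_m g_ij is the sum of the first-kind symbols for (m, i; j) and (m, j; i), whose
   other derivatives cancel in pairs. *)
rewrite -big_split; apply: eq_bigr => m _ /=.
rewrite [X in _ = _ + X]exchange_big /= -big_split; apply: eq_bigr => i _ /=.
rewrite -big_split; apply: eq_bigr => j _ /=.
have gC k : cpartial k (fun y => (metric M y j i)%:C%C) x =
            cpartial k (fun y => (metric M y i j)%:C%C) x.
  by apply: (cpartial_ext oU) => // y Uy; rewrite metricC.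
by rewrite gC; field.
Qed.

End LeviCivita.

(** * The operators [spin_conn M A] are spinorial connections *)

Section SpinConnection.
Local Open Scope classical_set_scope.
Local Open Scope ring_scope.
Context {R : realType} {n : nat}.
Variable M : framed_domain R n.
Notation C := R[i].
Notation U := (domain M).
Notation oU := (@domain_open R n M).
Notation field := (vfield R (n + n)).
Notation spinor_field := ('rV[R]_(n + n) -> spinor R n).
Implicit Types (X Y Z : field) (x : 'rV[R]_(n + n)) (u v w : 'rV[C]_(n + n)).
Implicit Types (phi psi : spinor_field).

Lemma vderiv_frame v (f : 'rV[R]_(n + n) -> C) x : U x ->
  vderiv v f x = \sum_a frame_coord M x v 0 a * vderiv (frame M a x) f x.
Proof.
move=> Ux; rewrite {1}(frame_coordK v Ux) vderiv_suml.
by apply: eq_bigr => a _; rewrite vderivZl.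
Qed.

Lemma scale_rVE (k : C) v i : (k *: v) 0 i = k * v 0 i.
Proof. exact: mxE. Qed.

Lemma add_rVE u v i : (u + v) 0 i = u 0 i + v 0 i.
Proof. exact: mxE. Qed.

Lemma levi_civitaE X Y x k : levi_civita M X Y x 0 k =
  vderiv (X x) (fun y => Y y 0 k) x
  + \sum_i \sum_j (christoffel M x k i j)%:C%C * X x 0 i * Y x 0 j.
Proof. exact: mxE. Qed.

Lemma levi_civita_frame X Y x : U x ->
  levi_civita M X Y x = \sum_a frame_coord M x (X x) 0 a *: levi_civita M (frame M a) Y x.
Proof.
move=> Ux; apply/rowP => k; rewrite summxE levi_civitaE (vderiv_frame _ _ Ux).
under [RHS]eq_bigr => a _ do rewrite scale_rVE levi_civitaE mulrDr.
rewrite big_split /=; congr (_ + _).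
under [RHS]eq_bigr => a _ do rewrite mulr_sumr.
rewrite [RHS]exchange_big /=; apply: eq_bigr => i _.
under [RHS]eq_bigr => a _ do rewrite mulr_sumr.
rewrite [RHS]exchange_big /=; apply: eq_bigr => j _.
rewrite {1}(frame_coordK (X x) Ux) summxE mulr_sumr mulr_suml.
by apply: eq_bigr => a _; rewrite mxE; ring.
Qed.

Lemma levi_civitaD X Y Z x : smooth_vfield U Y -> smooth_vfield U Z -> U x ->
  levi_civita M X (fun y => Y y + Z y) x = levi_civita M X Y x + levi_civita M X Z x.
Proof.
move=> sY sZ Ux; apply/rowP => k; rewrite !mxE.
rewrite (vderiv_ext oU _ (g := fun y => Y y 0 k + Z y 0 k)) => [|y _|//]; last by rewrite mxE.
rewrite (vderivD oU)// -!addrA; congr (_ + _); rewrite addrCA; congr (_ + _).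
rewrite -big_split; apply: eq_bigr => i _; rewrite -big_split; apply: eq_bigr => j _ /=.
by rewrite mxE mulrDr.
Qed.

Lemma levi_civitaZ X (f : 'rV[R]_(n + n) -> C) Y x :
  csmooth U f -> smooth_vfield U Y -> U x ->
  levi_civita M X (fun y => f y *: Y y) x =
    vderiv (X x) f x *: Y x + f x *: levi_civita M X Y x.
Proof.
move=> sf sY Ux; apply/rowP => k; rewrite !mxE.
rewrite (vderiv_ext oU _ (g := fun y => f y * Y y 0 k)) => [|y _|//]; last by rewrite mxE.
rewrite (vderivM oU)// -!addrA mulrDr; congr (_ + (_ + _)).
rewrite mulr_sumr; apply: eq_bigr => i _; rewrite mulr_sumr; apply: eq_bigr => j _ /=.
by rewrite mxE; ring.
Qed.

Lemma smooth_vfieldZ (f : 'rV[R]_(n + n) -> C) X : csmooth U f -> smooth_vfield U X ->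
  smooth_vfield U (fun x => f x *: X x).
Proof.
move=> sf sX k; apply: (csmooth_ext oU _ (csmoothM oU sf (sX k))) => x _.
by rewrite mxE.
Qed.

Lemma smooth_vfield_cst v : smooth_vfield U (fun=> v).
Proof. by move=> k; exact: csmooth_cst. Qed.

Lemma smooth_vfield_sum (I : Type) (r : seq I) (F : I -> field) :
  (forall i, smooth_vfield U (F i)) -> smooth_vfield U (fun x => \sum_(i <- r) F i x).
Proof.
move=> sF k; apply: (csmooth_ext oU (f := fun x => \sum_(i <- r) F i x 0 k)).
  by move=> x _; rewrite summxE.
by apply: (csmooth_sum oU) => i _; exact: sF.
Qed.

Lemma levi_civita_ext X Y Z x : (forall y, U y -> Y y = Z y) -> U x ->
  levi_civita M X Y x = levi_civita M X Z x.
Proof.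
move=> YZ Ux; apply/rowP => k; rewrite !mxE YZ//; congr (_ + _).
by apply: (vderiv_ext oU) => // y Uy; rewrite YZ.
Qed.

Lemma levi_civita_sum X (I : Type) (r : seq I) (F : I -> field) x :
  (forall i, smooth_vfield U (F i)) -> U x ->
  levi_civita M X (fun y => \sum_(i <- r) F i y) x = \sum_(i <- r) levi_civita M X (F i) x.
Proof.
move=> sF Ux; elim: r => [|i r IH].
  rewrite big_nil (levi_civita_ext X (Z := fun y => (fun=> 0) y *: (fun=> 0) y) _ Ux); last first.
    by move=> y _; rewrite big_nil scaler0.
  rewrite levi_civitaZ// ?scale0r ?scaler0 ?addr0//; last exact: smooth_vfield_cst.
  exact: csmooth_cst.
rewrite big_cons -IH -levi_civitaD//; last exact: smooth_vfield_sum.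
by apply: levi_civita_ext Ux => y _; rewrite big_cons.
Qed.

(** Expanding Y in the frame, the Leibniz rule separates the derivatives of its components from the
    connection coefficients. *)
Lemma frame_coord_levi_civita X Y x c : smooth_vfield U Y -> U x ->
  frame_coord M x (levi_civita M X Y x) 0 c =
  vderiv (X x) (fun y => frame_coord M y (Y y) 0 c) x +
  \sum_a \sum_b frame_coord M x (X x) 0 a * frame_coord M x (Y x) 0 b * omega M x a b c.
Proof.
move=> sY Ux; pose F b : field := fun y => frame_coord M y (Y y) 0 b *: frame M b y.
have sF b : smooth_vfield U (F b).
  by apply: smooth_vfieldZ; [exact: csmooth_frame_coord|exact: frame_smooth].
rewrite (levi_civita_ext X (Z := fun y => \sum_b F b y) _ Ux); last first.
  by move=> y; exact: frame_coordK.
rewrite levi_civita_sum// linear_sum /= summxE.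
have LF b : levi_civita M X (F b) x =
    vderiv (X x) (fun y => frame_coord M y (Y y) 0 b) x *: frame M b x
    + frame_coord M x (Y x) 0 b *: levi_civita M X (frame M b) x.
  exact: levi_civitaZ (csmooth_frame_coord b sY) (frame_smooth M b) Ux.
under [LHS]eq_bigr => b _ do rewrite LF.
under [LHS]eq_bigr => b _ do rewrite linearD 2!linearZ /= frame_coord_frame// add_rVE !scale_rVE
  [delta_mx _ _ _ _]mxE eqxx /=.
rewrite big_split /=; congr (_ + _).
  rewrite (bigD1 c)//= eqxx mulr1 big1 ?addr0// => b /negPf bc.
  by rewrite eq_sym bc mulr0.
rewrite exchange_big /=; apply: eq_bigr => b _.
rewrite levi_civita_frame// linear_sum /= summxE mulr_sumr.
by apply: eq_bigr => a _; rewrite linearZ /= scale_rVE /omega; ring.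
Qed.

(** The two terms are 2 g(nabla_a e_b, e_c) and 2 g(e_b, nabla_a e_c); they add up to the derivative
    of the constant 2 g(e_b, e_c). *)
Lemma omega_metric x a b c : U x ->
  omega M x a b (dual c) + omega M x a c (dual b) = 0.
Proof.
move=> Ux; rewrite /omega !frame_coordE// !dualK -mulrDr.
rewrite [X in _ * (_ + X)]cmetricC// -levi_civita_metric//; try exact: frame_smooth.
rewrite (vderiv_ext oU _ (g := fun=> 2%:R^-1 * (c == dual b)%:R)) ?vderiv_cst ?mulr0//.
by move=> y; exact: frame_metric_dual.
Qed.

Lemma omega_upE x a d c : U x -> omega_up M x a d c = 2%:R * omega M x a (dual d) c.
Proof.
move=> Ux; rewrite /omega_up (bigD1 (dual d))//= frame_metric_invE// dualK eqxx mulr1.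
rewrite big1 ?addr0// => b bd; rewrite frame_metric_invE// -(inj_eq (inv_inj dualK)) dualK.
by rewrite eq_sym (negPf bd) mulr0 mul0r.
Qed.

Lemma omega_up_antisym x a d c : U x -> omega_up M x a d c = - omega_up M x a c d.
Proof.
move=> Ux; apply/eqP; rewrite -addr_eq0 !omega_upE// -mulrDr.
by have := omega_metric a (dual d) (dual c) Ux; rewrite !dualK => ->; rewrite mulr0.
Qed.

(** The commutator [gamma_b gamma_c, gamma_d] is gamma_b {gamma_c, gamma_d} - {gamma_b, gamma_d}
    gamma_c, so a bivector acts on vectors by commutators. Antisymmetry of w makes the two
    contracted sums equal, whence the factor -2. *)
Lemma bivector_gamma (w : 'I_(n + n) -> 'I_(n + n) -> C) d (s : spinor R n) :
  (forall b c, w b c = - w c b) ->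
  \sum_b \sum_c w b c *: gamma b (gamma c (gamma d s))
    - gamma d (\sum_b \sum_c w b c *: gamma b (gamma c s))
  = - 2%:R *: \sum_c w (dual d) c *: gamma c s.
Proof.
move=> anti; rewrite linear_sum /= -sumrB.
transitivity (\sum_b \sum_c (w b c * (c == dual d)%:R *: gamma b s
                      - w b c * (b == dual d)%:R *: gamma c s)).
  apply: eq_bigr => b _; rewrite linear_sum /= -sumrB; apply: eq_bigr => c _.
  rewrite linearZ /= -!scalerA -!scalerBr; congr (_ *: _).
  have /(congr1 (gamma b)) := gamma_anticomm c d s.
  have := gamma_anticomm b d (gamma c s).
  rewrite linearD linearZ /= => h1 h2.
  have dE a1 a2 : (a1 == dual a2) = (a2 == dual a1) by rewrite eq_sym (inv_eq dualK).
  rewrite [c == _]dE [b == _]dE -h1 -h2.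
  by rewrite opprD addrA addrK.
under [LHS]eq_bigr => b _ do rewrite sumrB.
rewrite sumrB [X in _ - X = _]exchange_big /=.
under [X in X - _ = _]eq_bigr => b _ do rewrite -scaler_suml.
under [X in _ - X = _]eq_bigr => b _ do rewrite -scaler_suml.
have E (f : 'I_(n + n) -> C) : \sum_b f b * (b == dual d)%:R = f (dual d).
  by rewrite -(sum_dual_l d); apply: eq_bigr => b _; rewrite mulrC.
under [X in X - _ = _]eq_bigr => b _ do rewrite E anti scaleNr.
under [X in _ - X = _]eq_bigr => b _ do rewrite (E (w ^~ b)).
by rewrite sumrN -opprD -mulr2n -scaler_nat scaleNr.
Qed.

Definition spin_form x a (s : spinor R n) : spinor R n :=
  4%:R^-1 *: \sum_b \sum_c omega_up M x a b c *: gamma b (gamma c s).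

Lemma spin_form_is_linear x a : linear (spin_form x a).
Proof.
move=> k s t; rewrite /spin_form scalerA mulrC -scalerA -scalerDr; congr (_ *: _).
rewrite scaler_sumr -big_split; apply: eq_bigr => b _ /=.
rewrite scaler_sumr -big_split; apply: eq_bigr => c _ /=.
by rewrite (gamma_is_linear c) (gamma_is_linear b) scalerDr !scalerA mulrC.
Qed.

HB.instance Definition _ x a := GRing.isLinear.Build C (spinor R n) (spinor R n) *:%R
  (spin_form x a) (spin_form_is_linear x a).

(** The commutator with a frame vector reproduces nabla_a e_d. This fixes the 1/4: a factor 2 comes
    from raising an index in [omega_up] and -2 from [bivector_gamma]. *)
Lemma spin_form_gamma x a d s : U x ->
  gamma d (spin_form x a s) - spin_form x a (gamma d s) = \sum_c omega M x a d c *: gamma c s.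
Proof.
move=> Ux; have num (K : numFieldType) (z : K) : 4%:R^-1 * (- 2%:R * (2%:R * z)) = - z.
  by field.
apply: oppr_inj; rewrite opprB /spin_form linearZ /= -scalerBr bivector_gamma; last first.
  by move=> b c; exact: omega_up_antisym.
rewrite !scaler_sumr -sumrN; apply: eq_bigr => c _.
by rewrite omega_upE// dualK !scalerA -mulrA num scaleNr.
Qed.

Lemma spin_formZ x a (k : C) s : spin_form x a (k *: s) = k *: spin_form x a s.
Proof. by rewrite linearZ. Qed.

Lemma spin_form_cliff x a v s : U x ->
  cliff v (spin_form x a s) - spin_form x a (cliff v s) =
    \sum_d (\sum_b v 0 b * omega M x a b d) *: gamma d s.
Proof.
move=> Ux; rewrite /cliff (linear_sum (spin_form x a)) /= -sumrB.
under [RHS]eq_bigr => d _ do rewrite scaler_suml.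
rewrite [RHS]exchange_big; apply: eq_bigr => b _ /=.
rewrite spin_formZ /= -scalerBr spin_form_gamma// scaler_sumr.
by apply: eq_bigr => d _; rewrite scalerA.
Qed.

Lemma spin_connE A X phi x : U x -> spin_conn M A X phi x =
  \sum_a frame_coord M x (X x) 0 a *:
    (spinor_vderiv (frame M a x) phi x - spin_form x a (phi x) + A x 0 a *: phi x).
Proof.
move=> Ux; rewrite /spin_conn; apply: eq_bigr => a _.
suff -> : spin_form x a (phi x) = 4%:R^-1 *: (\sum_b \sum_c omega_up M x a b c *:
         clifford M x (frame M b x) (clifford M x (frame M c x) (phi x))) by [].
rewrite /spin_form; congr (_ *: _); apply: eq_bigr => b _; apply: eq_bigr => c _.
by rewrite !cliffordE !frame_coord_frame// !cliff_delta.
Qed.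

Lemma smooth_spinor_ext phi psi : (forall x, U x -> psi x = phi x) ->
  smooth_spinor_field M phi -> smooth_spinor_field M psi.
Proof. by move=> e s I; apply: (csmooth_ext oU _ (s I)) => x Ux; rewrite e. Qed.

Lemma smooth_spinorD phi psi : smooth_spinor_field M phi -> smooth_spinor_field M psi ->
  smooth_spinor_field M (fun x => phi x + psi x).
Proof.
move=> s t I; apply: (csmooth_ext oU _ (csmoothD oU (s I) (t I))) => x _.
by rewrite ffunE.
Qed.

Lemma smooth_spinorZ (f : 'rV[R]_(n + n) -> C) phi :
  csmooth U f -> smooth_spinor_field M phi -> smooth_spinor_field M (fun x => f x *: phi x).
Proof.
move=> s t I; apply: (csmooth_ext oU _ (csmoothM oU s (t I))) => x _.
by rewrite ffunE.
Qed.

Lemma smooth_spinor_cst s : smooth_spinor_field M (fun=> s).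
Proof. by move=> I; exact: csmooth_cst. Qed.

Lemma smooth_spinor_sum (I : Type) (r : seq I) (F : I -> spinor_field) :
  (forall i, smooth_spinor_field M (F i)) ->
  smooth_spinor_field M (fun x => \sum_(i <- r) F i x).
Proof.
move=> sF; elim: r => [|i r IH].
  apply: (smooth_spinor_ext (phi := fun=> 0)) => [x _|]; first by rewrite big_nil.
  exact: smooth_spinor_cst.
by apply: (smooth_spinor_ext _ (smooth_spinorD (sF i) IH)) => x _; rewrite big_cons.
Qed.

Lemma smooth_gamma a phi : smooth_spinor_field M phi ->
  smooth_spinor_field M (fun x => gamma a (phi x)).
Proof.
move=> s I; case: (split_ordP a) => i ->.
  apply: (csmooth_ext oU (f := fun x => if i \in I then 0 else
    koszul_sign i I * phi x (i |: I))) => [x _|]; first by rewrite gamma_lshift ffunE.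
  case: (i \in I); first exact: csmooth_cst.
  by apply: (csmoothM oU); [exact: csmooth_cst|exact: s].
apply: (csmooth_ext oU (f := fun x => if i \in I then
    koszul_sign i (I :\ i) * phi x (I :\ i) else 0)) => [x _|]; first by rewrite gamma_rshift ffunE.
case: (i \in I); last exact: csmooth_cst.
by apply: (csmoothM oU); [exact: csmooth_cst|exact: s].
Qed.

Lemma smooth_omega a b c : csmooth U (fun x => omega M x a b c).
Proof.
by apply: csmooth_frame_coord; apply: smooth_levi_civita; exact: frame_smooth.
Qed.

Lemma smooth_spin_form a phi : smooth_spinor_field M phi ->
  smooth_spinor_field M (fun x => spin_form x a (phi x)).
Proof.
move=> s; apply: (@smooth_spinorZ (fun=> 4%:R^-1)); first exact: csmooth_cst.
apply: smooth_spinor_sum => b; apply: smooth_spinor_sum => c; apply: smooth_spinorZ.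
  apply: (csmooth_ext oU (fun x Ux => omega_upE a b c Ux)).
  by apply: (csmoothM oU); [exact: csmooth_cst|exact: smooth_omega].
by do 2!apply: smooth_gamma.
Qed.

Lemma smooth_spin_conn A X phi : smooth_one_form M A -> smooth_vfield U X ->
  smooth_spinor_field M phi -> smooth_spinor_field M (spin_conn M A X phi).
Proof.
move=> sA sX s; apply: (smooth_spinor_ext (fun x Ux => spin_connE A X phi Ux)).
apply: smooth_spinor_sum => a; apply: smooth_spinorZ; first exact: csmooth_frame_coord.
apply: smooth_spinorD; last exact: smooth_spinorZ.
apply: smooth_spinorD.
  move=> I; apply: (csmooth_ext oU (f := fun x => vderiv (frame M a x) (phi ^~ I) x)).
    by move=> x _; rewrite ffunE.
  by apply: (csmooth_vderiv oU); [exact: frame_smooth|exact: s].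
apply: (smooth_spinor_ext (phi := fun x => -1 *: spin_form x a (phi x))) => [x _|].
  by rewrite scaleN1r.
by apply: (@smooth_spinorZ (fun=> -1)); [exact: csmooth_cst|exact: smooth_spin_form].
Qed.

Lemma spinor_vderivD v phi psi x : smooth_spinor_field M phi -> smooth_spinor_field M psi ->
  U x -> spinor_vderiv v (fun y => phi y + psi y) x = spinor_vderiv v phi x + spinor_vderiv v psi x.
Proof.
move=> s t Ux; apply/ffunP => I; rewrite !ffunE -(vderivD oU)//.
by apply: (vderiv_ext oU _ _ Ux) => y _; rewrite ffunE.
Qed.

Lemma spinor_vderivZ v f phi x : csmooth U f -> smooth_spinor_field M phi -> U x ->
  spinor_vderiv v (fun y => f y *: phi y) x = vderiv v f x *: phi x + f x *: spinor_vderiv v phi x.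
Proof.
move=> s t Ux; apply/ffunP => I; rewrite !ffunE.
transitivity (vderiv v (fun y => f y * phi y I) x).
  by apply: (vderiv_ext oU _ _ Ux) => y _; rewrite ffunE.
by rewrite (vderivM oU).
Qed.

Lemma spinor_vderiv_ext v phi psi x : (forall y, U y -> phi y = psi y) -> U x ->
  spinor_vderiv v phi x = spinor_vderiv v psi x.
Proof.
move=> e Ux; apply/ffunP => I; rewrite !ffunE.
by apply: (vderiv_ext oU _ _ Ux) => y Uy; rewrite e.
Qed.

Lemma spinor_vderiv_cst v s x : spinor_vderiv v (fun=> s) x = 0.
Proof. by apply/ffunP => I; rewrite !ffunE vderiv_cst. Qed.

Lemma spinor_vderiv_sum v (I : Type) (r : seq I) (F : I -> spinor_field) x :
  (forall i, smooth_spinor_field M (F i)) -> U x ->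
  spinor_vderiv v (fun y => \sum_(i <- r) F i y) x = \sum_(i <- r) spinor_vderiv v (F i) x.
Proof.
move=> sF Ux; elim: r => [|i r IH].
  rewrite big_nil; transitivity (spinor_vderiv v (fun=> 0) x); last exact: spinor_vderiv_cst.
  by apply: (spinor_vderiv_ext _ _ Ux) => y _; rewrite big_nil.
rewrite big_cons -IH -spinor_vderivD//; last exact: smooth_spinor_sum.
by apply: (spinor_vderiv_ext _ _ Ux) => y _; rewrite big_cons.
Qed.

Lemma spinor_vderiv_gamma v a phi x : smooth_spinor_field M phi -> U x ->
  spinor_vderiv v (fun y => gamma a (phi y)) x = gamma a (spinor_vderiv v phi x).
Proof.
move=> s Ux; have K (k : C) I : vderiv v (fun y => k * phi y I) x = k * vderiv v (phi ^~ I) x.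
  by rewrite (vderivM oU) ?vderiv_cst ?mul0r ?add0r//; exact: csmooth_cst.
apply/ffunP => I; rewrite ffunE; case: (split_ordP a) => i ->.
  rewrite gamma_lshift ffunE ffunE -K; case: (boolP (i \in I)) => iI.
    rewrite -(vderiv_cst v 0 x); apply: (vderiv_ext oU _ _ Ux) => y _.
    by rewrite gamma_lshift ffunE iI.
  by apply: (vderiv_ext oU _ _ Ux) => y _; rewrite gamma_lshift ffunE (negPf iI).
rewrite gamma_rshift ffunE ffunE -K; case: (boolP (i \in I)) => iI.
  by apply: (vderiv_ext oU _ _ Ux) => y _; rewrite gamma_rshift ffunE iI.
rewrite -(vderiv_cst v 0 x); apply: (vderiv_ext oU _ _ Ux) => y _.
by rewrite gamma_rshift ffunE (negPf iI).
Qed.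

Lemma spinor_vderiv_clifford (v : 'rV[C]_(n + n)) Y phi x :
  smooth_vfield U Y -> smooth_spinor_field M phi -> U x ->
  spinor_vderiv v (fun y => clifford M y (Y y) (phi y)) x =
   \sum_d (vderiv v (fun y => frame_coord M y (Y y) 0 d) x *: gamma d (phi x)
           + frame_coord M x (Y x) 0 d *: gamma d (spinor_vderiv v phi x)).
Proof.
move=> sY s Ux.
rewrite (spinor_vderiv_ext v
  (psi := fun y => \sum_d frame_coord M y (Y y) 0 d *: gamma d (phi y)) _ Ux); last first.
  by move=> y _; rewrite cliffordE.
have sc d := csmooth_frame_coord d sY; have sg d := smooth_gamma d s.
rewrite spinor_vderiv_sum//; last by move=> d; exact: smooth_spinorZ.
by apply: eq_bigr => d _; rewrite spinor_vderivZ// spinor_vderiv_gamma.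
Qed.

Lemma addr_shuffle6 (V : zmodType) (a b c d e f : V) :
  a + b + (c + d) + (e + f) = a + c + e + (b + d + f).
Proof. by rewrite (addrACA a b) (addrACA (a + c)). Qed.

Lemma addr_cancel_mid (V : zmodType) (p q r u v : V) :
  p + q - r + v = p + (u - r) + (q - u + v).
Proof.
rewrite -!addrA; congr (_ + _); rewrite (addrCA (- r) q) (addrCA u q); congr (_ + _).
by rewrite (addrCA (- r) (- u)) addNKr.
Qed.

Lemma scale_leibniz (K : comPzRingType) (V : lmodType K) (c d f a : K) (p q r : V) :
  c *: (d *: p + f *: q - f *: r + a *: (f *: p)) =
  (c * d) *: p + f *: (c *: (q - r + a *: p)).
Proof.
rewrite !(scalerDr, scalerN, scalerA, addrA) [f * c]mulrC -!mulrA [f * a]mulrC.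
by [].
Qed.

(** Only the Clifford-Leibniz rule has content: differentiating the frame components of v gives the
    derivative part of nabla_X v, the commutator with [spin_form] gives its [omega] part, and the
    scalar A commutes with Clifford multiplication. *)
Lemma spin_conn_spinorial A : smooth_one_form M A -> spinorial_connection M (spin_conn M A).
Proof.
move=> sA; split.
- by move=> X phi sX s; exact: smooth_spin_conn.
- move=> f X Y phi x _ _ _ _ Ux.
  rewrite !spin_connE// scaler_sumr -big_split; apply: eq_bigr => a _ /=.
  by rewrite linearP add_rVE scale_rVE scalerDl scalerA.
- move=> X phi chi x sX s t Ux.
  rewrite !spin_connE// -big_split; apply: eq_bigr => a _ /=.
  rewrite -scalerDr; congr (_ *: _).
  rewrite spinor_vderivD// (linearD (spin_form x a)) /= scalerDr opprD.
  exact: addr_shuffle6.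
- move=> f X phi x sf sX s Ux.
  rewrite !spin_connE// (vderiv_frame _ _ Ux) scaler_suml scaler_sumr -big_split.
  apply: eq_bigr => a _ /=; rewrite spinor_vderivZ// spin_formZ /=.
  exact: scale_leibniz.
- move=> X Y phi x sX sY s Ux; rewrite !spin_connE// !cliffordE.
  have -> : cliff (frame_coord M x (levi_civita M X Y x)) (phi x) =
      \sum_a frame_coord M x (X x) 0 a *: \sum_d
        (vderiv (frame M a x) (fun y => frame_coord M y (Y y) 0 d) x
         + \sum_b frame_coord M x (Y x) 0 b * omega M x a b d) *: gamma d (phi x).
    under [RHS]eq_bigr => a _ do rewrite scaler_sumr.
    rewrite [RHS]exchange_big; apply: eq_bigr => d _ /=.
    rewrite frame_coord_levi_civita// (vderiv_frame _ _ Ux) -big_split scaler_suml.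
    apply: eq_bigr => a _ /=; rewrite [RHS]scalerA mulrDr; congr ((_ + _) *: _).
    by rewrite mulr_sumr; apply: eq_bigr => b _; rewrite mulrA.
  rewrite linear_sum /= -big_split; apply: eq_bigr => a _ /=.
  rewrite cliffZr /= -scalerDr; congr (_ *: _).
  under [X in _ = X + _]eq_bigr => d _ do rewrite scalerDl.
  rewrite (big_split _ _ _ (fun d => vderiv _ _ _ *: _)) /= -spin_form_cliff//.
  rewrite (linearD (cliff _)) (linearB (cliff _)) /= (cliffZr _ (A x 0 a) (phi x)).
  rewrite spinor_vderiv_clifford// big_split /=.
  exact: addr_cancel_mid.
Qed.

End SpinConnection.

(** * Null spaces of pure spinors as maximal isotropic row spaces *)

Section PureSpinors.
Local Open Scope ring_scope.

(** Turns a subspace into the row space of a matrix, so that dimension counts become rank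
    computations. *)
Lemma vspace_row_basis (K : fieldType) m k (V : {vspace 'rV[K]_m}) : \dim V = k ->
  exists2 B : 'M[K]_(k, m), row_free B & forall v, (v \in V) = (v <= B)%MS.
Proof.
move=> <-; exists (\matrix_i (vbasis V)`_i).
  apply/inj_row_free => c; rewrite mulmx_sum_row => c0.
  have /freeP f := basis_free (vbasisP V).
  apply/rowP => i; rewrite mxE; apply: (f (c 0)).
  by rewrite -[RHS]c0; apply: eq_bigr => j _; rewrite rowK.
move=> v; apply/idP/submxP => [vV|[c ->]].
  exists (\row_i coord (vbasis V) i v); rewrite mulmx_sum_row {1}(coord_vbasis vV).
  by apply: eq_bigr => i _; rewrite rowK mxE.
rewrite mulmx_sum_row; apply: memv_suml => i _; apply: memvZ; rewrite rowK.
by apply: vbasis_mem; apply: mem_nth; rewrite size_tuple.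
Qed.

Context {R : realType} {n : nat}.
Notation C := R[i].
Implicit Types (s chi : spinor R n) (u v w : 'rV[C]_(n + n)).

(** The n independent rows of B form a basis of the null space of s in frame components; the shape
    of B encodes purity. *)
Definition row_null_space (B : 'M[C]_(n, n + n)) s :=
  row_free B /\ forall v, (cliff v s == 0) = (v <= B)%MS.

Definition dual_perm : {perm _} := perm (inv_inj (@dualK n)).

Lemma pairingE u v : pairing u v = (u *m (col_perm dual_perm v)^T) 0 0.
Proof. by rewrite mxE; apply: eq_bigr => a _; rewrite !mxE permE. Qed.

(** The orthogonal of a row space is the kernel of a matrix of the same rank, because the Gram
    matrix of [pairing] is a permutation matrix. *)
Lemma pairing0_sub k (B : 'M[C]_(k, n + n)) u :
  (forall i, pairing u (row i B) = 0) <-> (u <= kermx (col_perm dual_perm B)^T)%MS.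
Proof.
split=> [H|/sub_kermxP H i].
  apply/sub_kermxP/rowP => i; rewrite [RHS]mxE -(H i) pairingE !mxE.
  by apply: eq_bigr => a _; rewrite !mxE.
have := congr1 (fun w : 'rV_k => w 0 i) H; rewrite [RHS]mxE => <-.
by rewrite pairingE !mxE; apply: eq_bigr => a _; rewrite !mxE.
Qed.

Lemma rank_dual_perm k (B : 'M[C]_(k, n + n)) : \rank (col_perm dual_perm B)^T = \rank B.
Proof. by rewrite mxrank_tr col_permE mxrankMfree// row_free_unit unitmx_perm. Qed.

Section NullSpace.
Variables (B : 'M[C]_(n, n + n)) (s : spinor R n).
Hypotheses (s0 : s != 0) (nB : row_null_space B s).

Lemma null_isotropic u v : cliff u s = 0 -> cliff v s = 0 -> pairing u v = 0.
Proof.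
move=> us vs; have := cliff_anticomm u v s.
by rewrite us vs !linear0 addr0 => /esym/eqP; rewrite scaler_eq0 (negPf s0) orbF => /eqP.
Qed.

Lemma row_null i : cliff (row i B) s = 0.
Proof. by apply/eqP; rewrite nB.2 row_sub. Qed.

(** The null space N is isotropic, so it lies in its orthogonal; both have dimension n, hence they
    coincide. *)
Lemma null_perp w : (forall z, cliff z s = 0 -> pairing w z = 0) -> cliff w s = 0.
Proof.
move=> H; apply/eqP; rewrite nB.2.
have /pairing0_sub wK : forall i, pairing w (row i B) = 0 by move=> i; exact/H/row_null.
have BK : (B <= kermx (col_perm dual_perm B)^T)%MS.
  apply/row_subP => i; apply/pairing0_sub => j.
  by apply: null_isotropic; exact: row_null.
apply: submx_trans wK _; rewrite -(mxrank_leqif_sup BK).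
by rewrite mxrank_ker rank_dual_perm (eqP nB.1) addnK.
Qed.

(** The orthogonal of three vectors has dimension at least 2n - 3, which exceeds n = dim N when n >
    3. *)
Lemma exists_perp_not_null y1 y2 y3 : (3 < n)%N ->
  exists2 v, cliff v s != 0 & [/\ pairing v y1 = 0, pairing v y2 = 0 & pairing v y3 = 0].
Proof.
move=> n3; pose Y := col_mx y1 (col_mx y2 y3).
have : ~~ (kermx (col_perm dual_perm Y)^T <= B)%MS.
  apply/negP => /mxrankS; rewrite mxrank_ker rank_dual_perm (eqP nB.1).
  have := rank_leq_row Y; move: (\rank Y) => r; rewrite leq_subLR => r3 h.
  by have := leq_trans h (leq_add r3 (leqnn n)); rewrite leq_add2r leqNgt n3.
move=> /row_subPn [i iB]; exists (row i (kermx (col_perm dual_perm Y)^T)).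
  by rewrite nB.2.
have /pairing0_sub H := row_sub i (kermx (col_perm dual_perm Y)^T).
split.
- by have := H (lshift _ 0); rewrite rowKu row_id.
- by have := H (rshift _ (lshift _ 0)); rewrite rowKd rowKu row_id.
- by have := H (rshift _ (rshift _ 0)); rewrite rowKd rowKd row_id.
Qed.

Lemma cliff_swap u v t : pairing u v = 0 -> cliff u (cliff v t) = - cliff v (cliff u t).
Proof.
by move=> uv; apply/eqP; rewrite -addr_eq0 cliff_anticomm uv scale0r.
Qed.

Lemma cliff_mulmx_ind k (P : spinor R n -> Prop) (D : 'M[C]_(k, n + n)) t :
  P 0 -> (forall a r r', P r -> P r' -> P (a *: r + r')) ->
  (forall i, P (cliff (row i D) t)) -> forall c : 'rV[C]_k, P (cliff (c *m D) t).
Proof.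
move=> P0 PD Pi c; rewrite mulmx_sum_row.
elim: (index_enum _) => [|i r IH].
  by rewrite big_nil -(scale0r 0) cliffZl scale0r.
by rewrite big_cons cliffDl cliffZl; apply: PD.
Qed.

Lemma cliffN v t : cliff v (- t) = - cliff v t.
Proof. by rewrite linearN. Qed.

Lemma cliff0 v : cliff v 0 = 0.
Proof. by rewrite linear0. Qed.

(** By trilinearity the three vectors may be taken among the two basis vectors of N. Two of them
    then coincide; anticommutation makes them adjacent, and a null vector squares to zero. *)
Lemma cliff3_dim2 u v w t : n = 2 -> cliff u s = 0 -> cliff v s = 0 -> cliff w s = 0 ->
  cliff u (cliff v (cliff w t)) = 0.
Proof.
move=> n2 /eqP + /eqP + /eqP; rewrite !nB.2 => /submxP[a ->] /submxP[b ->] /submxP[c ->].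
have iso i j : pairing (row i B) (row j B) = 0 by apply: null_isotropic; exact: row_null.
have sq i r : cliff (row i B) (cliff (row i B) r) = 0 by apply: cliff_sqr.
apply: (cliff_mulmx_ind (P := fun r => r = 0)) => // [k r r' -> ->|i].
  by rewrite scaler0 addr0.
apply: (cliff_mulmx_ind (P := fun r => cliff (row i B) r = 0)) => [|k r r' e e'|j].
- exact: cliff0.
- by rewrite (cliff_is_linear (row i B)) e e' scaler0 addr0.
apply: (cliff_mulmx_ind (P := fun r => cliff (row i B) (cliff (row j B) r) = 0))
  => [|l r r' e e'|k].
- by rewrite !cliff0.
- by rewrite !cliff_is_linear e e' scaler0 addr0.
have [->|ij] := eqVneq i j; first exact: sq.
have [->|jk] := eqVneq j k; first by rewrite sq cliff0.
have -> : k = i.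
  have lt2 (l : 'I_n) : (l < 2)%N by rewrite -[X in (_ < X)%N]n2.
  apply/val_inj; move: ij jk (lt2 i) (lt2 j) (lt2 k); rewrite -!val_eqE /=.
  by case: (val i) => [|[]]//; case: (val j) => [|[]]//; case: (val k) => [|[]].
by rewrite cliff_swap// sq cliff0 oppr0.
Qed.

(* z.y.x.chi = c s for z in N. If n > 3, some v outside N is orthogonal to x, y, z;
   moving v to the left in x.z.y.v.chi = 0 then yields c v.s = 0. *)
Lemma twistor_null_product chi x y : n = 2 \/ (3 < n)%N ->
  cliff x s = 0 -> cliff y s = 0 ->
  (forall v, exists w, cliff y (cliff v chi) = cliff w s) ->
  cliff y (cliff x chi) = 0.
Proof.
move=> dimn xs ys H; have [w e] := H x; rewrite e; apply: null_perp => z zs.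
have iso u v : cliff u s = 0 -> cliff v s = 0 -> pairing u v = 0 := @null_isotropic u v.
have cz : cliff z (cliff y (cliff x chi)) = pairing w z *: s.
  by rewrite e pairingC -cliff_anticomm zs cliff0 addr0.
case: dimn => [n2|n3].
  move/eqP: cz; rewrite cliff3_dim2// eq_sym scaler_eq0 (negPf s0) orbF => /eqP ->//.
have [v vs [vx vy vz]] := exists_perp_not_null x y z n3.
have [w' e'] := H v.
(* Here y.v.chi has the form w'.s, so z maps it to a multiple of s, which x kills. *)
have : cliff x (cliff z (cliff y (cliff v chi))) = 0.
  rewrite e' (_ : cliff z (cliff w' s) = pairing z w' *: s).
    by rewrite cliffZr xs scaler0.
  by rewrite -cliff_anticomm zs cliff0 addr0.
rewrite (cliff_swap chi (etrans (pairingC y v) vy)) !cliffN.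
rewrite (cliff_swap _ (etrans (pairingC z v) vz)) cliffN opprK.
rewrite (cliff_swap _ (etrans (pairingC x v) vx)) (cliff_swap _ (iso _ _ xs zs)).
rewrite cliffN opprK (cliff_swap _ (iso _ _ xs ys)).
rewrite !cliffN cz cliffZr => /eqP; rewrite oppr_eq0 scaler_eq0 (negPf vs) orbF => /eqP.
by [].
Qed.

End NullSpace.
End PureSpinors.

(** * From the twistor equation to integrability *)

Section TwistorIntegrability.
Local Open Scope classical_set_scope.
Local Open Scope ring_scope.
Context {R : realType} {n : nat}.
Variable M : framed_domain R n.
Notation C := R[i].
Notation U := (domain M).
Notation oU := (@domain_open R n M).
Notation field := (vfield R (n + n)).
Notation spinor_field := ('rV[R]_(n + n) -> spinor R n).
Implicit Types (X Y Z : field) (x : 'rV[R]_(n + n)) (u v w : 'rV[C]_(n + n)).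
Implicit Types (phi psi : spinor_field).

Definition cliffordl x s v := clifford M x v s.

Lemma cliffordl_is_linear x s : linear (cliffordl x s).
Proof. by move=> k u v; rewrite /cliffordl !cliffordE linearP cliffDl cliffZl. Qed.

HB.instance Definition _ x s := GRing.isLinear.Build C 'rV[C]_(n + n) (spinor R n) *:%R
  (cliffordl x s) (cliffordl_is_linear x s).

Lemma mem_annihilator phi x v :
  (v \in annihilator M phi x) = (clifford M x v (phi x) == 0).
Proof.
rewrite /annihilator memv_ker -[linfun _]/(linfun (cliffordl x (phi x))).
by rewrite lfunE.
Qed.

(** [annihilator] contains coordinate vectors while [cliff] takes frame components, so a basis
    matrix is multiplied by the inverse of the frame matrix. *)
Lemma pure_row_null_space phi x : U x -> \dim (annihilator M phi x) = n ->
  exists B, row_null_space B (phi x).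
Proof.
move=> Ux /vspace_row_basis[B fB memB].
have uF := frame_mx_unit Ux.
exists (B *m invmx (frame_mx M x)); split.
  by rewrite /row_free mxrankMfree ?row_free_unit ?unitmx_inv.
move=> c; have cE : c = frame_coord M x (c *m frame_mx M x).
  by rewrite /frame_coord -/(frame_mx M x) mulmxK.
rewrite {1}cE -cliffordE -mem_annihilator memB.
have fF : row_free (frame_mx M x) by rewrite row_free_unit.
by rewrite -[RHS](submxMfree _ _ fF) mulmxKV.
Qed.

Variable nabla : @spinor_operator R n.
Hypothesis nablaP : spinorial_connection M nabla.

(* psi is unchanged when multiplied by the indicator function of the complement
   of U, which is smooth on the open set U. *)
Lemma spinorial_vanishing X psi x : smooth_vfield U X ->
  (forall y, U y -> psi y = 0) -> U x -> nabla X psi x = 0.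
Proof.
move=> sX psi0 Ux.
have spsi : smooth_spinor_field M psi.
  by apply: (smooth_spinor_ext psi0); exact: smooth_spinor_cst.
pose f y : C := if `[< U y >] then 0 else 1.
have f0 y : U y -> f y = 0 by move=> Uy; rewrite /f asboolT.
have sf : csmooth U f by apply: (csmooth_ext oU f0); exact: csmooth_cst.
have e : psi = (fun y => f y *: psi y).
  apply/funext => y; rewrite /f; case: asboolP => Uy; last by rewrite scale1r.
  by rewrite scale0r psi0.
rewrite e (spinorial_leibniz nablaP sf sX spsi Ux) f0// scale0r addr0.
by rewrite (vderiv_ext oU _ f0)// vderiv_cst scale0r.
Qed.

(** Obtained by applying nabla_X to the identity Y.phi = 0 on the domain. *)
Lemma clifford_levi_civita_null X Y phi x : smooth_vfield U X -> smooth_vfield U Y ->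
  smooth_spinor_field M phi -> (forall y, U y -> clifford M y (Y y) (phi y) = 0) -> U x ->
  clifford M x (levi_civita M X Y x) (phi x) = - clifford M x (Y x) (nabla X phi x).
Proof.
move=> sX sY s Y0 Ux; apply/eqP; rewrite -addr_eq0.
by rewrite -(spinorial_clifford nablaP sX sY s Ux) spinorial_vanishing.
Qed.

Lemma clifford_lie_bracket X Y phi x : smooth_vfield U X -> smooth_vfield U Y ->
  smooth_spinor_field M phi -> (forall y, U y -> clifford M y (X y) (phi y) = 0) ->
  (forall y, U y -> clifford M y (Y y) (phi y) = 0) -> U x ->
  clifford M x (lie_bracket X Y x) (phi x) =
    clifford M x (X x) (nabla Y phi x) - clifford M x (Y x) (nabla X phi x).
Proof.
move=> sX sY s X0 Y0 Ux; rewrite (levi_civita_torsion_free (M := M))//.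
rewrite -[LHS]/(cliffordl x (phi x) (_ - _)) linearB /= /cliffordl.
by rewrite !clifford_levi_civita_null// opprK addrC.
Qed.

Lemma twistor_integrable phi : n = 2 \/ (3 < n)%N -> pure_spinor_field M phi ->
  is_twistor M nabla phi -> generates_integrable M phi.
Proof.
move=> dimn [s pur] tw X Y sX sY X0 Y0 x Ux; rewrite mem_annihilator.
have X0' y : U y -> clifford M y (X y) (phi y) = 0.
  by move=> Uy; apply/eqP; rewrite -mem_annihilator X0.
have Y0' y : U y -> clifford M y (Y y) (phi y) = 0.
  by move=> Uy; apply/eqP; rewrite -mem_annihilator Y0.
rewrite clifford_lie_bracket//.
have n0 : (2 * n)%:R != 0 :> C by rewrite pnatr_eq0; case: dimn => [->|] //; case: n.
set chi := dirac M nabla phi x.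
have twE Z : smooth_vfield U Z -> nabla Z phi x = (2 * n)%:R^-1 *: clifford M x (Z x) chi.
  by move=> sZ; apply/eqP; rewrite -subr_eq0; apply/eqP; exact: tw.
have [phi0 dim_n] := pur x Ux; have [B nB] := pure_row_null_space Ux dim_n.
have Yx := Y0' _ Ux; have Xx := X0' _ Ux; move: (Yx) (Xx); rewrite !cliffordE => Yc Xc.
have YX0 : cliff (frame_coord M x (Y x)) (cliff (frame_coord M x (X x)) chi) = 0.
  apply: (twistor_null_product phi0 nB dimn Xc Yc) => c.
  (* The prescribed vector is extended as a field with constant coordinates; the Leibniz rule then
     exhibits y.v.chi as w.phi with w = -2n nabla_v Y. *)
  pose v := \sum_a c 0 a *: frame M a x.
  have := clifford_levi_civita_null (smooth_vfield_cst M v) sY s Y0' Ux.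
  rewrite twE; last exact: smooth_vfield_cst.
  rewrite !cliffordE /v frame_coord_sum// cliffZr => e.
  exists (- (2 * n)%:R *: frame_coord M x (levi_civita M (fun=> v) Y x)).
  by rewrite cliffZl e scalerN scaleNr opprK scalerA mulfV// scale1r.
rewrite !twE// !cliffordE !cliffZr YX0 scaler0 subr0.
have := cliff_anticomm (frame_coord M x (X x)) (frame_coord M x (Y x)) chi.
by rewrite YX0 addr0 => ->; rewrite (null_isotropic phi0 Xc Yc) scale0r scaler0.
Qed.

End TwistorIntegrability.

(** * Linear algebra of spinors in dimension four *)

Section FourDimensionalSpinors.
Local Open Scope ring_scope.
Context {R : realType}.
Notation C := R[i].
Implicit Types (a b c d p q r t : C).

Let i0 : 'I_2 := ord0.
Let i1 : 'I_2 := lift ord0 ord0.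

(** The spinor a + b theta^1 + c theta^2 + d theta^12: even part (a, d), odd part (b, c). *)
Definition spin2 a b c d : spinor R 2 := [ffun I : {set 'I_2} =>
  if i0 \in I then (if i1 \in I then d else b) else (if i1 \in I then c else a)].

Definition e0 : 'I_(2 + 2) := lshift 2 i0.
Definition e1 : 'I_(2 + 2) := lshift 2 i1.
Definition t0 : 'I_(2 + 2) := rshift 2 i0.
Definition t1 : 'I_(2 + 2) := rshift 2 i1.

Lemma spin2E (s : spinor R 2) :
  s = spin2 (s finset.set0) (s [set i0]%SET) (s [set i1]%SET) (s [set: 'I_2]%SET).
Proof.
apply/ffunP => I; rewrite ffunE.
have IE (J : {set 'I_2}) : (i0 \in I) = (i0 \in J) -> (i1 \in I) = (i1 \in J) -> I = J.
  move=> h0 h1; apply/setP => -[[|[|//]] k].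
    by rewrite (_ : Ordinal k = i0)//; apply/val_inj.
  by rewrite (_ : Ordinal k = i1)//; apply/val_inj.
by case: ifP => h0; case: ifP => h1; congr (s _); apply: IE; rewrite ?h0 ?h1 !inE.
Qed.

Lemma spin2_inj a b c d a' b' c' d' : spin2 a b c d = spin2 a' b' c' d' ->
  [/\ a = a', b = b', c = c' & d = d'].
Proof.
move=> /ffunP e; split.
- by have := e finset.set0; rewrite !ffunE !inE.
- by have := e [set i0]%SET; rewrite !ffunE !inE.
- by have := e [set i1]%SET; rewrite !ffunE !inE.
- by have := e [set: 'I_2]%SET; rewrite !ffunE !inE.
Qed.

Lemma spin2_0 : spin2 0 0 0 0 = 0.
Proof. by apply/ffunP => I; rewrite !ffunE; case: ifP; case: ifP. Qed.

Lemma spin2D a b c d a' b' c' d' :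
  spin2 a b c d + spin2 a' b' c' d' = spin2 (a + a') (b + b') (c + c') (d + d').
Proof. by apply/ffunP => I; rewrite !ffunE; case: ifP; case: ifP. Qed.

Lemma spin2Z k a b c d : k *: spin2 a b c d = spin2 (k * a) (k * b) (k * c) (k * d).
Proof. by apply/ffunP => I; rewrite !ffunE; case: ifP; case: ifP. Qed.

Lemma spin2BZ x y z w r a b c d : spin2 x y z w - r *: spin2 a b c d =
  spin2 (x - r * a) (y - r * b) (z - r * c) (w - r * d).
Proof. by rewrite spin2Z; apply/ffunP => I; rewrite !ffunE; case: ifP; case: ifP. Qed.

Lemma spin2_eq a b c d a' b' c' d' : a = a' -> b = b' -> c = c' -> d = d' ->
  spin2 a b c d = spin2 a' b' c' d'.
Proof. by move=> -> -> -> ->. Qed.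

Lemma koszul_sign2 i (I : {set 'I_2}) :
  koszul_sign i I = (if (i == i1) && (i0 \in I) then -1 else 1) :> C.
Proof.
rewrite /koszul_sign; case: (eqVneq i i1) => [->|ii] /=.
  rewrite (_ : [set j in I | (j < i1)%N]%SET = if i0 \in I then [set i0]%SET else finset.set0).
    by case: ifP => _; rewrite ?cards1 ?cards0 ?expr1 ?expr0.
  apply/setP => -[[|[|//]] k]; rewrite !inE /= ?andbF ?andbT.
    by rewrite (_ : Ordinal k = i0) //; [case: ifP; rewrite !inE|apply/val_inj].
  by case: ifP; rewrite !inE.
rewrite (_ : [set j in I | (j < i)%N]%SET = finset.set0) ?cards0//.
have -> : i = i0 by apply/val_inj; move: ii; case: i => -[|[|]].
by apply/setP => j; rewrite !inE ltn0 andbF.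
Qed.

Lemma gamma_e0 a b c d : gamma e0 (spin2 a b c d) = spin2 b 0 d 0.
Proof.
rewrite gamma_lshift contractE; apply/ffunP => I; rewrite !ffunE !in_toggle koszul_sign2 /=.
by case: (i0 \in I); case: (i1 \in I); rewrite /= ?mul1r ?mulN1r.
Qed.
Lemma gamma_e1 a b c d : gamma e1 (spin2 a b c d) = spin2 c (- d) 0 0.
Proof.
rewrite gamma_lshift contractE; apply/ffunP => I; rewrite !ffunE !in_toggle koszul_sign2 /=.
by case: (i0 \in I); case: (i1 \in I); rewrite /= ?mul1r ?mulN1r.
Qed.
Lemma gamma_t0 a b c d : gamma t0 (spin2 a b c d) = spin2 0 a 0 c.
Proof.
rewrite gamma_rshift wedgeE; apply/ffunP => I; rewrite !ffunE !in_toggle koszul_sign2 /=.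
by case: (i0 \in I); case: (i1 \in I); rewrite /= ?mul1r ?mulN1r.
Qed.
Lemma gamma_t1 a b c d : gamma t1 (spin2 a b c d) = spin2 0 0 a (- b).
Proof.
rewrite gamma_rshift wedgeE; apply/ffunP => I; rewrite !ffunE !in_toggle koszul_sign2 /=.
by case: (i0 \in I); case: (i1 \in I); rewrite /= ?mul1r ?mulN1r.
Qed.
Definition gamma2 := (gamma_e0, gamma_e1, gamma_t0, gamma_t1).

Lemma dual_e0 : dual e0 = t0. Proof. exact: dual_lshift. Qed.
Lemma dual_e1 : dual e1 = t1. Proof. exact: dual_lshift. Qed.
Lemma dual_t0 : dual t0 = e0. Proof. exact: dual_rshift. Qed.
Lemma dual_t1 : dual t1 = e1. Proof. exact: dual_rshift. Qed.
Definition dual2 := (dual_e0, dual_e1, dual_t0, dual_t1).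

Lemma sum4 (V : nmodType) (F : 'I_(2 + 2) -> V) :
  \sum_a F a = F e0 + F e1 + (F t0 + F t1).
Proof. by rewrite big_split_ord /= !big_ord_recl !big_ord0 /= !addr0. Qed.

Lemma ind4 (P : 'I_(2 + 2) -> Prop) : P e0 -> P e1 -> P t0 -> P t1 -> forall k, P k.
Proof.
move=> P0 P1 P2 P3 k; case: (split_ordP k) => -[[|[|//]] i] ->.
- by rewrite (_ : Ordinal i = i0)//; apply/val_inj.
- by rewrite (_ : Ordinal i = i1)//; apply/val_inj.
- by rewrite (_ : Ordinal i = i0)//; apply/val_inj.
- by rewrite (_ : Ordinal i = i1)//; apply/val_inj.
Qed.

Definition row4 (x y z w : C) : 'rV[C]_(2 + 2) :=
  \row_k (if k == e0 then x else if k == e1 then y else if k == t0 then z else w).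

Lemma row4E x y z w : (row4 x y z w 0 e0 = x) * (row4 x y z w 0 e1 = y) *
  (row4 x y z w 0 t0 = z) * (row4 x y z w 0 t1 = w).
Proof. by rewrite !mxE. Qed.

Lemma cliff_spin2 v a b c d : cliff v (spin2 a b c d) =
  spin2 (v 0 e0 * b + v 0 e1 * c) (v 0 t0 * a - v 0 e1 * d)
        (v 0 t1 * a + v 0 e0 * d) (v 0 t0 * c - v 0 t1 * b).
Proof.
rewrite /cliff sum4 !gamma2 !spin2Z !spin2D.
by congr spin2; rewrite ?mulr0 ?mulrN ?addr0 ?add0r //; rewrite addrC.
Qed.

Lemma pairing4 (u v : 'rV[C]_(2 + 2)) : pairing u v =
  u 0 e0 * v 0 t0 + u 0 e1 * v 0 t1 + (u 0 t0 * v 0 e0 + u 0 t1 * v 0 e1).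
Proof. by rewrite /pairing sum4 !dual2. Qed.

(** The four component equations of z.s = 0 say that z is orthogonal to these four rows, so the rows
    lie in the orthogonal of N, which is N. Their entries are, up to sign, coefficients of s, so
    they will provide smooth null fields. *)
Lemma null_spin2 B a b c d : spin2 a b c d != 0 -> row_null_space B (spin2 a b c d) ->
  [/\ cliff (row4 0 a d 0) (spin2 a b c d) = 0,
      cliff (row4 a 0 0 (- d)) (spin2 a b c d) = 0,
      cliff (row4 c (- b) 0 0) (spin2 a b c d) = 0 &
      cliff (row4 0 0 b c) (spin2 a b c d) = 0].
Proof.
move=> s0 nB.
have cN (z : 'rV[C]_(2 + 2)) : cliff z (spin2 a b c d) = 0 ->
    [/\ z 0 e0 * b + z 0 e1 * c = 0, z 0 t0 * a - z 0 e1 * d = 0,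
     z 0 t1 * a + z 0 e0 * d = 0 & z 0 t0 * c - z 0 t1 * b = 0].
  by rewrite cliff_spin2 -spin2_0 => /spin2_inj.
split; apply: (null_perp s0 nB) => z /cN [h1 h2 h3 h4]; rewrite pairing4 !row4E.
- by rewrite -[RHS]h3; ring.
- by rewrite -[RHS]h2; ring.
- by rewrite -[RHS]h4; ring.
- by rewrite -[RHS]h1; ring.
Qed.

(** Isotropy of N applied to the four vectors of [null_spin2] says that every product of an even and
    an odd coefficient vanishes. *)
Lemma chiral_spin2 B a b c d : spin2 a b c d != 0 -> row_null_space B (spin2 a b c d) ->
  (a = 0 /\ d = 0) \/ (b = 0 /\ c = 0).
Proof.
move=> s0 nB; have [h1 h2 h3 h4] := null_spin2 s0 nB.
have iso := null_isotropic s0.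
have := iso _ _ h1 h4; have := iso _ _ h2 h4; have := iso _ _ h1 h3; have := iso _ _ h2 h3.
rewrite !pairing4 !row4E => k1 k2 k3 k4.
have /eqP : a * b = 0 by rewrite -[RHS]k3; ring.
have /eqP : a * c = 0 by rewrite -[RHS]k4; ring.
have /eqP : d * b = 0 by rewrite -[RHS]k1; ring.
have /eqP : d * c = 0 by rewrite -[RHS]k2; ring.
rewrite !mulf_eq0.
have [-> | _ /= _ _ /eqP -> /eqP ->] := eqVneq a 0; last by right.
have [-> | _ /= /eqP -> /eqP ->] := eqVneq d 0; first by left.
by right.
Qed.

(* B l stands for nabla_{e_l} phi, D for the Dirac operator applied to phi in the
   gauge where lam (nabla_X phi) = 0; in the twistor gauge it becomes 2 D. *)
Lemma gauge_twistor (K : numFieldType) (V : lmodType K) (phi : V) (lam : V -> K) (g : 'I_(2 + 2) -> V -> V)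
    (B : 'I_(2 + 2) -> V) (D := \sum_l 2%:R *: g (dual l) (B l - lam (B l) *: phi))
    (A := fun k => - lam (B k) + 2%:R^-1 * lam (g k D)) :
  (forall k, linear (g k)) ->
  \sum_l lam (g l D) *: g (dual l) phi = D ->
  (forall k, 2%:R *: (B k - lam (B k) *: phi) = g k D - lam (g k D) *: phi) ->
  forall k, B k + A k *: phi =
    4%:R^-1 *: g k (\sum_l 2%:R *: g (dual l) (B l + A l *: phi)).
Proof.
move=> lin h1 h2 k; have n2 : 2%:R != 0 :> K by rewrite pnatr_eq0.
have gZ l (c : K) v : g l (c *: v) = c *: g l v.
  have g0 : g l 0 = 0.
    by apply: (addrI (g l 0)); rewrite addr0 -[X in X + _]scale1r -lin scale1r addr0.
  by rewrite -[c *: v]addr0 lin g0 addr0.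
have BA l : B l + A l *: phi = B l - lam (B l) *: phi + (2%:R^-1 * lam (g l D)) *: phi.
  by rewrite /A scalerDl scaleNr addrA.
have -> : \sum_l 2%:R *: g (dual l) (B l + A l *: phi) = 2%:R *: D.
  under eq_bigr => l _ do
    rewrite BA addrC lin scalerDr scalerA mulrA mulfV// mul1r.
  by rewrite big_split /= -/D h1 scaler_nat mulr2n.
rewrite gZ scalerA BA; apply: (scalerI n2); rewrite scalerDr h2 !scalerA mulrA mulfV// mul1r.
by rewrite subrK (_ : 2%:R * (4%:R^-1 * 2%:R) = 1) ?scale1r//; field.
Qed.

(** The functional lam, with conjugate coefficients and 1/|phi|^2 kept as free variables: the
    algebra below uses only the normalisation lam(phi) = 1, so conjugation never enters a [ring]
    goal. *)
Definition dot4 a' b' c' d' N (s : spinor R 2) : C :=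
  N * (a' * s finset.set0 + b' * s [set i0]%SET + c' * s [set i1]%SET + d' * s [set: 'I_2]%SET).

Lemma dot4E a' b' c' d' N a b c d : dot4 a' b' c' d' N (spin2 a b c d) =
  N * (a' * a + b' * b + c' * c + d' * d).
Proof. by rewrite /dot4 !ffunE !inE. Qed.

Variables a' b' c' d' N : C.
Notation lam := (dot4 a' b' c' d' N).

(** Read from right to left it inserts the normalisation as a factor 1, turning the goal into a
    polynomial identity. *)
Lemma mul_unit x y : x = 1 -> y * x = y :> C.
Proof. by move=> ->; rewrite mulr1. Qed.

(** Modulo phi the twistor equation asks that D = (r, s) satisfy one linear equation in each of the
    four frame directions. The equality of Clifford products in the hypothesis, which is
    integrability, makes this overdetermined system consistent. *)
Lemma gauge_twistor_even a d (B : 'I_(2 + 2) -> spinor R 2) (phi := spin2 a 0 0 d)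
    (D := \sum_l 2%:R *: gamma (dual l) (B l - lam (B l) *: phi))
    (A := fun k => - lam (B k) + 2%:R^-1 * lam (gamma k D)) :
  N * (a * a' + d * d') = 1 -> (forall k, exists p q, B k = spin2 p 0 0 q) ->
  cliff (row4 0 a d 0) (\sum_k row4 a 0 0 (- d) 0 k *: B k) =
  cliff (row4 a 0 0 (- d)) (\sum_k row4 0 a d 0 0 k *: B k) ->
  forall k, B k + A k *: phi =
    4%:R^-1 *: gamma k (\sum_l 2%:R *: gamma (dual l) (B l + A l *: phi)).
Proof.
move=> N1 hB H.
have [p0 [q0 B0]] := hB e0; have [p1 [q1 B1]] := hB e1.
have [p2 [q2 B2]] := hB t0; have [p3 [q3 B3]] := hB t1.
(* The determinant against (a, d): the class of (p, q) modulo phi. *)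
pose dl p q := d * p - a * q.
have [H1 H2] : a * dl p0 q0 = d * dl p3 q3 /\ a * dl p1 q1 = - (d * dl p2 q2).
  move: H; rewrite !sum4 !row4E B0 B1 B2 B3 !spin2Z !spin2D !cliff_spin2 !row4E.
  move=> /spin2_inj[_ /eqP + /eqP + _]; rewrite -2![_ == _ + _]subr_eq0 => /eqP h1 /eqP h2.
  by split; apply/subr0_eq; [rewrite -[RHS]h1|rewrite -[RHS]h2]; rewrite /dl; ring.
(* Subtracting lam times phi projects onto the kernel of lam, which within the chirality plane is
   spanned by (d', - a'). *)
have Bp p q : spin2 p 0 0 q - lam (spin2 p 0 0 q) *: phi =
    spin2 (N * dl p q * d') 0 0 (- (N * dl p q * a')).
  rewrite dot4E spin2BZ /dl; apply: spin2_eq; try ring.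
    by rewrite -[X in X - _](mul_unit _ N1); ring.
  by rewrite -[X in X - _](mul_unit _ N1); ring.
set r := 2%:R * N * (d' * dl p0 q0 + a' * dl p3 q3).
set s := 2%:R * N * (d' * dl p1 q1 - a' * dl p2 q2).
have DE : D = spin2 0 r s 0.
  rewrite /D sum4 !dual2 B0 B1 B2 B3 !Bp !gamma2 !spin2Z !spin2D /r /s.
  by apply: spin2_eq; ring.
(* The first goal says that the one-form X -> lam(X.D), contracted into phi, gives back D; it is
   another form of the normalisation. *)
apply: (gauge_twistor (gamma_is_linear)); rewrite -/D.
  rewrite DE sum4 !dual2 !gamma2 !dot4E !spin2Z !spin2D; apply: spin2_eq; try ring.
    by rewrite -[RHS](mul_unit _ N1); ring.
  by rewrite -[RHS](mul_unit _ N1); ring.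
(* The four equations for r and s. [F0] and [F3] are compatible by [H1], [F1] and [F2] by [H2]; r
   and s are the combinations of them weighted by the conjugate coefficients. *)
have F0 : d * r = 2%:R * dl p0 q0.
  rewrite -[RHS](mul_unit _ N1) /r; transitivity (2%:R * N * (d * d' * dl p0 q0 + a' * (d * dl p3 q3))).
    by ring.
  by rewrite -H1; ring.
have F3 : a * r = 2%:R * dl p3 q3.
  rewrite -[RHS](mul_unit _ N1) /r; transitivity (2%:R * N * (d' * (a * dl p0 q0) + a * a' * dl p3 q3)).
    by ring.
  by rewrite H1; ring.
have F1 : d * s = 2%:R * dl p1 q1.
  rewrite -[RHS](mul_unit _ N1) /s; transitivity (2%:R * N * (d * d' * dl p1 q1 - a' * (d * dl p2 q2))).
    by ring.
  by rewrite -[d * dl p2 q2]opprK -H2; ring.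
have F2 : - (a * s) = 2%:R * dl p2 q2.
  rewrite -[RHS](mul_unit _ N1) /s; transitivity (- (2%:R * N * (d' * (a * dl p1 q1) - a * a' * dl p2 q2))).
    by ring.
  by rewrite H2; ring.
(* Two spinors of this chirality have the same projection to the kernel of lam once their
   determinants against phi agree. *)
have key t p q x y : d * x - a * y = 2%:R * dl p q -> t = N * (a' * x + d' * y) ->
    2%:R *: (spin2 p 0 0 q - lam (spin2 p 0 0 q) *: phi) = spin2 x 0 0 y - t *: phi.
  move=> e ->; rewrite Bp spin2BZ spin2Z; apply: spin2_eq; try ring.
    rewrite -[X in _ = X - _](mul_unit _ N1).
    by transitivity (N * d' * (2%:R * dl p q)); [|rewrite -e]; ring.
  rewrite -[X in _ = X - _](mul_unit _ N1).
  by transitivity (- (N * a' * (2%:R * dl p q))); [|rewrite -e]; ring.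
apply: ind4; rewrite DE !gamma2 ?oppr0 ?B0 ?B1 ?B2 ?B3; apply: key; rewrite ?dot4E; try ring.
- by rewrite -F0; ring.
- by rewrite -F1; ring.
- by rewrite -F2; ring.
- by rewrite -F3; ring.
Qed.

(** The same mechanism in the odd plane, with determinant c p - b q and the kernel of lam spanned by
    (c', - b'). *)
Lemma gauge_twistor_odd b c (B : 'I_(2 + 2) -> spinor R 2) (phi := spin2 0 b c 0)
    (D := \sum_l 2%:R *: gamma (dual l) (B l - lam (B l) *: phi))
    (A := fun k => - lam (B k) + 2%:R^-1 * lam (gamma k D)) :
  N * (b * b' + c * c') = 1 -> (forall k, exists p q, B k = spin2 0 p q 0) ->
  cliff (row4 c (- b) 0 0) (\sum_k row4 0 0 b c 0 k *: B k) =
  cliff (row4 0 0 b c) (\sum_k row4 c (- b) 0 0 0 k *: B k) ->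
  forall k, B k + A k *: phi =
    4%:R^-1 *: gamma k (\sum_l 2%:R *: gamma (dual l) (B l + A l *: phi)).
Proof.
move=> N1 hB H.
have [p0 [q0 B0]] := hB e0; have [p1 [q1 B1]] := hB e1.
have [p2 [q2 B2]] := hB t0; have [p3 [q3 B3]] := hB t1.
pose dl p q := c * p - b * q.
have [H1 H2] : c * dl p0 q0 = b * dl p1 q1 /\ b * dl p2 q2 = - (c * dl p3 q3).
  move: H; rewrite !sum4 !row4E B0 B1 B2 B3 !spin2Z !spin2D !cliff_spin2 !row4E.
  move=> /spin2_inj[/eqP + _ _ /eqP]; rewrite -2![_ == _ + _]subr_eq0 => /eqP h1 /eqP h2.
  by split; apply/subr0_eq; [rewrite -[RHS]h2|rewrite -[RHS]h1]; rewrite /dl; ring.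
have Bp p q : spin2 0 p q 0 - lam (spin2 0 p q 0) *: phi =
    spin2 0 (N * dl p q * c') (- (N * dl p q * b')) 0.
  rewrite dot4E spin2BZ /dl; apply: spin2_eq; try ring.
    by rewrite -[X in X - _](mul_unit _ N1); ring.
  by rewrite -[X in X - _](mul_unit _ N1); ring.
set r := 2%:R * N * (c' * dl p2 q2 - b' * dl p3 q3).
set s := - (2%:R * N * (b' * dl p0 q0 + c' * dl p1 q1)).
have DE : D = spin2 r 0 0 s.
  rewrite /D sum4 !dual2 B0 B1 B2 B3 !Bp !gamma2 !spin2Z !spin2D /r /s.
  by apply: spin2_eq; ring.
apply: (gauge_twistor gamma_is_linear); rewrite -/D.
  rewrite DE sum4 !dual2 !gamma2 !dot4E !spin2Z !spin2D; apply: spin2_eq; try ring.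
    by rewrite -[RHS](mul_unit _ N1); ring.
  by rewrite -[RHS](mul_unit _ N1); ring.
have F0 : - (b * s) = 2%:R * dl p0 q0.
  rewrite -[RHS](mul_unit _ N1) /s; transitivity (2%:R * N * (b * b' * dl p0 q0 + c' * (b * dl p1 q1))).
    by ring.
  by rewrite -H1; ring.
have F1 : - (c * s) = 2%:R * dl p1 q1.
  rewrite -[RHS](mul_unit _ N1) /s; transitivity (2%:R * N * (b' * (c * dl p0 q0) + c * c' * dl p1 q1)).
    by ring.
  by rewrite H1; ring.
have F2 : c * r = 2%:R * dl p2 q2.
  rewrite -[RHS](mul_unit _ N1) /r; transitivity (2%:R * N * (c * c' * dl p2 q2 - b' * (c * dl p3 q3))).
    by ring.
  by rewrite -[c * dl p3 q3]opprK -H2; ring.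
have F3 : - (b * r) = 2%:R * dl p3 q3.
  rewrite -[RHS](mul_unit _ N1) /r; transitivity (- (2%:R * N * (c' * (b * dl p2 q2) - b * b' * dl p3 q3))).
    by ring.
  by rewrite H2; ring.
have key t p q x y : c * x - b * y = 2%:R * dl p q -> t = N * (b' * x + c' * y) ->
    2%:R *: (spin2 0 p q 0 - lam (spin2 0 p q 0) *: phi) = spin2 0 x y 0 - t *: phi.
  move=> e ->; rewrite Bp spin2BZ spin2Z; apply: spin2_eq; try ring.
    rewrite -[X in _ = X - _](mul_unit _ N1).
    by transitivity (N * c' * (2%:R * dl p q)); [|rewrite -e]; ring.
  rewrite -[X in _ = X - _](mul_unit _ N1).
  by transitivity (- (N * b' * (2%:R * dl p q))); [|rewrite -e]; ring.
apply: ind4; rewrite DE !gamma2 ?oppr0 ?B0 ?B1 ?B2 ?B3; apply: key; rewrite ?dot4E; try ring.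
- by rewrite -F0; ring.
- by rewrite -F1; ring.
- by rewrite -F2; ring.
- by rewrite -F3; ring.
Qed.

End FourDimensionalSpinors.

(** * The Dirac operator in a null frame *)

Section DiracOperator.
Local Open Scope ring_scope.
Context {R : realType} {n : nat}.
Variable M : framed_domain R n.

Lemma diracE nabla phi x : domain M x ->
  dirac M nabla phi x = \sum_b 2%:R *: gamma (dual b) (nabla (frame M b) phi x).
Proof.
move=> Ux; rewrite /dirac exchange_big; apply: eq_bigr => b _ /=.
rewrite (bigD1 (dual b))//= big1 => [|a ab].
  by rewrite addr0 frame_metric_invE// dualK eqxx mulr1 cliffordE frame_coord_frame// cliff_delta.
rewrite frame_metric_invE// (_ : (b == dual a) = false) ?mulr0 ?scale0r//.
by apply/negbTE; apply: contra ab => /eqP ->; rewrite dualK.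
Qed.

(** The contraction of the generators with the inverse metric: doubling the sum pairs each b with
    its dual, and each anticommutator of dual generators is 1. *)
Lemma sum_dual_gamma (s : spinor R n) :
  \sum_b 2%:R *: gamma (dual b) (gamma b s) = (2 * n)%:R *: s.
Proof.
rewrite -scaler_sumr scaler_nat mulr2n.
rewrite [X in X + _](reindex_inj (inv_inj dualK)) -big_split /=.
under eq_bigr => b _ do rewrite dualK gamma_anticomm eqxx scale1r.
by rewrite sumr_const card_ord addnn -mul2n scaler_nat.
Qed.

Lemma row0E m (k : 'I_m) : (0 : 'rV[R[i]]_m) 0 k = 0.
Proof. exact: mxE. Qed.

Lemma sum_delta (V : lmodType R[i]) m (k : 'I_m) (F : 'I_m -> V) :
  \sum_a (delta_mx 0 k : 'rV[R[i]]_m) 0 a *: F a = F k.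
Proof.
rewrite (bigD1 k)//= big1 => [|j /negPf jk]; first by rewrite mxE !eqxx scale1r addr0.
by rewrite mxE jk andbF scale0r.
Qed.

Lemma spin_conn_frame A k phi x : domain M x -> spin_conn M A (frame M k) phi x =
  spin_conn M (fun=> 0) (frame M k) phi x + A x 0 k *: phi x.
Proof.
move=> Ux; rewrite !spin_connE// frame_coord_frame//.
by rewrite [LHS]sum_delta [X in _ = X + _]sum_delta row0E scale0r addr0.
Qed.

Lemma spin_conn_sum A X phi x : domain M x -> spin_conn M A X phi x =
  \sum_k frame_coord M x (X x) 0 k *: spin_conn M A (frame M k) phi x.
Proof.
move=> Ux; rewrite [LHS]spin_connE//; apply: eq_bigr => k _; congr (_ *: _).
by rewrite spin_connE// frame_coord_frame// sum_delta.
Qed.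

End DiracOperator.

(** * Choosing the one-form A in dimension four *)

Section FourDimensionalTwistors.
Local Open Scope classical_set_scope.
Local Open Scope ring_scope.
Context {R : realType}.
Notation C := R[i].
Implicit Types s : spinor R 2.

Definition even2 s := exists p q, s = spin2 p 0 0 q.
Definition odd2 s := exists p q, s = spin2 0 p q 0.

Lemma even2_lin (k : C) s t : even2 s -> even2 t -> even2 (k *: s + t).
Proof.
by move=> [p [q ->]] [p' [q' ->]]; exists (k * p + p'), (k * q + q');
  rewrite spin2Z spin2D !mulr0 !addr0.
Qed.

Lemma odd2_lin (k : C) s t : odd2 s -> odd2 t -> odd2 (k *: s + t).
Proof.
by move=> [p [q ->]] [p' [q' ->]]; exists (k * p + p'), (k * q + q');
  rewrite spin2Z spin2D !mulr0 !addr0.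
Qed.

Lemma even2_0 : even2 (0 : spinor R 2).
Proof. by exists 0, 0; rewrite spin2_0. Qed.

Lemma odd2_0 : odd2 (0 : spinor R 2).
Proof. by exists 0, 0; rewrite spin2_0. Qed.

Lemma even2_gamma k s : even2 s -> odd2 (gamma k s).
Proof.
move=> [p [q ->]]; move: k; apply: ind4; rewrite gamma2.
- by exists 0, q.
- by exists (- q), 0.
- by exists p, 0.
- by exists 0, p; rewrite oppr0.
Qed.

Lemma odd2_gamma k s : odd2 s -> even2 (gamma k s).
Proof.
move=> [p [q ->]]; move: k; apply: ind4; rewrite gamma2.
- by exists p, 0.
- by exists q, 0; rewrite oppr0.
- by exists 0, q.
- by exists 0, (- p).
Qed.

Lemma lin_sum (V : lmodType C) (P : V -> Prop) m (k : 'I_m -> C) (F : 'I_m -> V) :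
  P 0 -> (forall a u v, P u -> P v -> P (a *: u + v)) -> (forall i, P (F i)) ->
  P (\sum_i k i *: F i).
Proof.
move=> P0 PD PF; elim: (index_enum _) => [|i r IH]; first by rewrite big_nil.
by rewrite big_cons; apply: PD.
Qed.

Variable M : framed_domain R 2.
Notation U := (domain M).
Notation oU := (@domain_open R 2 M).

(** The spin form is a linear combination of products of two generators, so it preserves
    chirality. *)
Lemma spin_form_parity (P : spinor R 2 -> Prop) x a s :
  P 0 -> (forall (k : C) u v, P u -> P v -> P (k *: u + v)) ->
  (forall b c, P (gamma b (gamma c s))) -> P (spin_form M x a s).
Proof.
move=> P0 PD H; rewrite /spin_form -[_ *: _]addr0; apply: (PD) => //.
under eq_bigr => b _ do rewrite -[\sum_c _]scale1r.
by apply: lin_sum => // b; apply: lin_sum.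
Qed.

Variable phi : 'rV[R]_(2 + 2) -> spinor R 2.
Hypotheses (pphi : pure_spinor_field M phi) (iphi : generates_integrable M phi).

Let sphi : smooth_spinor_field M phi := pphi.1.
Let a x := phi x finset.set0.
Let b x := phi x [set ord0]%SET.
Let c x := phi x [set lift ord0 ord0]%SET.
Let d x := phi x [set: 'I_2]%SET.

Let phiE x : phi x = spin2 (a x) (b x) (c x) (d x).
Proof. exact: spin2E. Qed.

Let sqnorm x := a x * conjc (a x) + b x * conjc (b x) + c x * conjc (c x) + d x * conjc (d x).
(** The coefficient of the Hermitian projection onto the line of [phi x]. All four coefficients
    enter, so the formula is smooth on the whole domain whatever the chirality is. *)
Let lam x := dot4 (conjc (a x)) (conjc (b x)) (conjc (c x)) (conjc (d x)) (sqnorm x)^-1.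
Let B k x := spin_conn M (fun=> 0) (frame M k) phi x.
Let D x := \sum_l 2%:R *: gamma (dual l) (B l x - lam x (B l x) *: phi x).
Let A x : 'rV[C]_(2 + 2) :=
  \row_k (- lam x (B k x) + 2%:R^-1 * lam x (gamma k (D x))).

Let null x : U x -> exists N, row_null_space N (spin2 (a x) (b x) (c x) (d x)).
Proof. by move=> Ux; rewrite -phiE; apply: (pure_row_null_space Ux); have [] := pphi.2 x Ux. Qed.

Let phi0 x : U x -> spin2 (a x) (b x) (c x) (d x) != 0.
Proof. by move=> Ux; rewrite -phiE; have [] := pphi.2 x Ux. Qed.

Let chiral x : U x -> (a x = 0 /\ d x = 0) \/ (b x = 0 /\ c x = 0).
Proof. by move=> Ux; have [N nN] := null Ux; exact: chiral_spin2 (phi0 Ux) nN. Qed.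

Lemma conj_mul_ge0 (z : C) : 0 <= z * conjc z.
Proof. by rewrite -sqr_normc exprn_ge0. Qed.

Let sqnorm_neq0 x : U x -> sqnorm x != 0.
Proof.
move=> Ux; apply: contra (phi0 Ux).
rewrite /sqnorm !paddr_eq0 ?addr_ge0 ?conj_mul_ge0// !mulf_eq0 !conjc_eq0 !orbb.
by move=> /andP[/andP[/andP[/eqP -> /eqP ->] /eqP ->] /eqP ->]; rewrite spin2_0.
Qed.

Let smooth0 : smooth_one_form M (fun=> 0).
Proof. by move=> k; exact: csmooth_cst. Qed.

Let smooth_lam (s : 'rV[R]_(2 + 2) -> spinor R 2) : smooth_spinor_field M s ->
  csmooth U (fun x => lam x (s x)).
Proof.
move=> ss; have cj I := csmooth_conj oU (sphi I).
apply: (csmoothM oU).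
  apply: (csmoothV oU); last exact: sqnorm_neq0.
  by do 3?apply: (csmoothD oU); apply: (csmoothM oU); (exact: sphi || exact: cj).
by do 3?apply: (csmoothD oU); apply: (csmoothM oU); (exact: ss || exact: cj).
Qed.

Let smoothB k : smooth_spinor_field M (B k).
Proof. by apply: smooth_spin_conn => //; exact: frame_smooth. Qed.

Let smooth_defect : smooth_spinor_field M D.
Proof.
apply: smooth_spinor_sum => l; apply: smooth_spinorZ; first exact: csmooth_cst.
apply: smooth_gamma; apply: smooth_spinorD; first exact: smoothB.
apply: (smooth_spinor_ext (phi := fun x => (-1 * lam x (B l x)) *: phi x)).
  by move=> x _; rewrite mulN1r scaleNr.
apply: smooth_spinorZ => //; apply: (csmoothM oU); first exact: csmooth_cst.
exact: smooth_lam.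
Qed.

Let smoothA : smooth_one_form M A.
Proof.
move=> k; apply: (csmooth_ext oU
  (f := fun x => - lam x (B k x) + 2%:R^-1 * lam x (gamma k (D x)))) => [x _|].
  by rewrite mxE.
apply: (csmoothD oU); first by apply: (csmoothN oU); exact: smooth_lam.
apply: (csmoothM oU); first exact: csmooth_cst.
by apply: smooth_lam; exact: smooth_gamma.
Qed.

Let BE k x : U x -> B k x = spinor_vderiv (frame M k x) phi x - spin_form M x k (phi x).
Proof.
move=> Ux; by rewrite /B spin_connE// frame_coord_frame// sum_delta row0E scale0r addr0.
Qed.

(* Applied to the products of an even and an odd coefficient of a pure spinor,
   which vanish identically: the derivative of phi has the chirality of phi. *)
Lemma vderiv_factor v (f g : 'rV[R]_(2 + 2) -> C) x : csmooth U f -> csmooth U g ->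
  (forall y, U y -> f y * g y = 0) -> U x -> f x != 0 -> vderiv v g x = 0.
Proof.
move=> sf sg fg Ux fx; have gx : g x = 0.
  by have /eqP := fg x Ux; rewrite mulf_eq0 (negPf fx) => /eqP.
have := vderivM oU v sf sg Ux; rewrite (vderiv_ext oU _ fg)// vderiv_cst gx mulr0 add0r.
by move=> /esym/eqP; rewrite mulf_eq0 (negPf fx) => /eqP.
Qed.

Let prod0 x (f g : C) : U x -> (f = a x \/ f = d x) -> (g = b x \/ g = c x) -> f * g = 0.
Proof.
by move=> /chiral[] [e1 e2] [] -> [] ->; rewrite ?e1 ?e2 ?mulr0 ?mul0r.
Qed.

Let evenB k x : U x -> b x = 0 -> c x = 0 -> even2 (B k x).
Proof.
move=> Ux b0 c0; have ad : a x != 0 \/ d x != 0.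
  have := phi0 Ux; rewrite b0 c0; have [->|] := eqVneq (a x) 0; last by left.
  by have [->|] := eqVneq (d x) 0; [rewrite spin2_0 eqxx|right].
have e : even2 (phi x) by rewrite phiE b0 c0; exists (a x), (d x).
rewrite BE// addrC -scaleN1r; apply: even2_lin.
  apply: spin_form_parity; [exact: even2_0|exact: even2_lin|].
  by move=> k1 k2; apply: odd2_gamma; exact: even2_gamma.
rewrite [spinor_vderiv _ _ _]spin2E !ffunE.
suff [-> ->] : vderiv (frame M k x) b x = 0 /\ vderiv (frame M k x) c x = 0.
  by eexists; eexists.
by case: ad => n0; split; apply: (vderiv_factor _ (sphi _) (sphi _) _ Ux n0) => y Uy;
  apply: (prod0 Uy); auto.
Qed.

Let oddB k x : U x -> a x = 0 -> d x = 0 -> odd2 (B k x).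
Proof.
move=> Ux a0 d0; have bc : b x != 0 \/ c x != 0.
  have := phi0 Ux; rewrite a0 d0; have [->|] := eqVneq (b x) 0; last by left.
  by have [->|] := eqVneq (c x) 0; [rewrite spin2_0 eqxx|right].
have e : odd2 (phi x) by rewrite phiE a0 d0; exists (b x), (c x).
rewrite BE// addrC -scaleN1r; apply: odd2_lin.
  apply: spin_form_parity; [exact: odd2_0|exact: odd2_lin|].
  by move=> k1 k2; apply: even2_gamma; exact: odd2_gamma.
rewrite [spinor_vderiv _ _ _]spin2E !ffunE.
suff [-> ->] : vderiv (frame M k x) a x = 0 /\ vderiv (frame M k x) d x = 0.
  by eexists; eexists.
by case: bc => n0; split; apply: (vderiv_factor _ (sphi _) (sphi _) _ Ux n0) => y Uy;
  rewrite mulrC; apply: (prod0 Uy); auto.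
Qed.

(** The bracket of the two null fields annihilates phi, so the two terms of [clifford_lie_bracket]
    agree. Stated in frame components, to be applied to the fields of [null_spin2]. *)
Let integrability (f g : 'rV[R]_(2 + 2) -> 'rV[C]_(2 + 2)) x :
  (forall k, csmooth U (fun y => f y 0 k)) -> (forall k, csmooth U (fun y => g y 0 k)) ->
  (forall y, U y -> cliff (f y) (phi y) = 0) -> (forall y, U y -> cliff (g y) (phi y) = 0) ->
  U x -> cliff (f x) (\sum_k g x 0 k *: B k x) = cliff (g x) (\sum_k f x 0 k *: B k x).
Proof.
move=> sf sg f0 g0 Ux; pose F (h : 'rV[R]_(2 + 2) -> 'rV[C]_(2 + 2)) : vfield R (2 + 2) :=
  fun y => \sum_k h y 0 k *: frame M k y.
have sF (h : 'rV[R]_(2 + 2) -> 'rV[C]_(2 + 2)) : (forall k, csmooth U (fun y => h y 0 k)) -> smooth_vfield U (F h).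
  move=> sh; apply: smooth_vfield_sum => k; apply: smooth_vfieldZ; first exact: sh.
  exact: frame_smooth.
have F0 (h : 'rV[R]_(2 + 2) -> 'rV[C]_(2 + 2)) : (forall y, U y -> cliff (h y) (phi y) = 0) ->
    forall y, U y -> clifford M y (F h y) (phi y) = 0.
  by move=> h0 y Uy; rewrite cliffordE frame_coord_sum// h0.
have := clifford_lie_bracket (spin_conn_spinorial smooth0) (sF f sf) (sF g sg) sphi
  (F0 f f0) (F0 g g0) Ux.
have /eqP -> : clifford M x (lie_bracket (F f) (F g) x) (phi x) == 0.
  rewrite -mem_annihilator; apply: iphi Ux; try exact: sF.
    by move=> y Uy; rewrite mem_annihilator F0.
  by move=> y Uy; rewrite mem_annihilator F0.
rewrite !cliffordE (spin_conn_sum _ (F f))// (spin_conn_sum _ (F g))// !frame_coord_sum//.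
by move=> /esym/subr0_eq.
Qed.

Lemma csmooth_row4 (f g h l : 'rV[R]_(2 + 2) -> C) :
  csmooth U f -> csmooth U g -> csmooth U h -> csmooth U l ->
  forall k, csmooth U (fun y => row4 (f y) (g y) (h y) (l y) 0 k).
Proof.
move=> sf sg sh sl; apply: ind4.
- by apply: (csmooth_ext oU _ sf) => y _; rewrite row4E.
- by apply: (csmooth_ext oU _ sg) => y _; rewrite row4E.
- by apply: (csmooth_ext oU _ sh) => y _; rewrite row4E.
- by apply: (csmooth_ext oU _ sl) => y _; rewrite row4E.
Qed.

Let gauge k x : U x -> B k x + A x 0 k *: phi x =
  4%:R^-1 *: gamma k (\sum_l 2%:R *: gamma (dual l) (B l x + A x 0 l *: phi x)).
Proof.
move=> Ux.
have s0 : csmooth U (fun=> 0 : C) by exact: csmooth_cst.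
have AE l : A x 0 l = - lam x (B l x) + 2%:R^-1 * lam x (gamma l (D x)) by rewrite mxE.
under eq_bigr => l _ do rewrite AE.
rewrite AE; have N0 := mulVf (sqnorm_neq0 Ux).
(* The chirality is known only at x, but a bracket needs fields that are null on the whole domain:
   the four rows are null at every y, whichever the chirality there. *)
have null4 y : U y -> _ := fun Uy => let: ex_intro N nN := null Uy in null_spin2 (phi0 Uy) nN.
case: (chiral Ux) => [[a0 d0]|[b0 c0]].
- have pE : phi x = spin2 0 (b x) (c x) 0 by rewrite phiE a0 d0.
  rewrite /D pE; apply: (@gauge_twistor_odd R (conjc (a x)) (conjc (b x)) (conjc (c x)) (conjc (d x))
    (sqnorm x)^-1 (b x) (c x) (B ^~ x)).
  + by rewrite -[RHS]N0 /sqnorm a0 d0; ring.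
  + by move=> l; exact: oddB.
  + apply: (integrability (f := fun y => row4 (c y) (- b y) 0 0)
      (g := fun y => row4 0 0 (b y) (c y))) => //.
    * by apply: csmooth_row4 => //; [exact: sphi|apply: (csmoothN oU); exact: sphi].
    * by apply: csmooth_row4 => //; exact: sphi.
    * by move=> y Uy; rewrite phiE; have [] := null4 y Uy.
    * by move=> y Uy; rewrite phiE; have [] := null4 y Uy.
- have pE : phi x = spin2 (a x) 0 0 (d x) by rewrite phiE b0 c0.
  rewrite /D pE; apply: (@gauge_twistor_even R (conjc (a x)) (conjc (b x)) (conjc (c x)) (conjc (d x))
    (sqnorm x)^-1 (a x) (d x) (B ^~ x)).
  + by rewrite -[RHS]N0 /sqnorm b0 c0; ring.
  + by move=> l; exact: evenB.
  + apply: (integrability (f := fun y => row4 0 (a y) (d y) 0)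
      (g := fun y => row4 (a y) 0 0 (- d y))) => //.
    * by apply: csmooth_row4 => //; exact: sphi.
    * by apply: csmooth_row4 => //; [exact: sphi|apply: (csmoothN oU); exact: sphi].
    * by move=> y Uy; rewrite phiE; have [] := null4 y Uy.
    * by move=> y Uy; rewrite phiE; have [] := null4 y Uy.
Qed.

Lemma integrable_twistor4 : exists A : 'rV[R]_(2 + 2) -> 'rV[C]_(2 + 2),
  smooth_one_form M A /\ spinorial_connection M (spin_conn M A) /\
  is_twistor M (spin_conn M A) phi.
Proof.
exists A; split; first exact: smoothA.
split; first exact: spin_conn_spinorial.
move=> X x sX Ux; rewrite /twistor_operator diracE// spin_conn_sum//.
under eq_bigr => k _ do rewrite spin_conn_frame// -/(B k x) gauge//.
under [X in _ - _ *: clifford _ _ _ X]eq_bigr => k _ do rewrite spin_conn_frame// -/(B k x).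
rewrite cliffordE /cliff scaler_sumr -sumrB big1// => k _.
by rewrite !scalerA mulrC subrr.
Qed.

End FourDimensionalTwistors.

(** * The sheared metric and its null frame *)

Section DeformedFlatSpace.
Local Open Scope classical_set_scope.
Local Open Scope ring_scope.
Context {R : realType} {n : nat}.
Notation C := R[i].
Variables (eps : R) (p q r : 'I_n).
Hypotheses (qr : q != r).
Implicit Types (x : 'rV[R]_(n + n)) (u v : 'rV[C]_(n + n)) (a b : 'I_(n + n)).

(* In the coordinates x_i = x 0 (lshift n i), y_i = x 0 (rshift n i) the metric is
   sum_i dx_i dy_i + eps x_p dx_q dy_r; eps = 0 gives flat space. *)
Definition shear a b : R :=
  ((a == lshift n q) && (b == rshift n r))%:R + ((a == rshift n r) && (b == lshift n q))%:R.

Definition sheared_metric x : 'M[R]_(n + n) :=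
  \matrix_(a, b) (2%:R^-1 * ((b == dual a)%:R + eps * x 0 (lshift n p) * shear a b)).

(** Only d/dy_r needs correcting: the shear gives it a product with d/dx_q, and subtracting eps x_p
    d/dy_q removes that product. *)
Definition sheared_frame a : vfield R (n + n) := fun x =>
  delta_mx 0 a - ((a == rshift n r)%:R * (eps * x 0 (lshift n p)))%:C%C *: delta_mx 0 (rshift n q).

Lemma sheared_metric_smooth a b : smooth setT (fun x => sheared_metric x a b).
Proof.
have oT : open (setT : set 'rV[R]_(n + n)) := openT.
apply: (smooth_ext oT (f := fun x =>
  2%:R^-1 * ((b == dual a)%:R + eps * x 0 (lshift n p) * shear a b))) => [x _|].
  by rewrite mxE.
apply: (smoothM oT); first exact: smooth_cst.
apply: (smoothD oT); first exact: smooth_cst.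
apply: (smoothM oT); last exact: smooth_cst.
by apply: (smoothM oT); [exact: smooth_cst|exact: smooth_coord].
Qed.

Lemma shearC a b : shear a b = shear b a.
Proof. by rewrite /shear addrC ![(a == _) && _]andbC. Qed.

Lemma sheared_metric_sym x : (sheared_metric x)^T = sheared_metric x.
Proof.
apply/matrixP => a b; rewrite !mxE shearC [a == dual b]eq_sym.
by rewrite (inv_eq dualK).
Qed.

Lemma sum_pick (K : pzSemiRingType) m (j : 'I_m) (F : 'I_m -> K) :
  \sum_i F i * (i == j)%:R = F j.
Proof.
rewrite (bigD1 j)//= eqxx mulr1 big1 ?addr0// => i /negPf ->; exact: mulr0.
Qed.

Lemma sheared_metric_unit x : sheared_metric x \in unitmx.
Proof.
rewrite -row_free_unit; apply/inj_row_free => v v0.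
set w := eps * x 0 (lshift n p).
have E b : v 0 (dual b) + w * (v 0 (lshift n q) * (b == rshift n r)%:R
    + v 0 (rshift n r) * (b == lshift n q)%:R) = 0.
  have := congr1 (fun u : 'rV_(n + n) => 2%:R * u 0 b) v0; rewrite [in RHS]mxE mulr0 => <-.
  rewrite mxE mulr_sumr.
  rewrite (eq_bigr (fun a => v 0 a * (a == dual b)%:R + w * ((v 0 a * (b == rshift n r)%:R)
    * (a == lshift n q)%:R + (v 0 a * (b == lshift n q)%:R) * (a == rshift n r)%:R))).
    by rewrite big_split -mulr_sumr big_split /= !sum_pick.
  move=> a _; rewrite mxE /shear -!mulnb !natrM [b == dual a]eq_sym (inv_eq dualK) -/w.
  by rewrite (mulrCA (v 0 a)) mulVKf ?pnatr_eq0//; ring.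
(* As q <> r, the columns of d/dy_q and d/dx_r are free of the shear term. They give v_q = 0 and v_r
   = 0, after which the shear term drops out of every other column. *)
have vq : v 0 (lshift n q) = 0.
  have := E (rshift n q); rewrite dual_rshift eq_rshift eq_rlshift (negPf qr).
  by rewrite !mulr0 addr0 mulr0 addr0.
have vr : v 0 (rshift n r) = 0.
  have := E (lshift n r); rewrite dual_lshift eq_lshift eq_lrshift eq_sym (negPf qr).
  by rewrite !mulr0 addr0 mulr0 addr0.
apply/rowP => a; have := E (dual a); rewrite dualK vq vr !mul0r addr0 mulr0 addr0 => ->.
by rewrite mxE.
Qed.

Lemma sheared_frame_smooth a : smooth_vfield setT (sheared_frame a).
Proof.
have oT : open (setT : set 'rV[R]_(n + n)) := openT.
move=> k; apply: (csmooth_ext oT (f := fun x => (delta_mx 0 a : 'rV[C]_(n + n)) 0 k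
  - ((a == rshift n r)%:R * (eps * x 0 (lshift n p)))%:C%C
    * (delta_mx 0 (rshift n q) : 'rV[C]_(n + n)) 0 k)) => [x _|].
  by rewrite !mxE.
apply: (csmoothB oT); first exact: csmooth_cst.
apply: (csmoothM oT); last exact: csmooth_cst.
apply: csmooth_real; apply: (smoothM oT); first exact: smooth_cst.
by apply: (smoothM oT); [exact: smooth_cst|exact: smooth_coord].
Qed.

Definition shear_param x : C := (eps * x 0 (lshift n p))%:C%C.

Lemma sheared_form x u v :
  (u *m map_mx (real_complex R) (sheared_metric x) *m v^T) 0 0 =
  2%:R^-1 * (pairing u v + shear_param x *
    (u 0 (lshift n q) * v 0 (rshift n r) + u 0 (rshift n r) * v 0 (lshift n q))).
Proof.
rewrite /shear_param; set w := (eps * _)%:C%C.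
rewrite mxE (eq_bigr (fun b => 2%:R^-1 * (u 0 (dual b) * v 0 b + w *
   ((u 0 (lshift n q) * v 0 b) * (b == rshift n r)%:R
     + (u 0 (rshift n r) * v 0 b) * (b == lshift n q)%:R)))) => [|b _].
  rewrite -mulr_sumr big_split -mulr_sumr big_split /= !sum_pick; congr (_ * (_ + _)).
  rewrite /pairing (reindex_inj (inv_inj dualK)).
  by apply: eq_bigr => b _; rewrite dualK.
rewrite !mxE (eq_bigr (fun a => 2%:R^-1 * (u 0 a * (a == dual b)%:R + w *
   ((u 0 a * (b == rshift n r)%:R) * (a == lshift n q)%:R
     + (u 0 a * (b == lshift n q)%:R) * (a == rshift n r)%:R)))) => [|a _].
  rewrite -mulr_sumr big_split -mulr_sumr big_split /= !sum_pick; ring.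
rewrite !mxE rmorphM fmorphV rmorph_nat rmorphD rmorphM -/w /shear rmorphD !rmorph_nat.
rewrite -!mulnb !natrM [b == dual a]eq_sym (inv_eq dualK); ring.
Qed.

Lemma pairing_delta a b : pairing (delta_mx 0 a) (delta_mx 0 b) = (b == dual a)%:R :> C.
Proof.
rewrite /pairing (bigD1 a)//= !mxE !eqxx mul1r eq_sym big1 ?addr0// => c /negPf ca.
by rewrite mxE ca andbF mul0r.
Qed.

Lemma pairingBZl (k : C) u v w : pairing (u - k *: v) w = pairing u w - k * pairing v w.
Proof.
rewrite /pairing mulr_sumr -sumrB; apply: eq_bigr => c _.
by rewrite !mxE; ring.
Qed.

Lemma sheared_frameE a x k : sheared_frame a x 0 k = (k == a)%:R
  - (a == rshift n r)%:R * shear_param x * (k == rshift n q)%:R.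
Proof. by rewrite !mxE !eqxx /shear_param !rmorphM rmorph_nat. Qed.

Lemma sheared_frame_form x a b :
  (sheared_frame a x *m map_mx (real_complex R) (sheared_metric x) *m (sheared_frame b x)^T) 0 0
    = 2%:R^-1 * (b == dual a)%:R.
Proof.
apply: (etrans (sheared_form _ _ _)).
have fE c : sheared_frame c x = delta_mx 0 c
    - ((c == rshift n r)%:R * shear_param x) *: delta_mx 0 (rshift n q).
  by rewrite /shear_param -(rmorph_nat (real_complex R)) -rmorphM.
move: (sheared_frameE a x) (sheared_frameE b x) (fE a) (fE b).
move: (sheared_frame a x) (sheared_frame b x) => fa fb Ea Eb Da Db.
rewrite !Ea !Eb Da Db.
move: (shear_param x) => w; apply: (congr1 (fun z => 2%:R^-1 * z)).
rewrite pairingBZl (pairingC (delta_mx 0 a)) (pairingC (delta_mx 0 (rshift n q))).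
rewrite !pairingBZl !pairing_delta !dual_rshift.
rewrite eq_rlshift eq_lrshift eq_rshift (eq_sym r q) (negPf qr).
rewrite -[a == dual b](inv_eq dualK) [dual a == b]eq_sym.
rewrite -[rshift n q == dual b](inv_eq dualK) dual_rshift.
rewrite ![lshift n q == _]eq_sym ![rshift n r == _]eq_sym.
have -> : false%:R = 0 :> C by []. ring.
Qed.

Lemma sheared_frame_ee x i j : (sheared_frame (lshift n i) x *m
  map_mx (real_complex R) (sheared_metric x) *m (sheared_frame (lshift n j) x)^T) 0 0 = 0.
Proof. by rewrite sheared_frame_form dual_lshift eq_lrshift mulr0. Qed.

Lemma sheared_frame_tt x i j : (sheared_frame (rshift n i) x *m
  map_mx (real_complex R) (sheared_metric x) *m (sheared_frame (rshift n j) x)^T) 0 0 = 0.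
Proof. by rewrite sheared_frame_form dual_rshift eq_rlshift mulr0. Qed.

Lemma sheared_frame_et x i j : (sheared_frame (lshift n i) x *m
  map_mx (real_complex R) (sheared_metric x) *m (sheared_frame (rshift n j) x)^T) 0 0
  = 2%:R^-1 * (i == j)%:R.
Proof. by rewrite sheared_frame_form dual_lshift eq_rshift eq_sym. Qed.

Definition sheared_domain : framed_domain R n :=
  @FramedDomain R n setT sheared_metric sheared_frame openT
    sheared_metric_smooth (fun x _ => sheared_metric_sym x)
    (fun x _ => sheared_metric_unit x) sheared_frame_smooth
    (fun x i j _ => sheared_frame_ee x i j) (fun x i j _ => sheared_frame_tt x i j)
    (fun x i j _ => sheared_frame_et x i j).

Lemma sheared_metric_cpartial x a b k :
  cpartial k (fun y => (sheared_metric y a b)%:C%C) x =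
  2%:R^-1 * eps%:C%C * (k == lshift n p)%:R * (shear a b)%:C%C :> C.
Proof.
have oT : open (setT : set 'rV[R]_(n + n)) := openT.
rewrite /cpartial partial_cst.
suff -> : partial k (fun y => sheared_metric y a b) x =
    2%:R^-1 * eps * (k == lshift n p)%:R * shear a b.
  by rewrite complexr0 !rmorphM fmorphV !rmorph_nat.
rewrite (partial_ext k oT (g := fun y => 2%:R^-1 * (b == dual a)%:R
  + (2%:R^-1 * eps * shear a b) * y 0 (lshift n p)))// => [|y _]; last first.
  by rewrite mxE; ring.
rewrite partialD ?partialM ?partial_cst ?partial_coord; first by ring.
all: try exact: differentiable_cst; try exact: differentiable_coord.
by apply: differentiableM; [exact: differentiable_cst|exact: differentiable_coord].
Qed.

(** The row space of [1 | W] is the graph of W over V; the null spaces of both example spinors have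
    this form. *)
Lemma sub_row_mx1 (W : 'M[C]_n) (c : 'rV[C]_(n + n)) :
  (c <= row_mx 1%:M W)%MS = (rsubmx c == lsubmx c *m W).
Proof.
apply/submxP/eqP => [[d ->]|e]; first by rewrite mul_mx_row mulmx1 row_mxKl row_mxKr.
by exists (lsubmx c); rewrite mul_mx_row mulmx1 -e hsubmxK.
Qed.

Lemma row_mx1_free (W : 'M[C]_n) : row_free (row_mx 1%:M W).
Proof.
apply/inj_row_free => v; rewrite mul_mx_row mulmx1 => e.
by rewrite -(row_mxKl v (v *m W)) e linear0.
Qed.

End DeformedFlatSpace.

(** * The constant spinor 1: integrable but not a twistor *)

Section PureExamples.
Local Open Scope classical_set_scope.
Local Open Scope ring_scope.
Context {R : realType} {n : nat}.
Notation C := R[i].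

Lemma sum3_delta m (a b c : 'I_m) (F : 'I_m -> 'I_m -> 'I_m -> C) :
  \sum_i \sum_j \sum_l (delta_mx 0 a : 'rV[C]_m) 0 i * (delta_mx 0 b : 'rV[C]_m) 0 j
    * (delta_mx 0 c : 'rV[C]_m) 0 l * F i j l = F a b c.
Proof.
rewrite -[RHS](sum_pick a (fun i => F i b c)); apply: eq_bigr => i _.
rewrite -[F i b c](sum_pick b (fun j => F i j c)) mulr_suml; apply: eq_bigr => j _.
rewrite -[F i j c](sum_pick c (F i j)) !mulr_suml; apply: eq_bigr => l _.
by rewrite !mxE /=; ring.
Qed.

Lemma dim_row_basis (K : fieldType) m k (V : {vspace 'rV[K]_m}) (B : 'M[K]_(k, m)) :
  row_free B -> (forall v, (v \in V) = (v <= B)%MS) -> \dim V = k.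
Proof.
move=> /eqP fB VB; have [B' /eqP fB' VB'] := vspace_row_basis (erefl (\dim V)).
rewrite -fB -fB'; apply/eqP; rewrite eqn_leq; apply/andP; split.
  by apply/mxrankS/row_subP => i; rewrite -VB VB' row_sub.
by apply/mxrankS/row_subP => i; rewrite -VB' VB row_sub.
Qed.

Lemma row_null_space_dim (M : framed_domain R n) phi x B : domain M x ->
  row_null_space B (phi x) -> \dim (annihilator M phi x) = n.
Proof.
move=> Ux [fB nB]; have uF := frame_mx_unit Ux.
have fF : row_free (frame_mx M x) by rewrite row_free_unit.
apply: (dim_row_basis (B := B *m frame_mx M x)) => [|v].
  by rewrite /row_free mxrankMfree.
by rewrite mem_annihilator cliffordE nB -(submxMfree _ _ fF) mulmxKV.
Qed.

(** The spinor 1, killed by all contractions; its null space is V. *)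
Definition vacuum : spinor R n := [ffun I : {set 'I_n} => (I == finset.set0)%:R].

Lemma contract_vacuum i : contract i vacuum = 0.
Proof.
apply/ffunP => I; rewrite !ffunE; case: ifP => // _.
by rewrite (_ : (i |: I)%SET == _ = false) ?mulr0//; apply/negbTE/set0Pn; exists i; rewrite !inE eqxx.
Qed.

Lemma wedge_vacuum i (I : {set 'I_n}) : wedge i vacuum I = (I == [set i]%SET)%:R.
Proof.
rewrite !ffunE; case: (boolP (i \in I)) => iI; last first.
  by case: eqP => // e; rewrite e inE eqxx in iI.
have -> : ((I :\ i)%SET == finset.set0) = (I == [set i]%SET).
  apply/eqP/eqP => [e|->]; last by rewrite finset.setDv.
  by rewrite -(finset.setD1K iI) e finset.setU0.
case: eqP => [->|_]; last by rewrite mulr0.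
by rewrite finset.setDv mulr1 /koszul_sign (_ : [set _ in _ | _]%SET = finset.set0) ?cards0//;
  apply/setP => j; rewrite !inE.
Qed.

Lemma cliff_vacuum (v : 'rV[C]_(n + n)) i : cliff v vacuum [set i]%SET = v 0 (rshift n i).
Proof.
rewrite /cliff big_split_ord /= big1 => [|j _]; last by rewrite gamma_lshift contract_vacuum scaler0.
rewrite add0r sum_ffunE (bigD1 i)//= ffunE gamma_rshift wedge_vacuum eqxx big1 ?addr0.
  by rewrite /GRing.scale/= mulr1.
move=> j ji; rewrite ffunE gamma_rshift wedge_vacuum.
rewrite (_ : ([set i]%SET == [set j]%SET) = false) ?scaler0//.
by apply/negbTE; apply: contra ji => /eqP/set1_inj ->.
Qed.

Lemma cliff_vacuum0 (v : 'rV[C]_(n + n)) :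
  (forall i, v 0 (rshift n i) = 0) -> cliff v vacuum = 0.
Proof.
move=> v0; rewrite /cliff big_split_ord /= !big1 ?addr0// => i _.
  by rewrite v0 scale0r.
by rewrite gamma_lshift contract_vacuum scaler0.
Qed.

Lemma vacuum_neq0 : vacuum != 0.
Proof.
by apply/eqP => /ffunP/(_ finset.set0); rewrite !ffunE eqxx => /eqP; rewrite oner_eq0.
Qed.

Lemma vacuum_null_space : row_null_space (row_mx 1%:M 0) vacuum.
Proof.
split=> [|v]; first exact: row_mx1_free.
rewrite sub_row_mx1 mulmx0; apply/eqP/eqP => [v0|/rowP v0].
  by apply/rowP => i; rewrite !mxE -cliff_vacuum v0 ffunE.
by apply: cliff_vacuum0 => i; have := v0 i; rewrite !mxE.
Qed.

Lemma vacuum_pure (M : framed_domain R n) : pure_spinor_field M (fun=> vacuum).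
Proof.
split; first exact: smooth_spinor_cst.
move=> x Ux; split; first exact: vacuum_neq0.
exact: row_null_space_dim Ux vacuum_null_space.
Qed.

Variables (p q r : 'I_n).
Hypotheses (pq : p != q) (pr : p != r) (qr : q != r).
Let M : framed_domain R n := sheared_domain 1 p qr.

Let frame_coord_y x (v : 'rV[C]_(n + n)) k : v 0 (rshift n k) =
  frame_coord M x v 0 (rshift n k) -
  (k == q)%:R * (shear_param 1 p x * frame_coord M x v 0 (rshift n r)).
Proof.
rewrite {1}(frame_coordK (M := M) v (I : domain M x)) summxE.
rewrite (eq_bigr (fun a => frame_coord M x v 0 a * (a == rshift n k)%:R
  - ((k == q)%:R * (shear_param 1 p x * frame_coord M x v 0 a)) * (a == rshift n r)%:R)).
  by rewrite sumrB !sum_pick.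
move=> a _; rewrite scale_rVE (sheared_frameE 1 p q r a x) [rshift n k == a]eq_sym eq_rshift; ring.
Qed.

(** The frame correction mixes y-components only among themselves, so V is the coordinate span of
    the d/dx_i at every point. *)
Let vacuum_null x (v : 'rV[C]_(n + n)) :
  (clifford M x v vacuum = 0) <-> (forall k, v 0 (rshift n k) = 0).
Proof.
rewrite cliffordE; split=> [e k|v0].
  by rewrite (frame_coord_y x) -!cliff_vacuum e !ffunE mulr0 mulr0 subrr.
have vr : frame_coord M x v 0 (rshift n r) = 0.
  by have := frame_coord_y x v r; rewrite v0 eq_sym (negPf qr) mul0r subr0.
apply: cliff_vacuum0 => k.
by have := frame_coord_y x v k; rewrite v0 vr !mulr0 subr0.
Qed.

(** The y-components of the bracket are derivatives of y-components of the two fields, which vanish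
    identically. *)
Lemma vacuum_integrable : generates_integrable M (fun=> vacuum).
Proof.
move=> X Y _ _ X0 Y0 x Ux; rewrite mem_annihilator; apply/eqP/vacuum_null => k.
have V (Z : vfield R (n + n)) : (forall x, domain M x -> Z x \in annihilator M (fun=> vacuum) x) ->
    forall y, domain M y -> Z y 0 (rshift n k) = 0.
  by move=> Z0 y Uy; have := Z0 y Uy; rewrite mem_annihilator => /eqP/vacuum_null.
have oM := @domain_open R n M.
by rewrite mxE (vderiv_ext oM _ (V Y Y0) Ux) (vderiv_ext oM _ (V X X0) Ux) !vderiv_cst subrr.
Qed.

(* (nabla_{theta^r} e_p) . 1 has a nonzero theta^q-coefficient, whereas
   e_p . theta^r . chi has none, whatever chi is. *)
Lemma vacuum_not_twistor A : smooth_one_form M A -> ~ is_twistor M (spin_conn M A) (fun=> vacuum).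
Proof.
(* At the origin x_p = 0, so the values of the frame are the coordinate vectors there, while the
   derivative of the metric along x_p survives. *)
move=> sA tw; pose x : 'rV[R]_(n + n) := 0; have Ux : domain M x by [].
have sX := frame_smooth M (rshift n r); set X := frame M (rshift n r) in sX *.
pose Y : vfield R (n + n) := fun=> delta_mx 0 (lshift n p).
have sY : smooth_vfield (domain M) Y := smooth_vfield_cst M _.
have Y0 y : domain M y -> clifford M y (Y y) vacuum = 0.
  by move=> _; apply/vacuum_null => k; rewrite mxE eq_rlshift andbF.
have := clifford_levi_civita_null (spin_conn_spinorial sA) sX sY
  (smooth_spinor_cst M vacuum) Y0 Ux.
have := tw X x sX Ux; rewrite /twistor_operator => /subr0_eq ->.
set chi := dirac _ _ _ _; set Z := levi_civita _ _ _ _.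
have FX : frame_coord M x (X x) = delta_mx 0 (rshift n r) by exact: frame_coord_frame.
have YE : Y x = frame M (lshift n p) x.
  by rewrite /= /sheared_frame eq_lrshift mul0r scale0r subr0.
have FY : frame_coord M x (Y x) = delta_mx 0 (lshift n p) by rewrite YE frame_coord_frame.
rewrite !cliffordE FX FY cliffZr !cliff_delta => /ffunP/(_ [set q]%SET).
rewrite cliff_vacuum !ffunE gamma_lshift gamma_rshift !ffunE !inE (negPf pq).
rewrite [r == p]eq_sym (negPf pr) [r == q]eq_sym (negPf qr) /= mulr0 scaler0 oppr0.
(* The theta^q-component of Z is 2 g(Z, e_q), which [levi_civita_lower] computes; the only surviving
   derivative is that of g(d/dy_r, d/dx_q) along x_p, equal to 1/2. *)
rewrite frame_coordE// dual_rshift => /eqP; rewrite mulf_eq0 pnatr_eq0 /= /Z.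
have XE : X x = delta_mx 0 (rshift n r).
  have x0 : x 0 (lshift n p) = 0 by rewrite mxE.
  by rewrite /X /= /sheared_frame x0 !mulr0 rmorph0 scale0r subr0.
have QE : sheared_frame 1 p q r (lshift n q) x = delta_mx 0 (lshift n q).
  by rewrite /sheared_frame eq_lrshift mul0r scale0r subr0.
rewrite levi_civita_lower// XE QE -[metric M]/(sheared_metric 1 p q r).
rewrite -[Y x]/(delta_mx 0 (lshift n p) : 'rV[C]_(n + n)) sum3_delta big1 => [|i _]; last first.
  by rewrite big1// => j _; rewrite vderiv_cst !mul0r.
rewrite add0r !sheared_metric_cpartial /shear.
rewrite !eqxx !(eq_rlshift, eq_lrshift) !eq_lshift (negPf pq) !andbF /=.
rewrite addr0 add0r rmorph0 rmorph1 !mulr1 !mulr0 add0r subr0.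
by rewrite mulf_eq0 invr_eq0 pnatr_eq0.
Qed.

End PureExamples.

(** * A pure twistor on flat six-dimensional space with a non-integrable distribution *)

Section FlatTwistor.
Local Open Scope classical_set_scope.
Local Open Scope ring_scope.
Context {R : realType}.
Notation C := R[i].

Let o0 : 'I_3 := ord0.
Let o1 : 'I_3 := lift ord0 ord0.
Let o2 : 'I_3 := ord_max.

Let o12 : o1 != o2. Proof. by []. Qed.
Let M : framed_domain R 3 := sheared_domain 0 o0 o12.

(** Coefficients as a function of the three membership bits, so that identities reduce to eight
    boolean cases. *)
Definition spin3 (f : bool -> bool -> bool -> C) : spinor R 3 :=
  [ffun I : {set 'I_3} => f (o0 \in I) (o1 \in I) (o2 \in I)].

Definition volume3 : spinor R 3 := spin3 (fun b0 b1 b2 => (b0 && b1 && b2)%:R).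

(* 1 + x _| theta^123, where x is the position vector x^i e_i + y_i theta^i. *)
Definition flat_twistor (x : 'rV[R]_(3 + 3)) : spinor R 3 :=
  spin3 (fun b0 b1 b2 => match b0, b1, b2 with
    | false, false, false => 1
    | false, true, true => (x 0 (lshift 3 o0))%:C%C
    | true, false, true => - (x 0 (lshift 3 o1))%:C%C
    | true, true, false => (x 0 (lshift 3 o2))%:C%C
    | _, _, _ => 0
    end).

Let ord3E (P : 'I_3 -> Prop) : P o0 -> P o1 -> P o2 -> forall i, P i.
Proof.
move=> P0 P1 P2 [[|[|[|//]]] i]; [move: P0|move: P1|move: P2];
  by congr P; apply/val_inj.
Qed.

Let sum6 (V : nmodType) (F : 'I_(3 + 3) -> V) : \sum_a F a =
  F (lshift 3 o0) + F (lshift 3 o1) + F (lshift 3 o2)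
  + (F (rshift 3 o0) + F (rshift 3 o1) + F (rshift 3 o2)).
Proof.
rewrite big_split_ord /= !big_ord_recl !big_ord0 /= !addr0 !addrA.
have -> : lift ord0 (lift ord0 ord0) = o2 by apply/val_inj.
by [].
Qed.

Let koszul3 (I : {set 'I_3}) : (koszul_sign o0 I = 1 :> C) *
  (koszul_sign o1 I = (-1) ^+ (o0 \in I) :> C) *
  (koszul_sign o2 I = (-1) ^+ (o0 \in I) * (-1) ^+ (o1 \in I) :> C).
Proof.
have E i : koszul_sign i I = (-1) ^+ (\sum_j ((j \in I) && (j < i)))%N :> C.
  by rewrite /koszul_sign -sum1dep_card big_mkcond /=; congr (_ ^+ _);
    apply: eq_bigr => j _; case: (_ && _).
rewrite !E !big_ord_recl !big_ord0 /= !andbF !andbT !addn0 expr0.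
by split=> //; rewrite -exprD.
Qed.

Let gamma3 b i f : ladder b i (spin3 f) =
  [ffun I : {set 'I_3} => if (i \in I) == b then koszul_sign i I *
     f ((o0 == i) (+) (o0 \in I)) ((o1 == i) (+) (o1 \in I)) ((o2 == i) (+) (o2 \in I)) else 0].
Proof. by apply/ffunP => I; rewrite !ffunE !in_toggle. Qed.

Let cliff3 (v : 'rV[C]_(3 + 3)) f (I : {set 'I_3}) : cliff v (spin3 f) I =
  v 0 (lshift 3 o0) * ladder false o0 (spin3 f) I
  + v 0 (lshift 3 o1) * ladder false o1 (spin3 f) I
  + v 0 (lshift 3 o2) * ladder false o2 (spin3 f) I
  + (v 0 (rshift 3 o0) * ladder true o0 (spin3 f) I
  + v 0 (rshift 3 o1) * ladder true o1 (spin3 f) I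
  + v 0 (rshift 3 o2) * ladder true o2 (spin3 f) I).
Proof.
have sE (k : C) (s : spinor R 3) : (k *: s) I = k * s I by exact: ffunE.
rewrite /cliff sum_ffunE (eq_bigr _ (fun a _ => sE (v 0 a) (gamma a (spin3 f)))).
by rewrite sum6 !gamma_lshift !gamma_rshift !contractE !wedgeE.
Qed.

(** The theta-part of v is the cross product of its e-part with (x_1, x_2, x_3). These are the
    coefficients of degree one; the one of degree three is then a product of the form (v cross x).x
    and vanishes. *)
Lemma cliff_flat_twistor (v : 'rV[C]_(3 + 3)) x : cliff v (flat_twistor x) = 0 <->
  [/\ v 0 (rshift 3 o0) = v 0 (lshift 3 o1) * (x 0 (lshift 3 o2))%:C%C
         - v 0 (lshift 3 o2) * (x 0 (lshift 3 o1))%:C%C,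
      v 0 (rshift 3 o1) = v 0 (lshift 3 o2) * (x 0 (lshift 3 o0))%:C%C
         - v 0 (lshift 3 o0) * (x 0 (lshift 3 o2))%:C%C &
      v 0 (rshift 3 o2) = v 0 (lshift 3 o0) * (x 0 (lshift 3 o1))%:C%C
         - v 0 (lshift 3 o1) * (x 0 (lshift 3 o0))%:C%C].
Proof.
split=> [/ffunP e|[e0 e1 e2]].
  split.
  - have := e [set o0]%SET; rewrite cliff3 !gamma3 !ffunE !koszul3 !inE /=.
    by rewrite ?(mulr0, mul0r, addr0, add0r, mul1r, expr1, expr0, mulr1) => h; apply/subr0_eq; rewrite -[RHS]h; ring.
  - have := e [set o1]%SET; rewrite cliff3 !gamma3 !ffunE !koszul3 !inE /=.
    by rewrite ?(mulr0, mul0r, addr0, add0r, mul1r, expr1, expr0, mulr1) => h; apply/subr0_eq; rewrite -[RHS]h; ring.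
  - have := e [set o2]%SET; rewrite cliff3 !gamma3 !ffunE !koszul3 !inE /=.
    by rewrite ?(mulr0, mul0r, addr0, add0r, mul1r, expr1, expr0, mulr1) => h; apply/subr0_eq; rewrite -[RHS]h; ring.
apply/ffunP => I; rewrite cliff3 !gamma3 !ffunE !koszul3 e0 e1 e2.
by case: (o0 \in I); case: (o1 \in I); case: (o2 \in I); rewrite /= ?expr1 ?expr0; ring.
Qed.

Lemma smooth_flat_twistor : smooth_spinor_field M flat_twistor.
Proof.
have oM := @domain_open R 3 M.
have sx i : csmooth (domain M) (fun x => (x 0 (lshift 3 i))%:C%C).
  by apply: csmooth_real; exact: smooth_coord.
move=> I; rewrite /flat_twistor.
apply: (csmooth_ext oM (fun x _ => ffunE _ _)).
case: (o0 \in I); case: (o1 \in I); case: (o2 \in I); try exact: csmooth_cst; try exact: sx.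
by apply: (csmoothN oM); exact: sx.
Qed.

Let flat_frame a x : frame M a x = delta_mx 0 a.
Proof. by rewrite /= /sheared_frame mul0r mulr0 rmorph0 scale0r subr0. Qed.

Let flat_coord x v : frame_coord M x v = v.
Proof.
rewrite {2}(frame_coordK (M := M) v (I : domain M x)) [LHS]row_sum_delta.
by apply: eq_bigr => a _; rewrite flat_frame.
Qed.

Let flat_null x : exists B, row_null_space B (flat_twistor x).
Proof.
(* The matrix of the cross product with x, whose graph is the null space. *)
pose W : 'M[C]_3 := \matrix_(i, k)
  ((x 0 (lshift 3 o0))%:C%C * (((i == o2) && (k == o1))%:R - ((i == o1) && (k == o2))%:R)
   + (x 0 (lshift 3 o1))%:C%C * (((i == o0) && (k == o2))%:R - ((i == o2) && (k == o0))%:R)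
   + (x 0 (lshift 3 o2))%:C%C * (((i == o1) && (k == o0))%:R - ((i == o0) && (k == o1))%:R)).
have WE (v : 'rV[C]_(3 + 3)) k : (lsubmx v *m W) 0 k =
    v 0 (lshift 3 o0) * W o0 k + v 0 (lshift 3 o1) * W o1 k + v 0 (lshift 3 o2) * W o2 k.
  rewrite mxE !big_ord_recl big_ord0 !mxE addr0 !addrA.
  by have -> : lift ord0 (lift ord0 ord0) = o2 by apply/val_inj.
exists (row_mx 1%:M W); split=> [|v]; first exact: row_mx1_free.
rewrite sub_row_mx1; apply/eqP/eqP => [/cliff_flat_twistor[e0 e1 e2]|/rowP e].
  apply/rowP; apply: ord3E; rewrite WE [LHS]mxE ?e0 ?e1 ?e2 !mxE /=; ring.
apply/cliff_flat_twistor; split.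
- by have := e o0; rewrite WE [rsubmx _ _ _]mxE !mxE /= => ->; ring.
- by have := e o1; rewrite WE [rsubmx _ _ _]mxE !mxE /= => ->; ring.
- by have := e o2; rewrite WE [rsubmx _ _ _]mxE !mxE /= => ->; ring.
Qed.

Lemma flat_twistor_pure : pure_spinor_field M flat_twistor.
Proof.
split; first exact: smooth_flat_twistor.
move=> x Ux; split; last by have [B nB] := flat_null x; exact: row_null_space_dim Ux nB.
by apply/eqP => /ffunP/(_ finset.set0); rewrite !ffunE !inE => /eqP; rewrite oner_eq0.
Qed.

Let flat_omega x a b c : omega M x a b c = 0.
Proof.
have Ux : domain M x by [].
rewrite /omega frame_coordE// levi_civita_lower// big1 => [|i _].
  rewrite add0r big1 ?mulr0// => i _; rewrite big1// => j _; rewrite big1// => l _.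
  rewrite -[metric M]/(sheared_metric 0 o0 o1 o2) !sheared_metric_cpartial.
  by rewrite rmorph0 mulr0 !mul0r addr0 subrr mulr0 mulr0.
rewrite big1// => j _; have oM := @domain_open R 3 M.
rewrite (vderiv_ext oM _ (g := fun=> (delta_mx 0 b : 'rV[C]_(3 + 3)) 0 i) _ Ux).
  by rewrite vderiv_cst !mul0r.
by move=> y _; rewrite flat_frame.
Qed.

Let flat_spin_conn k phi x :
  spin_conn M (fun=> 0) (frame M k) phi x = spinor_vderiv (delta_mx 0 k) phi x.
Proof.
have Ux : domain M x by [].
rewrite spin_connE// frame_coord_frame// sum_delta row0E scale0r addr0 flat_frame.
rewrite /spin_form big1 ?scaler0 ?subr0// => b _; rewrite big1// => c _.
by rewrite omega_upE// flat_omega mulr0 scale0r.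
Qed.

Let vderiv_delta k (f : 'rV[R]_(3 + 3) -> C) x : vderiv (delta_mx 0 k) f x = cpartial k f x.
Proof.
rewrite /vderiv (bigD1 k)//= mxE !eqxx mul1r big1 ?addr0// => j /negPf jk.
by rewrite mxE jk andbF mul0r.
Qed.

Let cpartial_coord x i j : cpartial i (fun y : 'rV[R]_(3 + 3) => (y 0 j)%:C%C) x = (i == j)%:R :> C.
Proof. by rewrite /cpartial partial_cst partial_coord complexr0 rmorph_nat. Qed.

Let cpartial_coordN x i j : cpartial i (fun y : 'rV[R]_(3 + 3) => - (y 0 j)%:C%C) x = - (i == j)%:R :> C.
Proof.
have sj : csmooth setT (fun y : 'rV[R]_(3 + 3) => (y 0 j)%:C%C).
  by apply: csmooth_real; exact: smooth_coord.
have oT : open (setT : set 'rV[R]_(3 + 3)) := openT.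
transitivity (cpartial i (fun y : 'rV[R]_(3 + 3) => -1 * (y 0 j)%:C%C) x).
  by apply: (cpartial_ext oT) => // y _; rewrite mulN1r.
rewrite (cpartialM oT i (csmooth_cst setT (-1)) sj I) cpartial_cst cpartial_coord; ring.
Qed.

(** The field is affine in x, and its derivative along e_k is e_k contracted into theta^123. The
    y-coordinates do not occur, in agreement with theta^k /\ theta^123 = 0. *)
Let flat_vderiv k x : spinor_vderiv (delta_mx 0 k) flat_twistor x = gamma k volume3.
Proof.
apply/ffunP => I; rewrite ffunE vderiv_delta.
rewrite (_ : (fun y => flat_twistor y I) = (fun y =>
   match o0 \in I, o1 \in I, o2 \in I with
    | false, false, false => 1
    | false, true, true => (y 0 (lshift 3 o0))%:C%C
    | true, false, true => - (y 0 (lshift 3 o1))%:C%C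
    | true, true, false => (y 0 (lshift 3 o2))%:C%C
    | _, _, _ => 0
    end)); last by apply/funext => y; rewrite ffunE.
case: (split_ordP k) => i ->.
  rewrite gamma_lshift contractE gamma3 ffunE; move: i; apply: ord3E; rewrite koszul3 /=;
  case: (o0 \in I); case: (o1 \in I); case: (o2 \in I);
  by rewrite /= ?cpartial_cst ?cpartial_coord ?cpartial_coordN ?eq_lshift ?expr1 ?expr0 /= ?mulr0 ?mulr1 ?mulN1r
    ?oppr0 ?opprK.
rewrite gamma_rshift wedgeE gamma3 ffunE; move: i; apply: ord3E; rewrite koszul3 /=;
case: (o0 \in I); case: (o1 \in I); case: (o2 \in I);
by rewrite /= ?cpartial_cst ?cpartial_coord ?cpartial_coordN ?eq_rlshift ?expr1 ?expr0 /= ?mulr0 ?oppr0.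
Qed.

Lemma flat_twistor_is_twistor : is_twistor M (spin_conn M (fun=> 0)) flat_twistor.
Proof.
move=> X x sX Ux; rewrite /twistor_operator diracE// spin_conn_sum//.
under eq_bigr => k _ do rewrite flat_spin_conn flat_vderiv.
under [X in _ - _ *: clifford _ _ _ X]eq_bigr => k _ do rewrite flat_spin_conn flat_vderiv.
by rewrite sum_dual_gamma cliffordE cliffZr scalerA mulVf ?pnatr_eq0// scale1r subrr.
Qed.

Lemma flat_twistor_not_integrable : ~ generates_integrable M flat_twistor.
Proof.
have oM := @domain_open R 3 M.
pose V (a : 'I_(3 + 3)) (b c : 'I_3) (f g : 'rV[R]_(3 + 3) -> C) : vfield R (3 + 3) := fun x =>
  delta_mx 0 a + f x *: delta_mx 0 (rshift 3 b) - g x *: delta_mx 0 (rshift 3 c).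
pose z i : 'rV[R]_(3 + 3) -> C := fun x => (x 0 (lshift 3 i))%:C%C.
(* X and Y are the lifts of the first two coordinate fields e_i to the graph of the cross
   product. *)
pose X : vfield R (3 + 3) := V (lshift 3 o0) o2 o1 (z o1) (z o2).
pose Y : vfield R (3 + 3) := V (lshift 3 o1) o0 o2 (z o2) (z o0).
have sz i : csmooth (domain M) (z i) by apply: csmooth_real; exact: smooth_coord.
have sV a b c f g : csmooth (domain M) f -> csmooth (domain M) g -> smooth_vfield (domain M) (V a b c f g).
  move=> sf sg k; apply: (csmooth_ext oM (f := fun x => (delta_mx 0 a : 'rV[C]_(3 + 3)) 0 k
    + f x * (delta_mx 0 (rshift 3 b) : 'rV[C]_(3 + 3)) 0 k
    - g x * (delta_mx 0 (rshift 3 c) : 'rV[C]_(3 + 3)) 0 k)) => [x _|].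
    by rewrite !mxE.
  by apply: (csmoothB oM); [apply: (csmoothD oM); first exact: csmooth_cst|];
    apply: (csmoothM oM) => //; exact: csmooth_cst.
move=> H; have Ux : domain M 0 by [].
have VE a b c f g x k : V a b c f g x 0 k = (k == a)%:R + f x * (k == rshift 3 b)%:R
    - g x * (k == rshift 3 c)%:R by rewrite !mxE !eqxx.
have X0 x : domain M x -> X x \in annihilator M flat_twistor x.
  move=> _; rewrite mem_annihilator cliffordE flat_coord; apply/eqP/cliff_flat_twistor.
  by rewrite !VE !(eq_rlshift, eq_lrshift) /=; split; rewrite ?eq_lshift ?eq_rshift /= /z; ring.
have Y0 x : domain M x -> Y x \in annihilator M flat_twistor x.
  move=> _; rewrite mem_annihilator cliffordE flat_coord; apply/eqP/cliff_flat_twistor.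
  by rewrite !VE !(eq_rlshift, eq_lrshift) /=; split; rewrite ?eq_lshift ?eq_rshift /= /z; ring.
(* At the origin the null space is V, so every theta-component of the bracket would vanish; its last
   one is -1 - 1. *)
have := H X Y (sV _ _ _ _ _ (sz _) (sz _)) (sV _ _ _ _ _ (sz _) (sz _)) X0 Y0 0 Ux.
rewrite mem_annihilator cliffordE flat_coord => /eqP/cliff_flat_twistor[_ _].
rewrite 2![(0 : 'rV[R]_(3 + 3)) 0 _]mxE rmorph0 !mulr0 subr0 mxE.
have z0 i : z i 0 = 0 by rewrite /z mxE rmorph0.
have -> : X 0 = delta_mx 0 (lshift 3 o0) by rewrite /X /V !z0 !scale0r addr0 subr0.
have -> : Y 0 = delta_mx 0 (lshift 3 o1) by rewrite /Y /V !z0 !scale0r addr0 subr0.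
rewrite !vderiv_delta.
move=> h; have /eqP : - 1 - 1 = 0 :> C.
  rewrite -[RHS]h; congr (_ - _); apply/esym.
    transitivity (cpartial (lshift 3 o0) (fun y : 'rV[R]_(3 + 3) => - (y 0 (lshift 3 o0))%:C%C) 0).
      congr cpartial; apply/funext => y.
      by rewrite VE eq_rlshift !eq_rshift /= mulr0 mulr1 !add0r.
    by rewrite cpartial_coordN eqxx.
  transitivity (cpartial (lshift 3 o1) (fun y : 'rV[R]_(3 + 3) => (y 0 (lshift 3 o1))%:C%C) 0).
    congr cpartial; apply/funext => y.
    by rewrite VE eq_rlshift !eq_rshift /= mulr0 mulr1 add0r subr0.
  by rewrite cpartial_coord eqxx.
by rewrite -opprD oppr_eq0 -(natrD _ 1 1) pnatr_eq0.
Qed.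

End FlatTwistor.


(** * The dimensions 2n = 4, 2n = 6 and 2n >= 8 put together *)

Theorem theorem5 (R : realType) :
  (forall (M : framed_domain R 2) (phi : 'rV[R]_(2 + 2) -> spinor R 2),
     pure_spinor_field M phi ->
     ((exists nabla : spinor_operator,
         spinorial_connection M nabla /\ is_twistor M nabla phi) ->
      generates_integrable M phi)
     /\
     (generates_integrable M phi ->
      exists A : 'rV[R]_(2 + 2) -> 'rV[R[i]]_(2 + 2),
        smooth_one_form M A /\ spinorial_connection M (spin_conn M A) /\
        is_twistor M (spin_conn M A) phi))
  /\
  ((exists (M : framed_domain R 3) (nabla : spinor_operator)
      (phi : 'rV[R]_(3 + 3) -> spinor R 3),
      pure_spinor_field M phi /\ spinorial_connection M nabla /\
      is_twistor M nabla phi /\ ~ generates_integrable M phi)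
   /\
   (exists (M : framed_domain R 3) (phi : 'rV[R]_(3 + 3) -> spinor R 3),
      pure_spinor_field M phi /\ generates_integrable M phi /\
      forall A : 'rV[R]_(3 + 3) -> 'rV[R[i]]_(3 + 3),
        smooth_one_form M A -> ~ is_twistor M (spin_conn M A) phi))
  /\
  (forall n : nat, (8 <= 2 * n)%N ->
     (forall (M : framed_domain R n) (phi : 'rV[R]_(n + n) -> spinor R n),
        pure_spinor_field M phi ->
        (exists nabla : spinor_operator,
           spinorial_connection M nabla /\ is_twistor M nabla phi) ->
        generates_integrable M phi)
     /\
     (exists (M : framed_domain R n) (phi : 'rV[R]_(n + n) -> spinor R n),
        pure_spinor_field M phi /\ generates_integrable M phi /\
        forall A : 'rV[R]_(n + n) -> 'rV[R[i]]_(n + n),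
          smooth_one_form M A -> ~ is_twistor M (spin_conn M A) phi)).
Proof.
split; [|split; [split|]].
- move=> M phi pphi; split=> [[nabla [nablaP tw]]|]; last exact: integrable_twistor4.
  by apply: twistor_integrable tw => //; left.
- pose o1 : 'I_3 := lift ord0 ord0; have o12 : o1 != ord_max by [].
  pose M : framed_domain R 3 := sheared_domain 0%R ord0 o12.
  exists M, (spin_conn M (fun=> 0%R)), (@flat_twistor R).
  split; first exact: flat_twistor_pure.
  split; first by apply: spin_conn_spinorial => a; exact: csmooth_cst.
  by split; [exact: flat_twistor_is_twistor|exact: flat_twistor_not_integrable].
- pose o1 : 'I_3 := lift ord0 ord0.
  have o01 : ord0 != o1 by []. have o02 : ord0 != ord_max :> 'I_3 by [].
  have o12 : o1 != ord_max by [].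
  exists (sheared_domain 1%R ord0 o12), (fun=> vacuum).
  split; first exact: vacuum_pure.
  by split; [exact: vacuum_integrable|move=> A; exact: vacuum_not_twistor].
- move=> n n8; have n4 : (3 < n)%N by rewrite -(leq_pmul2l (m := 2)).
  split=> [M phi pphi [nabla [nablaP tw]]|].
    by apply: twistor_integrable tw => //; right.
  have [n0 n1] : (0 < n)%N /\ (1 < n)%N by split; apply: leq_trans n4.
  have n2 : (2 < n)%N by apply: leq_trans n4.
  pose p := Ordinal n0; pose q := Ordinal n1; pose r := Ordinal n2.
  have pq : p != q by []. have pr : p != r by []. have qr : q != r by [].
  exists (sheared_domain 1%R p qr), (fun=> vacuum).
  split; first exact: vacuum_pure.
  by split; [exact: vacuum_integrable|move=> A; exact: vacuum_not_twistor].
Qed.
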